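(* Let $d\ge1$ and let $X$ be a stationary, isotropic, centered Gaussian random field on $\mathbb{R}^d$ with almost surely continuous sample paths and covariance function $\rho(h)=\mathbb{E}[X(0)X(h)]$ satisfying $$\rho(h)=1-\frac{\lambda}{2}\|h\|^2+o(\|h\|^2)\quad\text{as }h\to0,$$ for some $\lambda>0$. For a constant threshold $u\in\mathbb{R}$, let $R_0^{(u)}$ be the extremal range of $X$ at the origin. Then, as $u\to\infty$, the law $\mathbb{P}(u R_0^{(u)}\in\cdot\,)$ converges weakly to a non-degenerate probability distribution.
   Context: $\|\cdot\|$ is the Euclidean norm and $B(s,r)=\{s':\|s'-s\|\le r\}$. For constant $u\in\mathbb{R}$ let $E_X(u)=\{s\in\mathbb{R}^d:X(s)>u\}$ and $\tilde R^{(u)}(s)=\sup\{r>0:B(s,r)\subset E_X(u)\}=\mathrm{dist}(s,E_X(u)^c)\in[0,+\infty]$. The extremal range $R_0^{(u)}$ is the random variable whose law is the conditional law of $\tilde R^{(u)}(0)$ given $X(0)>u$: $\mathbb{P}(R_0^{(u)}\in A)=\mathbb{P}(\tilde R^{(u)}(0)\in A\mid X(0)>u)$. A non-degenerate distribution is one that is not a point mass. *)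

(* Defs.v *)
From HB Require Import structures.
From mathcomp Require Export all_boot all_order all_algebra.
From mathcomp Require Export all_classical all_reals all_analysis.
From mathcomp Require Export measurable_realfun.

Set Implicit Arguments.
Unset Strict Implicit.
Unset Printing Implicit Defensive.

Import Order.TTheory GRing.Theory Num.Theory.
Import numFieldNormedType.Exports.

Local Open Scope classical_set_scope.
Local Open Scope ring_scope.

(* The library norm `|v| on row vectors is the sup norm; both norms induce the
   same topology, so the library's [continuous] and [nbhs] are used as is. *)
Definition enorm (R : realType) (d : nat) (v : 'rV[R]_d) : R :=
  Num.sqrt (\sum_(i < d) v 0 i ^+ 2).

Definition eball (R : realType) (d : nat) (s : 'rV[R]_d) (r : R) :
    set 'rV[R]_d :=
  [set s' | enorm (s' - s) <= r].

Section RandomFields.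
Context {R : realType} {dO : measure_display} {Omega : measurableType dO}.
Variables (P : probability Omega R) (d : nat).

Implicit Types X : 'rV[R]_d -> {RV P >-> R}.

Definition fdd X (n : nat) (s : 'I_n -> 'rV[R]_d) (A : set (n.-tuple R)) :
    \bar R :=
  P ((fun w => [tuple X (s i) w | i < n]) @^-1` A).

Definition stationary X :=
  forall (h : 'rV[R]_d) (n : nat) (s : 'I_n -> 'rV[R]_d) (A : set (n.-tuple R)),
    measurable A -> fdd X (fun i => s i + h) A = fdd X s A.

Definition isotropic X :=
  forall Q : 'M[R]_d, Q *m Q^T = 1%:M ->
  forall (n : nat) (s : 'I_n -> 'rV[R]_d) (A : set (n.-tuple R)),
    measurable A -> fdd X (fun i => s i *m Q) A = fdd X s A.

Definition centered X := forall s, 'E_P[X s]%E = 0%E.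

(* Point masses are normal laws of variance 0; they are listed separately since
   [normal_prob m 0] is not the Dirac mass at [m]. *)
Definition is_normal_law (mu : set R -> \bar R) :=
  exists m sigma : R, forall A, measurable A ->
    mu A = if sigma == 0 then \d_m A else normal_prob m sigma A.

Definition gaussian_field X :=
  forall (n : nat) (c : 'I_n -> R) (s : 'I_n -> 'rV[R]_d),
    is_normal_law (pushforward P (fun w => \sum_(i < n) c i * X (s i) w)).

Definition continuous_paths X := {ae P, forall w, continuous (fun s => X s w)}.

Definition covariance_fun X (h : 'rV[R]_d) : R :=
  fine 'E_P[(fun w => X 0 w * X h w)%R]%E.

Definition excursion X (u : R) (w : Omega) : set 'rV[R]_d :=
  [set s | u < X s w].

(* The supremum is taken in [0, +oo], hence the [maxe 0] (the library has
   [ereal_sup set0 = -oo]). *)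
Definition Rtilde X (u : R) (s : 'rV[R]_d) (w : Omega) : \bar R :=
  maxe 0%E (ereal_sup
    [set r%:E | r in [set r : R | 0 < r /\ eball s r `<=` excursion X u w]]).

(* [A |-> P(Rtilde X u 0 \in A | X 0 > u)].  The paths are only almost surely
   continuous, so for measurable [A] the numerator event is measurable only up
   to a P-null set; the outer measure [P^*] gives it the probability it has in
   the completion of [P]. *)
Definition extremal_range_law X (u : R) (A : set (\bar R)) : \bar R :=
  let E := [set w | u < X 0 w] in
  ((P^*)%mu (Rtilde X u 0 @^-1` A `&` E) / P E)%E.

End RandomFields.

(* Laws are taken on [\bar R] because the extremal range may be infinite with
   positive probability. *)
Definition weakly_converges (R : realType) (I : Type)
    (mu_ : I -> set (\bar R) -> \bar R) (F : set_system I)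
    (mu : set (\bar R) -> \bar R) :=
  forall f : \bar R -> R, continuous f ->
    (exists M : R, forall x, `|f x| <= M) ->
    (\int[mu_ i]_x (f x)%:E)%E @[i --> F] --> (\int[mu]_x (f x)%:E)%E.

Definition non_degenerate (R : realType) (nu : probability R R) :=
  ~ exists a : R, forall A : set R, measurable A -> nu A = \d_a A.

(* Main.v *)
(* Put h = 1 / u, rho = the covariance function, xi = u (X(0) - u), and let
   G = (G_1, ..., G_d) be the normalised symmetric differences
   X(h e_i) - X(- h e_i).  By stationarity and isotropy the variables
   X(0), G_1, ..., G_d are exactly orthonormal, hence independent standard
   normal variables, and for fixed s

     u (X(h s) - u) = rho(h s) xi - lambda |s|^2 / 2 + sqrt(lambda) <s, G>
                      + D(s) + o(1),

   where the residual D(s) is orthogonal to X(0).  Its variance tends to 0 and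
   its increments are small in mean square, so a chaining argument that
   conditions on {X(0) > u} costs only the factor P(X(0) > u), and D is
   uniformly small on compact sets with conditional probability close to 1.
   Hence, up to small errors, {u R > r} is the event that
   xi > lambda r^2 / 2 + r sqrt(lambda) |G|.  By the Mills ratio xi given
   X(0) > u is asymptotically a standard exponential variable, so that

     P(u R > r | X(0) > u) --> H(r) = E exp (- lambda r^2 / 2 - r sqrt(lambda) |G|).

   As H is continuous, 1 - H is the distribution function of the limit, which
   therefore has no atom.

   Independence is needed only between X(0) and a function V = exp (- |G|^2 / 2)
   of G.  The moments of V weighted by bumps exp (- t (X(0) - m)^2 / 2) follow
   from one-dimensional characteristic functions and Fubini's theorem, and the
   Hausdorff moment problem turns them into a product formula. *)

From HB Require Import structures.
Require Import Defs.
From mathcomp Require Import ring lra.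

Set Implicit Arguments.
Unset Strict Implicit.
Unset Printing Implicit Defensive.

Import Order.TTheory GRing.Theory Num.Theory.
Import numFieldNormedType.Exports.
Local Open Scope classical_set_scope.
Local Open Scope ring_scope.

(** The probability of {X(0) > u} decays like exp (- u^2 / 2), so a remainder that is small only in
    unconditional probability proves nothing. The decomposition is therefore exact at each finite u:
    the coefficient of xi is the true correlation, and differences replace derivatives because
    symmetry then makes the covariances vanish identically and not just in the limit. The expansion
    of the covariance enters through one number eta, a relative error on a fixed box.

    It makes the variance of D of order eta, but bounds the variance of its increments only by a
    constant times the squared distance. The geometric mean of the two bounds is linear in the
    distance, with a coefficient of order sqrt eta. Chaining runs on this mean; a tail bound by a
    high power, depending on d, pays for the number of grid points.

    The moment problem needs bounded variables. This is why X(0) enters through bumps: their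
    superlevel sets are bounded intervals, and these increase to rays. *)

Section measurable_sets.
Context d (T : measurableType d) {R : realType}.
Implicit Types f g : T -> R.

Lemma measurable_gt f (y : R) : measurable_fun setT f ->
  measurable [set x | y < f x].
Proof.
move=> mf; rewrite -[X in measurable X]setTI.
have := mf measurableT _ (measurable_itv `]y, +oo[).
by congr (measurable (_ `&` _)); apply/seteqP; split => x /=;
  rewrite in_itv/= andbT.
Qed.

Lemma measurable_ge f (y : R) : measurable_fun setT f ->
  measurable [set x | y <= f x].
Proof.
move=> mf; rewrite -[X in measurable X]setTI.
have := mf measurableT _ (measurable_itv `[y, +oo[).
by congr (measurable (_ `&` _)); apply/seteqP; split => x /=;
  rewrite in_itv/= andbT.
Qed.

Lemma measurable_lt_fun f g : measurable_fun setT f -> measurable_fun setT g ->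
  measurable [set x | f x < g x].
Proof.
move=> mf mg; rewrite (_ : [set x | _] = [set x | 0 < g x - f x]); last first.
  by apply/seteqP; split => x /=; rewrite subr_gt0.
by apply: measurable_gt; exact: measurable_funB.
Qed.

End measurable_sets.

(** * Normal laws *)

Section normal_law.
Context {R : realType}.
Local Notation mu := (@lebesgue_measure R).
Implicit Types (m s b h t : R) (f : R -> R).

(** The change of variables is phrased with the Radon-Nikodym derivative, which agrees almost
    everywhere with [normal_pdf]. *)
Lemma ge0_integral_normal_prob m s (f : R -> \bar R) :
  measurable_fun setT f -> (forall x, 0 <= f x)%E ->
  (\int[normal_prob m s]_x f x = \int[mu]_x (f x * (normal_pdf m s x)%:E))%E.
Proof.
move=> mf f0.
have dom := @normal_prob_dominates R m s.
rewrite -(Radon_Nikodym_SigmaFinite.change_of_variables dom)//.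
have mpdf : measurable_fun setT (fun x => (normal_pdf m s x)%:E).
  by apply/measurable_EFinP; exact: measurable_normal_pdf.
have iF := Radon_Nikodym_SigmaFinite.f_integrable dom.
apply: ae_eq_integral => //.
- by apply: emeasurable_funM => //; exact: measurable_int iF.
- exact: emeasurable_funM.
- apply: ae_eqe_mul2l.
  apply: integral_ae_eq => //.
  move=> E _ mE.
  by rewrite -(Radon_Nikodym_SigmaFinite.f_integral dom).
Qed.

(** Completing the square: exponential tilting by [b] moves the mean by b s^2. The moments, tails
    and characteristic functions of this part all come from it. *)
Lemma normal_pdf_tilt m s b x : s != 0 ->
  expR (b * x) * normal_pdf m s x =
  expR (m * b + b ^+ 2 * s ^+ 2 / 2) * normal_pdf (m + b * s ^+ 2) s x.
Proof.
move=> s0; rewrite !normal_pdfE// mulrCA [RHS]mulrCA; congr (_ * _).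
rewrite /normal_fun -!expRD; congr expR.
by field.
Qed.

Lemma ge0_integral_normal_tilt m s b f : s != 0 -> measurable_fun setT f ->
  (forall x, 0 <= f x) ->
  (\int[normal_prob m s]_x (expR (b * x) * f x)%:E =
   (expR (m * b + b ^+ 2 * s ^+ 2 / 2))%:E *
   \int[normal_prob (m + b * s ^+ 2) s]_x (f x)%:E)%E.
Proof.
move=> s0 mf f0.
have me : measurable_fun setT (fun x => expR (b * x)).
  by apply: measurableT_comp => //; exact: measurable_funM.
have mpdf m' : measurable_fun setT (normal_pdf m' s) by exact: measurable_normal_pdf.
rewrite !ge0_integral_normal_prob//=; last 3 first.
- exact/measurable_EFinP.
- by apply/measurable_EFinP; exact: measurable_funM.
- by move=> x; rewrite lee_fin mulr_ge0 ?expR_ge0.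
rewrite -ge0_integralZl//=.
- apply: eq_integral => x _; rewrite -!EFinM; congr EFin.
  rewrite mulrAC normal_pdf_tilt//; ring.
- apply: emeasurable_funM.
    by apply/measurable_EFinP; exact: mf.
  by apply/measurable_EFinP; exact: mpdf.
- by move=> x _; rewrite -EFinM lee_fin mulr_ge0// normal_pdf_ge0.
Qed.

Lemma integral_normal_expR m s b : s != 0 ->
  (\int[normal_prob m s]_x (expR (b * x))%:E =
   (expR (m * b + b ^+ 2 * s ^+ 2 / 2))%:E)%E.
Proof.
move=> s0; have := @ge0_integral_normal_tilt m s b (cst 1) s0.
under eq_integral do rewrite mulr1.
move=> ->//.
by rewrite /= integral_cst// mul1e [X in (_ * X)%E]probability_setT mule1.
Qed.

Lemma ge0_integral_normal_shift m s h f : s != 0 -> continuous f ->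
  (forall x, 0 <= f x) ->
  (\int[normal_prob (m + h) s]_x (f x)%:E =
   \int[normal_prob m s]_x (f (x + h))%:E)%E.
Proof.
move=> s0 cf f0.
have cfh : continuous (fun x => f (x + h)).
  move=> x; apply: continuous_comp; last exact: cf.
  by apply: cvgD => //; exact: cvg_cst.
have mEf : measurable_fun setT (fun x => (f x)%:E).
  by apply/measurable_EFinP; exact: continuous_measurable_fun.
have mEfh : measurable_fun setT (fun x : R => (f (x + h))%:E).
  by apply/measurable_EFinP; exact: continuous_measurable_fun.
have f0E (x : R) : (0 <= (f x)%:E)%E by rewrite lee_fin.
have fh0E (x : R) : (0 <= (f (x + h))%:E)%E by rewrite lee_fin.
rewrite (ge0_integral_normal_prob _ _ mEf f0E).
rewrite (ge0_integral_normal_prob _ _ mEfh fh0E).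
under eq_integral do rewrite -EFinM.
have dF : forall x : R, is_derive x 1 (fun x : R => x + h) 1.
  by move=> x; rewrite -[X in is_derive _ _ _ X]addr0; exact: is_deriveD.
have F'E : (fun x : R => x + h)^`()%classic = cst 1.
  by apply/funext => x; rewrite derive1E; apply: derive_val.
rewrite (@increasing_ge0_integration_by_substitutionT _ (fun x => x + h))//.
- apply: eq_integral => x _; rewrite F'E /=.
  rewrite !fctE/= mulr1 -EFinM; congr (_ * _)%:E.
  rewrite !normal_pdfE// /normal_fun; congr (_ * expR _).
  by rewrite opprD addrACA addrN addr0.
- by move=> x y xy; rewrite ltrD2r.
- by rewrite F'E => ?; exact: cvg_cst.
- by rewrite F'E; exact: is_cvg_cst.
- by rewrite F'E; exact: is_cvg_cst.
- exact: cvg_addrr_Ny.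
- exact: cvg_addrr.
- move=> x; apply: cvgM; first exact: cf.
  exact: continuous_normal_pdf.
- by move=> x; rewrite mulr_ge0// normal_pdf_ge0.
Qed.

Lemma integrable_normal_expR m s b : s != 0 ->
  (normal_prob m s).-integrable setT (fun x : R => (expR (b * x))%:E).
Proof.
move=> s0; apply/integrableP; split.
  by apply/measurable_EFinP; apply: measurableT_comp => //; exact: measurable_funM.
under eq_integral do rewrite /= ger0_norm ?expR_ge0//.
by rewrite integral_normal_expR// ltry.
Qed.

Lemma integrable_normal_expR_abs m s b : s != 0 ->
  (normal_prob m s).-integrable setT (fun x : R => (expR (b * `|x|))%:E).
Proof.
move=> s0.
apply: (@le_integrable _ _ _ (normal_prob m s) _ _ _
  (fun x : R => (expR (b * x) + expR (- b * x))%:E)) => //.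
- apply/measurable_EFinP; apply: measurableT_comp => //.
  by apply: measurable_funM => //; exact: measurableT_comp.
- move=> x _; rewrite lee_fin ger0_norm ?expR_ge0//.
  rewrite ger0_norm ?addr_ge0 ?expR_ge0//.
  by case: (ger0P x) => _; rewrite ?mulNr ?mulrN ?lerDl ?lerDr expR_ge0.
- under eq_fun do rewrite EFinD.
  by apply: integrableD => //; exact: integrable_normal_expR.
Qed.

Lemma integrable_normal_bounded m s f (M : R) : measurable_fun setT f ->
  (forall x, `|f x| <= M) -> (normal_prob m s).-integrable setT (EFin \o f).
Proof.
move=> mf fM; apply: measurable_bounded_integrable => //.
  by rewrite (le_lt_trans (probability_le1 _ _))// ltry.
exists M; split => [|y My x _]; first exact: num_real.
exact: le_trans (fM x) (ltW My).
Qed.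

(** The rules for nonnegative functions apply to [1 + f]; the contribution of the constant 1 is then
    subtracted on both sides. *)
Lemma Rintegral_normal_tilt s b f : s != 0 -> continuous f ->
  (forall x, `|f x| <= 1) ->
  \int[normal_prob 0 s]_x (expR (b * x) * f x) =
  expR (b ^+ 2 * s ^+ 2 / 2) * \int[normal_prob 0 s]_x f (x + b * s ^+ 2).
Proof.
move=> s0 cf f1.
have f1ge0 x : 0 <= 1 + f x.
  by have := f1 x; rewrite ler_norml => /andP[+ _]; rewrite -lerBlDl sub0r.
have mf : measurable_fun setT f by exact: continuous_measurable_fun.
have me : measurable_fun [set: R] (fun x : R => expR (b * x)).
  by apply: measurableT_comp => //; exact: measurable_funM.
have cfh : continuous (fun x : R => f (x + b * s ^+ 2)).
  move=> x; apply: continuous_comp; last exact: cf.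
  by apply: cvgD => //; exact: cvg_cst.
have mfh : measurable_fun [set: R] (fun x : R => f (x + b * s ^+ 2)).
  exact: continuous_measurable_fun.
have c1f : continuous (fun x : R => 1 + f x).
  by move=> x; apply: cvgD; [exact: cvg_cst|exact: cf].
have E : (\int[normal_prob 0 s]_x (expR (b * x) * (1 + f x))%:E =
   (expR (0 * b + b ^+ 2 * s ^+ 2 / 2))%:E *
    \int[normal_prob 0 s]_x (1 + f (x + b * s ^+ 2))%:E)%E.
  have m1f : measurable_fun [set: R] (fun x : R => 1 + f x).
    exact: continuous_measurable_fun.
  rewrite (@ge0_integral_normal_tilt 0 s b _ s0 m1f f1ge0).
  by rewrite (@ge0_integral_normal_shift 0 s (b * s ^+ 2) _ s0 c1f f1ge0).
have ife : (normal_prob 0 s).-integrable setT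
    (EFin \o (fun x : R => expR (b * x) * f x)).
  apply: (le_integrable measurableT _ _ (integrable_normal_expR 0 b s0)).
  - by apply/measurable_EFinP; exact: measurable_funM.
  - move=> x _; rewrite lee_fin normrM ger0_norm ?expR_ge0//.
    by rewrite ler_piMr// expR_ge0.
have ifh : (normal_prob 0 s).-integrable setT
    (EFin \o (fun x : R => f (x + b * s ^+ 2))).
  exact: (@integrable_normal_bounded 0 s _ 1 mfh (fun x => f1 _)).
have i1 : (normal_prob 0 s).-integrable setT (EFin \o (fun x : R => 1 : R)).
  apply: (@integrable_normal_bounded 0 s _ 1) => [|x]; first exact: measurable_cst.
  by rewrite normr1.
move/(congr1 fine) : E; rewrite mul0r add0r.
rewrite fineM//; last first.
  have := integrable_fin_num measurableT (integrableD measurableT i1 ifh).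
  by [].
rewrite -[fine (\int[_]_x (expR _ * _)%:E)]/(\int[normal_prob 0 s]_x (expR (b * x) * (1 + f x))).
rewrite -[fine (\int[_]_x (1 + _)%:E)]/(\int[normal_prob 0 s]_x (1 + f (x + b * s ^+ 2))).
under [in LHS]eq_Rintegral do rewrite mulrDr mulr1.
rewrite RintegralD//; last exact: integrable_normal_expR.
rewrite RintegralD//.
rewrite {1}/Rintegral integral_normal_expR// mul0r add0r/=.
rewrite Rintegral_cst//.
rewrite [X in fine X](_ : _ = 1%E); last exact: probability_setT.
by rewrite mulr1 mulrDr mulr1 => /addrI.
Qed.

Lemma measurable_cos_affine (a c : R) :
  measurable_fun [set: R] (fun x : R => cos (a * x + c)).
Proof.
apply: (@measurableT_comp _ _ _ _ _ _ (@cos R)).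
  by apply: continuous_measurable_fun; exact: continuous_cos.
by apply: measurable_funD => //; exact: measurable_funM.
Qed.

Lemma measurable_sin_affine (a c : R) :
  measurable_fun [set: R] (fun x : R => sin (a * x + c)).
Proof.
apply: (@measurableT_comp _ _ _ _ _ _ (@sin R)).
  by apply: continuous_measurable_fun; exact: continuous_sin.
by apply: measurable_funD => //; exact: measurable_funM.
Qed.

Let G s (f : R -> R) := \int[normal_prob 0 s]_x f x.

Lemma is_derive_cos_affine (a c t : R) :
  is_derive t 1 (fun t : R => cos (t * a + c)) (- (a * sin (t * a + c))).
Proof.
have d1 : is_derive t 1 (fun t : R => t * a + c) a.
  rewrite -[X in is_derive _ _ _ X]addr0; apply: is_deriveD.
  rewrite -[X in is_derive _ _ _ X]mulr1.
  have := @is_deriveM _ _ (@id R) (cst a) t 1 1 0 _ _.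
  rewrite /= scaler0 add0r; exact.
have := @is_derive1_comp _ cos (fun t : R => t * a + c) t _ _ (is_derive_cos _) d1.
by rewrite mulNr mulrC -mulNr mulNr.
Qed.

Lemma le_expR_abs (x : R) : `|x| <= expR `|x|.
Proof. by rewrite (le_trans _ (expR_ge1Dx _))// lerDr. Qed.

(** Differentiation under the integral sign, dominated by |x g(x)|. The weight serves twice: [g = 1]
    gives the characteristic function, [g = id] the second moment. *)
Lemma normal_charfun_derive s t c (g : R -> R) : s != 0 ->
  measurable_fun setT g ->
  (normal_prob 0 s).-integrable setT (EFin \o g) ->
  (normal_prob 0 s).-integrable setT (EFin \o (fun x => x * g x)) ->
  is_derive t 1 (fun t => G s (fun x => g x * cos (t * x + c)))
    (- G s (fun x => x * g x * sin (t * x + c))).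
Proof.
move=> s0 mg ig ixg.
have dd (y x : R) : is_derive y 1 (fun t : R => g x * cos (t * x + c))
    (- (x * g x * sin (y * x + c))).
  have [d v] := is_deriveZ (g x) (is_derive_cos_affine x c y).
  by apply: DeriveDef; [exact: d|rewrite v /GRing.scale/=; ring].
have p1E y : partial1of2 (fun (t x : R) => g x * cos (t * x + c)) y =
    fun x => - (x * g x * sin (y * x + c)).
  by apply/funext => x; rewrite partial1of2E; exact: (@derive_val _ _ _ _ _ _ _ (dd y x)).
have I : (`]t - 1, t + 1[%classic : set R) t.
  by rewrite /= in_itv/= gtrBl ltr01 ltrDl ltr01.
have if1 x : (`]t - 1, t + 1[%classic : set R) x ->
    (normal_prob 0 s).-integrable setT (EFin \o (fun y : R => g y * cos (x * y + c))).
  move=> _; apply: (le_integrable measurableT _ _ ig) => [|y _].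
    apply/measurable_EFinP; apply: measurable_funM => //.
    exact: measurable_cos_affine.
  by rewrite lee_fin normrM ler_piMr// ler_norml cos_geN1 cos_le1.
have iG : (normal_prob 0 s).-integrable setT (EFin \o (fun y : R => `|y * g y|)).
  exact: integrable_norm.
have D x y : (`]t - 1, t + 1[%classic : set R) x -> (setT : set R) y ->
    derivable ((fun (t x : R) => g x * cos (t * x + c))^~ y) x 1.
  by move=> _ _; exact: (@ex_derive _ _ _ _ _ _ _ (dd x y)).
have B x y : (`]t - 1, t + 1[%classic : set R) x -> (setT : set R) y ->
    `|partial1of2 (fun (t x : R) => g x * cos (t * x + c)) x y| <= `|y * g y|.
  move=> _ _; rewrite p1E normrN normrM ler_piMr//.
  by rewrite ler_norml sin_geN1 sin_le1.
have := @derivable_under_integral _ _ _ (normal_prob 0 s) _ _ measurableT _ _ _ I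
   if1 D _ (fun y => normr_ge0 _) iG B.
have := @differentiation_under_integral _ _ _ (normal_prob 0 s) _ _ measurableT _ _ _ I
   if1 D _ (fun y => normr_ge0 _) iG B.
rewrite derive1E p1E => e d.
apply: DeriveDef; first exact: d.
rewrite [LHS]e.
have iG2 : (normal_prob 0 s).-integrable setT (EFin \o (fun x : R => x * g x * sin (t * x + c))).
  apply: (le_integrable measurableT _ _ ixg).
    apply/measurable_EFinP; apply: measurable_funM; last exact: measurable_sin_affine.
    exact: measurable_funM.
  move=> x _; rewrite lee_fin [leLHS]normrM ler_piMr//.
  by rewrite ler_norml sin_geN1 sin_le1.
under eq_Rintegral do rewrite -mulN1r.
by rewrite RintegralZl// mulN1r.
Qed.

Lemma integrable_normal_id m s : s != 0 ->
  (normal_prob m s).-integrable setT (EFin \o (@id R)).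
Proof.
move=> s0; apply: (le_integrable measurableT _ _ (integrable_normal_expR_abs m 1 s0)).
  exact/measurable_EFinP.
move=> x _; rewrite lee_fin mul1r (ger0_norm (expR_ge0 _)).
exact: le_expR_abs.
Qed.

Lemma integrable_normal_sqr s : s != 0 ->
  (normal_prob 0 s).-integrable setT (EFin \o (fun x : R => x * x)).
Proof.
move=> s0; apply: (le_integrable measurableT _ _ (integrable_normal_expR_abs 0 2 s0)).
  by apply/measurable_EFinP; exact: measurable_funM.
move=> x _; rewrite lee_fin (ger0_norm (expR_ge0 _)) normrM mulr_natl mulr2n expRD.
by rewrite ler_pM ?le_expR_abs.
Qed.

Lemma is_derive_expRM (a t : R) :
  is_derive t 1 (fun t : R => expR (t * a)) (a * expR (t * a)).
Proof.
have d1 : is_derive t 1 (fun t : R => t * a) a.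
  have := @is_deriveM _ _ (@id R) (cst a) t 1 1 0 _ _.
  by rewrite /= scaler0 add0r [a *: _]mulr1; exact.
have := @is_derive1_comp _ expR (fun t : R => t * a) t _ _ (is_derive_expR _) d1.
by rewrite mulrC.
Qed.

Lemma normal_stein_derive s t c : s != 0 ->
  is_derive (0 : R) 1 (fun b => G s (fun x => expR (b * x) * sin (t * x + c)))
    (G s (fun x => x * sin (t * x + c))).
Proof.
move=> s0.
have dd (y x : R) : is_derive y 1 (fun b : R => expR (b * x) * sin (t * x + c))
     (x * expR (y * x) * sin (t * x + c)).
  have := @is_deriveM _ _ (fun b : R => expR (b * x)) (cst (sin (t * x + c))) y 1 _ 0
    (is_derive_expRM _ _) _.
  by rewrite /= scaler0 add0r [_ *: _]mulrC; exact.
have p1E y : partial1of2 (fun (b x : R) => expR (b * x) * sin (t * x + c)) y =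
    fun x => x * expR (y * x) * sin (t * x + c).
  by apply/funext => x; rewrite partial1of2E; exact: (@derive_val _ _ _ _ _ _ _ (dd y x)).
have I : (`](-1), 1[%classic : set R) 0.
  by rewrite /= in_itv/= oppr_lt0 ltr01.
have ms : measurable_fun [set: R] (fun x : R => sin (t * x + c)).
  exact: measurable_sin_affine.
have s1 x : `|sin (t * x + c)| <= 1.
  by rewrite ler_norml sin_geN1 sin_le1.
have if1 b : (`](-1), 1[%classic : set R) b ->
    (normal_prob 0 s).-integrable setT
     (EFin \o (fun y : R => expR (b * y) * sin (t * y + c))).
  move=> _; apply: (le_integrable measurableT _ _ (integrable_normal_expR 0 b s0)).
    apply/measurable_EFinP; apply: measurable_funM => //.
    by apply: measurableT_comp => //; exact: measurable_funM.
  move=> x _; rewrite lee_fin normrM ger0_norm ?expR_ge0//.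
  by rewrite ler_piMr ?expR_ge0.
(* For |b| < 1 the derivative is at most |x| e^|x|, hence at most e^(2|x|). *)
have iG := integrable_normal_expR_abs 0 2 s0.
have D b y : (`](-1), 1[%classic : set R) b -> (setT : set R) y ->
    derivable ((fun (b x : R) => expR (b * x) * sin (t * x + c))^~ y) b 1.
  by move=> _ _; exact: (@ex_derive _ _ _ _ _ _ _ (dd b y)).
have B b y : (`](-1), 1[%classic : set R) b -> (setT : set R) y ->
    `|partial1of2 (fun (b x : R) => expR (b * x) * sin (t * x + c)) b y|
      <= expR (2 * `|y|).
  rewrite /= in_itv/= => /andP[b1 b2] _; rewrite p1E normrM.
  rewrite (le_trans (ler_piMr _ (s1 _)))// normrM mulr_natl mulr2n expRD.
  rewrite ler_pM ?le_expR_abs// ger0_norm ?expR_ge0// ler_expR.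
  rewrite (le_trans (ler_norm _))// normrM ler_piMl// ler_norml.
  by rewrite !ltW.
have := @derivable_under_integral _ _ _ (normal_prob 0 s) _ _ measurableT _ _ _ I
   if1 D _ (fun y => expR_ge0 _) iG B.
have := @differentiation_under_integral _ _ _ (normal_prob 0 s) _ _ measurableT _ _ _ I
   if1 D _ (fun y => expR_ge0 _) iG B.
rewrite derive1E p1E => e d.
apply: DeriveDef; first exact: d.
rewrite [LHS]e.
by apply: eq_Rintegral => x _; rewrite mul0r expR0 mulr1.
Qed.

Lemma integrable_cstM d (T : measurableType d) (P : {measure set T -> \bar R})
    (a : R) (f : T -> R) : P.-integrable setT (EFin \o f) ->
  P.-integrable setT (EFin \o (fun x => a * f x)).
Proof. by move=> /(integrableZl measurableT a). Qed.

Lemma is_derive_expR_sqr (a t : R) :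
  is_derive t 1 (fun t : R => expR (t ^+ 2 * a)) (2 * t * a * expR (t ^+ 2 * a)).
Proof.
have d1 : is_derive t 1 (fun t : R => t ^+ 2 * a) (2 * t * a).
  have := @is_deriveM _ _ (fun t : R => t ^+ 2) (cst a) t 1 (2 * t) 0 _ _.
  rewrite /= scaler0 add0r [a *: _]mulrC; apply.
    have := @is_deriveX _ _ (@id R) 2 t 1 1 _.
    by rewrite /= expr1 [_%:A]mulr1; exact.
have := @is_derive1_comp _ expR (fun t : R => t ^+ 2 * a) t _ _ (is_derive_expR _) d1.
by rewrite mulrC.
Qed.

(** Stein's identity E[X f(X)] = s^2 E[f'(X)] for a sine wave f. The function b |->
    E[e^(bX) sin (tX + c)] is differentiated at 0 twice: under the integral sign, and in the closed
    form that tilting provides. *)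
Lemma normal_stein s t c : s != 0 ->
  G s (fun x => x * sin (t * x + c)) = s ^+ 2 * t * G s (fun x => cos (t * x + c)).
Proof.
move=> s0.
set F := G s (fun x => cos (t * x + c)).
pose S := G s (fun x => sin (t * x + c)).
have h1 := normal_stein_derive t c s0.
have E (b : R) : G s (fun x => expR (b * x) * sin (t * x + c)) =
    expR (b ^+ 2 * (s ^+ 2 / 2)) *
    (cos (b * (t * s ^+ 2)) * S + sin (b * (t * s ^+ 2)) * F).
  rewrite /G (@Rintegral_normal_tilt s b (fun x => sin (t * x + c)))//.
  - rewrite mulrA; congr (_ * _).
    have is_ : (normal_prob 0 s).-integrable setT (EFin \o (fun x : R => sin (t * x + c))).
      apply: (@integrable_normal_bounded 0 s _ 1) => [|x].
        exact: measurable_sin_affine.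
      by rewrite ler_norml sin_geN1 sin_le1.
    have ic_ : (normal_prob 0 s).-integrable setT (EFin \o (fun x : R => cos (t * x + c))).
      apply: (@integrable_normal_bounded 0 s _ 1) => [|x].
        exact: measurable_cos_affine.
      by rewrite ler_norml cos_geN1 cos_le1.
    rewrite /S /F /G -RintegralZl// -RintegralZl// -RintegralD//=; last 2 first.
    + exact: integrable_cstM.
    + exact: integrable_cstM.
    apply: eq_Rintegral => x _.
    rewrite (_ : t * (x + b * s ^+ 2) + c = (t * x + c) + b * (t * s ^+ 2)); last by ring.
    by rewrite sinD; ring.
  - move=> x; apply: (continuous_comp (f := fun x : R => t * x + c)).
      by apply: cvgD; [apply: cvgM; [exact: cvg_cst|exact: cvg_id]|exact: cvg_cst].
    exact: continuous_sin.
  - by move=> x; rewrite ler_norml sin_geN1 sin_le1.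
have h2 : is_derive (0 : R) 1 (fun b => G s (fun x => expR (b * x) * sin (t * x + c)))
    (s ^+ 2 * t * F).
  (* The sine is written as a cosine shifted by pi / 2, so that one derivative rule covers both
     terms. *)
  rewrite (_ : (fun b => _) = (fun b : R => expR (b ^+ 2 * (s ^+ 2 / 2))) *
    ((fun b : R => cos (b * (t * s ^+ 2) + 0)) * cst S +
     (fun b : R => cos (b * (t * s ^+ 2) + (- (pi / 2)))) * cst F)); last first.
    apply/funext => b; rewrite E !fctE/=; congr (_ * (cos _ * _ + _ * _)).
      by rewrite addr0.
    by rewrite cosD cosN sinN cos_pihalf sin_pihalf mulr0 add0r mulrN opprK mulr1.
  have dcst (a : R) : is_derive (0 : R) 1 (cst a) (0 : R) by exact: is_derive_cst.
  have [d v] := is_deriveM (is_derive_expR_sqr (s ^+ 2 / 2) 0)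
    (is_deriveD (is_deriveM (is_derive_cos_affine (t * s ^+ 2) 0 0) (dcst S))
       (is_deriveM (is_derive_cos_affine (t * s ^+ 2) (- (pi / 2)) 0) (dcst F))).
  apply: DeriveDef; first exact: d.
  rewrite v /= !scaler0 !add0r !mul0r !add0r !mulr0 !mul0r expr0n/= !mul0r expR0.
  rewrite sin0 sinN sin_pihalf scaler0 addr0 mulr0 oppr0 scaler0 add0r.
  rewrite !scale1r mulrN1 opprK.
  by rewrite [_ *: _]mulrC; ring.
by rewrite -(@derive_val _ _ _ _ _ _ _ h1) (@derive_val _ _ _ _ _ _ _ h2).
Qed.

(** Stein's identity reads F' = - s^2 t F, so F(t) exp (s^2 t^2 / 2) is constant. The phase [c]
    replaces complex exponentials: varying it yields the cosine and the sine transform together. *)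
Lemma normal_charfun s t c : s != 0 ->
  G s (fun x => cos (t * x + c)) = cos c * expR (- (t ^+ 2 * s ^+ 2 / 2)).
Proof.
move=> s0; pose F t := G s (fun x => cos (t * x + c)).
have charfun_derive (u : R) : is_derive u 1 F (- G s (fun x => x * sin (u * x + c))).
  have := @normal_charfun_derive s u c (cst 1) s0 (measurable_cst _).
  have -> : (fun t => G s (fun x => cst 1 x * cos (t * x + c))) = F.
    by apply/funext => v; apply: eq_Rintegral => x _; rewrite mul1r.
  have -> : G s (fun x => x * cst 1 x * sin (u * x + c)) =
      G s (fun x => x * sin (u * x + c)).
    by apply: eq_Rintegral => x _; rewrite mulr1.
  apply.
    by apply: (@integrable_normal_bounded 0 s _ 1) => // x; rewrite normr1.
  under eq_fun do rewrite mulr1.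
  exact: integrable_normal_id.
have dF (u : R) : is_derive u 1 (fun u : R => F u * expR (u ^+ 2 * (s ^+ 2 / 2))) 0.
  have [d v] := is_deriveM (charfun_derive u) (is_derive_expR_sqr (s ^+ 2 / 2) u).
  apply: DeriveDef; first exact: d.
  rewrite v normal_stein// -/(F u) /=.
  by rewrite /GRing.scale/=; field.
have := @is_derive_0_is_cst _ (fun u : R => F u * expR (u ^+ 2 * (s ^+ 2 / 2))) t 0 dF.
rewrite expr0n/= mul0r expR0 mulr1 => e.
have F0 : F 0 = cos c.
  rewrite /F /G; under eq_Rintegral do rewrite mul0r add0r.
  rewrite Rintegral_cst// [X in fine X](_ : _ = 1%E) ?mulr1//.
  exact: probability_setT.
rewrite -F0 -[LHS]/(F t) -e -[RHS]mulrA -expRD.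
by rewrite mulrA addrN expR0 mulr1.
Qed.


(** Derivative at t = 0 of E[X sin (tX)] = s^2 t exp (- s^2 t^2 / 2), the sine again being a cosine
    of phase - pi / 2. *)
Lemma normal_moment2 s : s != 0 -> G s (fun x => x * x) = s ^+ 2.
Proof.
move=> s0.
have h1 := @normal_charfun_derive s 0 (- (pi / 2)) id s0 (@measurable_id _ _ _)
  (integrable_normal_id 0 s0) (integrable_normal_sqr s0).
have E (t : R) : G s (fun x => x * cos (t * x + - (pi / 2))) =
    s ^+ 2 * t * (expR (t ^+ 2 * (- (s ^+ 2) / 2))).
  transitivity (G s (fun x => x * sin (t * x + 0))).
    apply: eq_Rintegral => x _; rewrite addr0.
    by rewrite cosD cosN sinN cos_pihalf sin_pihalf; ring.
  rewrite normal_stein// normal_charfun// cos0 mul1r; congr (_ * expR _).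
  by field.
have dl : is_derive (0 : R) (1 : R) (fun t : R => s ^+ 2 * t) (s ^+ 2).
  apply: is_derive_eq; by rewrite /GRing.scale/=; ring.
have [d v] := is_deriveM dl
  (is_derive_expR_sqr (- (s ^+ 2) / 2) 0).
have := @derive_val _ _ _ _ _ _ _ h1.
have -> : (fun t => G s (fun x => x * cos (t * x + - (pi / 2)))) =
   (fun t : R => s ^+ 2 * t) * (fun t : R => expR (t ^+ 2 * (- (s ^+ 2) / 2))).
  by apply/funext => t; rewrite E.
have -> : G s (fun x => x * x * sin (0 * x + - (pi / 2))) = - G s (fun x => x * x).
  rewrite -[RHS]mulN1r -RintegralZl//; last exact: integrable_normal_sqr.
  apply: eq_Rintegral => x _.
  by rewrite mul0r add0r sinN sin_pihalf; ring.
rewrite v opprK => <-.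
by rewrite mulr0 scale0r add0r expr0n/= mul0r expR0 scale1r.
Qed.

(** Convexity gives 1 + b a <= E e^(bX) with equality at b = 0. The difference is minimal there, so
    its derivative m - a vanishes. *)
Lemma normal_mean m s : s != 0 -> \int[normal_prob m s]_x x = m.
Proof.
move=> s0; set a := \int[normal_prob m s]_x x.
have ie b := integrable_normal_expR m b s0.
have iid := integrable_normal_id m s0.
have i1 : (normal_prob m s).-integrable setT (EFin \o cst (1 : R)).
  by apply: (@integrable_normal_bounded m s _ 1) => // x; rewrite normr1.
have H (b : R) : 1 + b * a <= expR (m * b + b ^+ 2 * s ^+ 2 / 2).
  have -> : expR (m * b + b ^+ 2 * s ^+ 2 / 2) =
     \int[normal_prob m s]_x (expR (b * x)).
    by rewrite /Rintegral integral_normal_expR.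
  have -> : 1 + b * a = \int[normal_prob m s]_x (1 + b * x).
    rewrite RintegralD//; last exact: integrable_cstM.
    rewrite Rintegral_cst// [X in fine X](_ : _ = 1%E); last exact: probability_setT.
    by rewrite mulr1 RintegralZl.
  apply: le_Rintegral => //.
  - exact: (integrableD measurableT i1 (integrable_cstM b iid)).
  - exact: ie.
  - by move=> x _; exact: expR_ge1Dx.
pose f (b : R) := expR (m * b + b ^+ 2 * s ^+ 2 / 2) - (1 + b * a).
have df (b : R) : is_derive b 1 f ((m + b * s ^+ 2) * expR (m * b + b ^+ 2 * s ^+ 2 / 2) - a).
  rewrite /f; apply: is_derive_eq.
  by rewrite /GRing.scale/=; field.
have dfd (x : R) : derivable f x 1 by exact: (@ex_derive _ _ _ _ _ _ _ (df x)).
have : is_derive (0 : R) (1 : R) f 0.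
  apply: (@derive1_at_min _ f (-1) 1 0).
  - by rewrite (@le_trans _ _ 0)// lerN10.
  - by move=> t _; exact: dfd.
  - by rewrite in_itv/= ltrN10 ltr01.
  - move=> t _; rewrite {1}/f mulr0 expr0n/= !mul0r addr0 expR0 addr0 subrr.
    by rewrite subr_ge0.
move=> /(@derive_val _ _ _ _ _ _ _).
rewrite (@derive_val _ _ _ _ _ _ _ (df 0)).
rewrite mulr0 expr0n/= !mul0r !addr0 expR0 mulr1 => /eqP.
by rewrite subr_eq0 => /eqP.
Qed.

(** Markov's inequality for e^(bX) + e^(-bX) with b = 1 / |s|, whose mean is 2 e^(1/2). Exponential
    decay suffices, as it is later weakened to a power. *)
Lemma normal_tail_expR s (y : R) : s != 0 ->
  (normal_prob 0 s [set x : R | (y < `|x|)%R] <= (2 * expR (1 / 2) * expR (- (y / `|s|)))%:E)%E.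
Proof.
move=> s0; set A := [set x : R | (y < `|x|)%R].
pose b := `|s|^-1.
have s0' : `|s| != 0 by rewrite normr_eq0.
have b0 : 0 <= b by rewrite invr_ge0.
have mA : measurable A.
  by apply: measurable_gt; exact: normr_measurable.
have iE : (normal_prob 0 s).-integrable setT
    (EFin \o (fun x : R => expR (b * x) + expR (- b * x))).
  exact: (integrableD measurableT (integrable_normal_expR 0 b s0)
     (integrable_normal_expR 0 (- b) s0)).
have bs : b ^+ 2 * s ^+ 2 = 1.
  by rewrite /b -[s ^+ 2]real_normK ?num_real// exprVn mulVf// expf_eq0.
have iV : (\int[normal_prob 0 s]_x (expR (b * x) + expR (- b * x))%:E =
   (2 * expR (1 / 2))%:E)%E.
  under eq_integral do rewrite EFinD.
  rewrite integralD//; [|exact: integrable_normal_expR..].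
  rewrite !integral_normal_expR// !mul0r !add0r sqrrN bs -EFinD; congr EFin.
  by rewrite mulr_natl mulr2n.
have le1 (x : R) : A x ->
    (1 <= expR (- (y / `|s|)) * (expR (b * x) + expR (- b * x))).
  move=> /= yx.
  have : expR (b * `|x|) <= expR (b * x) + expR (- b * x).
    by case: (ger0P x) => _; rewrite ?mulNr ?mulrN ?lerDl ?lerDr expR_ge0.
  move=> h; rewrite (le_trans _ (ler_wpM2l (expR_ge0 _) h))//.
  rewrite -expRD -[leLHS]expR0 ler_expR addrC subr_ge0 mulrC ler_wpM2l//.
  exact: ltW.
have H : (normal_prob 0 s A <=
    \int[normal_prob 0 s]_(x in A)
   (expR (- (y / `|s|)) * (expR (b * x) + expR (- b * x)))%:E)%E.
  rewrite -[leLHS]mul1e -[X in (X * _)%E]/(1%:E) -integral_cst//.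
  apply: ge0_le_integral => //.
  - apply: measurable_funTS; apply/measurable_EFinP; apply: measurable_funM => //.
    by apply: measurable_funD; apply: measurableT_comp => //; exact: measurable_funM.
apply: (le_trans H).
rewrite [(2 * expR (1 / 2) * _)%R]mulrC EFinM -iV -integralZl//.
rewrite (_ : (\int[normal_prob 0 s]_(x in A) _ =
    \int[normal_prob 0 s]_(x in A) ((expR (- (y / `|s|)))%:E *
      (expR (b * x) + expR (- b * x))%:E))%E); last by apply: eq_integral.
apply: ge0_subset_integral => //.
  apply: emeasurable_funM => //; apply/measurable_EFinP.
  by apply: measurable_funD; apply: measurableT_comp => //; exact: measurable_funM.
Qed.

End normal_law.

(** * Bounded measurable functions and laws of real random variables *)

Section integral_setfun.
Import HBNNSimple.

(** Simple functions read a set function only on measurable sets. This lets [extremal_range_law], a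
    bare set function built on an outer measure, be traded for a probability measure under the
    integral. *)
Lemma eq_integral_setfun d (T : measurableType d) (R : realType)
    (m1 m2 : set T -> \bar R) (f : T -> \bar R) :
  (forall A, measurable A -> m1 A = m2 A) ->
  (\int[m1]_x f x = \int[m2]_x f x)%E.
Proof.
move=> m12; have E (h : {nnsfun T >-> R}) : sintegral m1 h = sintegral m2 h.
  by apply: eq_fsbigr => r _; rewrite m12.
rewrite /integral; congr (ereal_sup _ - ereal_sup _)%E;
  by apply/seteqP; split => _ [h hf <-]; exists h; rewrite // E.
Qed.

End integral_setfun.

Section bounded_measurable.
Context d (T : measurableType d) {R : realType}.
Implicit Types (f g : T -> R).

(** Bounded measurable functions: closed under sums and products, and integrable for every
    probability measure. *)
Definition bmf f := measurable_fun setT f /\ exists M : R, forall x, `|f x| <= M.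

Lemma bmf_cst (a : R) : bmf (fun=> a).
Proof. by split; [exact: measurable_cst|exists `|a|]. Qed.

Lemma bmfD f g : bmf f -> bmf g -> bmf (fun x => f x + g x).
Proof.
move=> [mf [M fM]] [mg [N gN]]; split; first exact: measurable_funD.
by exists (M + N) => x; rewrite (le_trans (ler_normD _ _))// lerD.
Qed.

Lemma bmfM f g : bmf f -> bmf g -> bmf (fun x => f x * g x).
Proof.
move=> [mf [M fM]] [mg [N gN]]; split; first exact: measurable_funM.
by exists (M * N) => x; rewrite normrM ler_pM.
Qed.

Lemma bmf_le1 f : measurable_fun setT f -> (forall x, 0 <= f x <= 1) -> bmf f.
Proof.
move=> mf f1; split=> //; exists 1 => x.
by have /andP[f0 f1'] := f1 x; rewrite ger0_norm.
Qed.

Lemma bmf_indic (A : set T) : measurable A -> bmf \1_A.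
Proof.
move=> mA; apply: bmf_le1; first exact: measurable_indic.
by move=> x; rewrite indicE; case: (x \in A); rewrite /= ?lexx ?ler01.
Qed.

Lemma bmf_cos f : measurable_fun setT f -> bmf (fun x => cos (f x)).
Proof.
move=> mf; split; last by exists 1 => x; rewrite ler_norml cos_geN1 cos_le1.
apply: (@measurableT_comp _ _ _ _ _ _ (@cos R)) => //.
by apply: continuous_measurable_fun; exact: continuous_cos.
Qed.

Lemma bmf_expRN f : measurable_fun setT f -> (forall x, 0 <= f x) ->
  bmf (fun x => expR (- f x)).
Proof.
move=> mf f0; apply: bmf_le1.
  by apply: measurableT_comp => //; exact: measurableT_comp.
by move=> x; rewrite expR_ge0/= -[leRHS]expR0 ler_expR oppr_le0.
Qed.

Lemma bmf_integrable (P : probability T R) f : bmf f ->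
  P.-integrable setT (EFin \o f).
Proof.
move=> [mf [M fM]]; apply: measurable_bounded_integrable => //.
  by rewrite (le_lt_trans (probability_le1 _ _))// ltry.
exists M; split => [|y My x _]; first exact: num_real.
exact: le_trans (fM x) (ltW My).
Qed.

Lemma bmf_RintegralZ (P : probability T R) (a : R) f : bmf f ->
  \int[P]_x (a * f x) = a * \int[P]_x f x.
Proof. by move=> bf; rewrite RintegralZl//; exact: bmf_integrable. Qed.

Lemma bmf_RintegralD (P : probability T R) f g : bmf f -> bmf g ->
  \int[P]_x (f x + g x) = \int[P]_x f x + \int[P]_x g x.
Proof. by move=> bf bg; rewrite RintegralD//; exact: bmf_integrable. Qed.

Lemma bmf_RintegralB (P : probability T R) f g : bmf f -> bmf g ->
  \int[P]_x (f x - g x) = \int[P]_x f x - \int[P]_x g x.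
Proof. by move=> bf bg; rewrite RintegralB//; exact: bmf_integrable. Qed.

Lemma Rintegral_cst1 (P : probability T R) (a : R) : \int[P]_x a = a.
Proof.
by rewrite Rintegral_cst//= [X in fine X]probability_setT/= mulr1.
Qed.

Lemma bmf_le_Rintegral (P : probability T R) f g : bmf f -> bmf g ->
  (forall x, f x <= g x) -> \int[P]_x f x <= \int[P]_x g x.
Proof.
by move=> bf bg fg; apply: le_Rintegral => //; exact: bmf_integrable.
Qed.

Lemma Rintegral_indic (P : probability T R) (A : set T) : measurable A ->
  \int[P]_x (\1_A x : R) = fine (P A).
Proof. by move=> mA; rewrite /Rintegral integral_indic// setIT. Qed.

Lemma Rintegral_sum_bmf (P : probability T R) (I : Type) (r : seq I) (F : I -> T -> R) :
  (forall i, bmf (F i)) ->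
  \int[P]_x (\sum_(i <- r) F i x) = \sum_(i <- r) \int[P]_x F i x.
Proof.
move=> bF; elim: r => [|i r IH].
  under eq_Rintegral do rewrite big_nil.
  by rewrite big_nil Rintegral_cst1.
under eq_Rintegral do rewrite big_cons.
rewrite big_cons bmf_RintegralD// ?IH//.
elim: r {IH} => [|j r IH]; first by under eq_fun do rewrite big_nil; exact: bmf_cst.
by under eq_fun do rewrite big_cons; exact: bmfD.
Qed.

End bounded_measurable.

Section fubini_bounded.
Context d1 d2 (T1 : measurableType d1) (T2 : measurableType d2) {R : realType}.
Variables (P : probability T1 R) (Q : probability T2 R).

Lemma Rintegral_fubini (f : T1 * T2 -> R) : bmf f ->
  \int[P]_x \int[Q]_y f (x, y) = \int[Q]_y \int[P]_x f (x, y).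
Proof.
move=> bf.
have [mf [M fM]] := bf.
have bx x : bmf (fun y => f (x, y)).
  split; last by exists M => y; exact: fM.
  by apply: measurableT_comp => //; exact: measurable_pair1.
have by_ y : bmf (fun x => f (x, y)).
  split; last by exists M => x; exact: fM.
  by apply: measurableT_comp => //; exact: measurable_pair2.
have i12 : (P \x Q)%E.-integrable setT (EFin \o f).
  exact: (@bmf_integrable _ _ _ (P \x Q)%E).
have := Fubini i12.
rewrite /Rintegral => H; congr fine.
transitivity (\int[P]_x \int[Q]_y (EFin \o f) (x, y))%E.
  apply: eq_integral => x _; rewrite fineK//.
  by apply: integrable_fin_num => //; exact: bmf_integrable.
rewrite H; apply: eq_integral => y _; rewrite fineK//.
by apply: integrable_fin_num => //; exact: bmf_integrable.
Qed.

End fubini_bounded.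

(** * Centered normal laws, degenerate case included *)

Section centered_normal.
Context {R : realType}.
Implicit Types s t c : R.

(** The point mass at 0 must belong to the family for it to be stable under linear combinations,
    since these may vanish. *)
Definition nlaw s : probability (measurableTypeR R) R :=
  if s == 0 then (\d_(0 : measurableTypeR R) : probability _ _)
  else (normal_prob 0 s : probability _ _).

Lemma nlaw_cos s t c :
  \int[nlaw s]_x cos (t * x + c) = cos c * expR (- (t ^+ 2 * s ^+ 2 / 2)).
Proof.
rewrite /nlaw; have [->|s0] := eqVneq s 0; last exact: normal_charfun.
rewrite /Rintegral integral_dirac//; last first.
  by apply/measurable_EFinP; exact: measurable_cos_affine.
by rewrite diracT mul1e/= mulr0 add0r expr0n/= mulr0 mul0r oppr0 expR0 mulr1.
Qed.

Lemma integrable_nlaw_sqr s : (nlaw s).-integrable setT (EFin \o (fun x : R => x * x)).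
Proof.
rewrite /nlaw; have [_|s0] := eqVneq s 0; last exact: integrable_normal_sqr.
apply/integrableP; split; first by apply/measurable_EFinP; exact: measurable_funM.
rewrite integral_dirac//.
  by rewrite diracT mul1e/= mulr0 normr0 ltry.
by apply: measurableT_comp => //; apply/measurable_EFinP; exact: measurable_funM.
Qed.

Lemma nlaw_moment2 s : \int[nlaw s]_x (x * x) = s ^+ 2.
Proof.
rewrite /nlaw; have [->|s0] := eqVneq s 0; last exact: normal_moment2.
rewrite /Rintegral integral_dirac//.
  by rewrite diracT mul1e/= mulr0 expr0n.
by apply/measurable_EFinP; exact: measurable_funM.
Qed.

(** The exponential tail is weakened by z^n / n! <= e^z. A power of s^2 / y^2 still makes sense at s
    = 0 and turns a variance bound directly into a tail bound, the form that chaining consumes. *)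
Lemma nlaw_tail s (y : R) (k : nat) : 0 < y ->
  fine (nlaw s [set x : R | (y < `|x|)%R]) <=
    2 * expR (1 / 2) * (k.+1.*2)`!%:R * (s ^+ 2 / y ^+ 2) ^+ k.+1.
Proof.
move=> y0; rewrite /nlaw; have [->|s0] := eqVneq s 0.
  rewrite [X in fine X](_ : _ = 0%E); last first.
    by rewrite [LHS]diracE memNset//= normr0 ltNge ltW.
  by rewrite expr0n/= mul0r expr0n/= mulr0.
have s0' : 0 < `|s| by rewrite normr_gt0.
set z := y / `|s|; have z0 : 0 < z by rewrite divr_gt0.
have pn : 0 < (k.+1.*2)`!%:R :> R by rewrite ltr0n fact_gt0.
have ez : expR (- z) <= (k.+1.*2)`!%:R * (s ^+ 2 / y ^+ 2) ^+ k.+1.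
  have -> : s ^+ 2 / y ^+ 2 = (z ^+ 2)^-1.
    by rewrite /z exprMn exprVn invf_div real_normK ?num_real.
  rewrite expRN exprVn -exprM mul2n ler_pdivlMr ?exprn_gt0// mulrC.
  rewrite ler_pdivrMr ?expR_gt0// mulrC -ler_pdivrMr//.
  rewrite (le_trans _ (expR_ge1Dxn (k.*2.+1) (ltW z0)))// doubleS.
  by rewrite lerDr.
rewrite -mulrA -[_ * _ * _]mulrA mulrA.
apply: (@le_trans _ _ (2 * expR (1 / 2) * expR (- z))); last first.
  by rewrite ler_wpM2l// ?mulr_ge0 ?expR_ge0.
rewrite -lee_fin fineK; first exact: normal_tail_expR.
by rewrite fin_num_measure//; apply: measurable_gt; exact: normr_measurable.
Qed.

End centered_normal.

(** * Random variables with a centered normal law *)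

Section cnormal.
Context d (T : measurableType d) {R : realType} (P : probability T R).
Implicit Types (s t c : R) (B : T -> R).

Definition has_law B (mu : probability (measurableTypeR R) R) :=
  measurable_fun setT B /\ forall A : set R, measurable A -> P (B @^-1` A) = mu A.

Lemma law_ge0_integral B mu (f : R -> \bar R) : has_law B mu ->
  measurable_fun setT f -> (forall x, 0 <= f x)%E ->
  (\int[P]_x f (B x) = \int[mu]_x f x)%E.
Proof.
move=> [mB BA] mf f0.
have := @ge0_integral_pushforward _ _ _ (measurableTypeR R) R _ mB P setT f measurableT mf
  (fun x _ => f0 x).
rewrite preimage_setT => <-.
by apply: eq_integral_setfun => A mA; exact: BA.
Qed.

Lemma law_integrable B mu (f : R -> R) : has_law B mu ->
  measurable_fun setT f -> (mu).-integrable setT (EFin \o f) ->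
  P.-integrable setT (EFin \o (f \o B)).
Proof.
move=> nB mf /integrableP[_ fi]; apply/integrableP; split.
  by apply/measurable_EFinP; apply: measurableT_comp => //; exact: nB.1.
rewrite (law_ge0_integral (f := fun x => `|(EFin \o f) x|%E) nB)//.
by apply: measurableT_comp => //; exact/measurable_EFinP.
Qed.

Lemma law_Rintegral B mu (f : R -> R) : has_law B mu ->
  measurable_fun setT f -> (mu).-integrable setT (EFin \o f) ->
  \int[P]_x f (B x) = \int[mu]_x f x.
Proof.
move=> nB mf fi; have iPf := law_integrable nB mf fi.
have mf' : measurable_fun setT (EFin \o f) by exact/measurable_EFinP.
have iPf' : P.-integrable (B @^-1` setT) ((EFin \o f) \o B).
  by rewrite preimage_setT.
have := @integral_pushforward _ _ _ (measurableTypeR R) R _ nB.1 P setT _ mf' iPf' measurableT.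
rewrite preimage_setT /Rintegral => <-; congr fine.
by apply: eq_integral_setfun => A mA; exact: nB.2.
Qed.

Definition cnormal B s := has_law B (nlaw s).

Lemma cnormal_cos B s t c : cnormal B s ->
  \int[P]_x cos (t * B x + c) = cos c * expR (- (t ^+ 2 * s ^+ 2 / 2)).
Proof.
move=> nB; rewrite -nlaw_cos.
apply: (law_Rintegral (f := fun x : R => cos (t * x + c)) nB).
  exact: measurable_cos_affine.
by apply: bmf_integrable; apply: bmf_cos; apply: measurable_funD => //; exact: measurable_funM.
Qed.

Lemma cnormal_moment2 B s : cnormal B s -> \int[P]_x (B x * B x) = s ^+ 2.
Proof.
move=> nB; rewrite -nlaw_moment2.
apply: (law_Rintegral (f := fun x : R => x * x) nB).
  exact: measurable_funM.
exact: integrable_nlaw_sqr.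
Qed.

Lemma cnormal_tail B s (y : R) (k : nat) : cnormal B s -> 0 < y ->
  fine (P [set x | y < `|B x|]) <=
    2 * expR (1 / 2) * (k.+1.*2)`!%:R * (s ^+ 2 / y ^+ 2) ^+ k.+1.
Proof.
move=> [mB BA] y0; rewrite (le_trans _ (nlaw_tail s k y0))//.
rewrite -BA//; apply: measurable_gt; exact: normr_measurable.
Qed.

End cnormal.

(** * Gaussian spaces *)

Section gaussian_bump.
Context d (T : measurableType d) {R : realType} (P : probability T R).
Implicit Types (s t c m : R) (A B w : T -> R).

(* [E exp (- t (Z - m)^2 / 2)] for [Z] standard normal: the Gaussian factor is
   itself a characteristic function, so that only [E cos] has to be known. *)
Definition kappa t m : R :=
  \int[nlaw 1]_g (cos (- (Num.sqrt t * m) * g) * expR (- (t * g ^+ 2 / 2))).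

(** The hypothesis says that under the weight [w], and up to the factor [C], the variable [A] keeps
    the characteristic function of a standard normal variable. The bump is an average of cosines
    over an auxiliary normal variable; after Fubini the same outer integral [kappa] remains for
    every [w]. *)
Lemma integral_weighted_bump w A (C : R) t m : bmf w -> measurable_fun setT A ->
  (forall a c, \int[P]_x (w x * cos (a * A x + c)) = C * cos c * expR (- (a ^+ 2 / 2))) ->
  0 <= t ->
  \int[P]_x (w x * expR (- (t * (A x - m) ^+ 2 / 2))) = C * kappa t m.
Proof.
move=> bw mA H t0.
set q := Num.sqrt t.
have qE : q ^+ 2 = t by rewrite sqr_sqrtr.
pose f (z : T * R) := w z.1 * cos (q * (A z.1 - m) * z.2).
have mf1 : measurable_fun [set: T * measurableTypeR R] (fun z : T * R => w z.1).
  by apply: measurableT_comp => //; exact: bw.1.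
have bf : @bmf _ (T * measurableTypeR R)%type R f.
  apply: bmfM.
    split; first exact: mf1.
    by case: bw => _ [M wM]; exists M => z; exact: wM.
  apply: bmf_cos; apply: measurable_funM => //.
  apply: measurable_funM => //; apply: measurable_funB => //.
  by apply: measurableT_comp.
transitivity (\int[P]_x \int[nlaw 1]_g f (x, g)).
  apply: eq_Rintegral => x _.
  rewrite /f/= bmf_RintegralZ; last first.
    by apply: bmf_cos; exact: measurable_funM.
  congr (_ * _).
  have := nlaw_cos 1 (q * (A x - m)) 0.
  rewrite cos0 mul1r expr1n mulr1 exprMn qE => <-.
  by apply: eq_Rintegral => g _; rewrite addr0.
rewrite (Rintegral_fubini _ _ bf).
transitivity (\int[nlaw 1]_g (C * (cos (- (q * m) * g) * expR (- (t * g ^+ 2 / 2))))).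
  apply: eq_Rintegral => g _.
  have := H (q * g) (- (q * m) * g).
  rewrite exprMn qE mulrA => <-.
  apply: eq_Rintegral => x _; rewrite /f/=; congr (_ * cos _).
  by ring.
rewrite bmf_RintegralZ//; apply: bmfM.
  by apply: bmf_cos; exact: measurable_funM.
apply: bmf_expRN.
  by apply: measurable_funM => //; apply: measurable_funM => //; exact: measurable_funX.
by move=> x; rewrite mulr_ge0 ?invr_ge0// mulr_ge0// sqr_ge0.
Qed.

End gaussian_bump.

(** * Linear spaces of centered normal variables *)

Section gaussian_space.
Context d (T : measurableType d) {R : realType} (P : probability T R).
Implicit Types (s t c m : R) (A B w : T -> R).

Definition cov A B : R := \int[P]_x (A x * B x).

Lemma covC A B : cov A B = cov B A.
Proof. by apply: eq_Rintegral => x _; rewrite mulrC. Qed.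

(** Joint normality is encoded by closure under linear combinations, in the spirit of the
    Cramer-Wold device. *)
Definition gaussian_space (L : set (T -> R)) :=
  (forall a b A B, L A -> L B -> L (fun x => a * A x + b * B x)) /\
  (forall A, L A -> exists s, cnormal P A s).

Variable L : set (T -> R).
Hypothesis gL : gaussian_space L.

Lemma gspaceZ a A : L A -> L (fun x => a * A x).
Proof.
move=> LA; have := gL.1 a 0 A A LA LA.
by under eq_fun do rewrite mul0r addr0.
Qed.

Lemma gspaceD A B : L A -> L B -> L (fun x => A x + B x).
Proof.
move=> LA LB; have := gL.1 1 1 A B LA LB.
by under eq_fun do rewrite !mul1r.
Qed.

Lemma gspaceB A B : L A -> L B -> L (fun x => A x - B x).
Proof.
move=> LA LB; have := gL.1 1 (-1) A B LA LB.
by under eq_fun do rewrite mul1r mulN1r.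
Qed.

Lemma gspace0 A : L A -> L (fun=> 0).
Proof. by move/(gspaceZ 0); under eq_fun do rewrite mul0r. Qed.

Lemma gspace_sum A (I : Type) (r : seq I) (F : I -> T -> R) : L A ->
  (forall i, L (F i)) -> L (fun x => \sum_(i <- r) F i x).
Proof.
move=> LA LF; elim: r => [|i r IH].
  by under eq_fun do rewrite big_nil; exact: gspace0 LA.
by under eq_fun do rewrite big_cons; exact: gspaceD.
Qed.

Lemma gspace_measurable A : L A -> measurable_fun setT A.
Proof. by move=> /gL.2[s []]. Qed.

Lemma gspace_cnormal A : L A -> exists2 s, cnormal P A s & s ^+ 2 = cov A A.
Proof. by move=> /gL.2[s nA]; exists s => //; rewrite /cov (cnormal_moment2 nA). Qed.

Lemma gspace_integrable_sqr A : L A -> P.-integrable setT (EFin \o (fun x => A x * A x)).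
Proof.
move=> /gL.2[s nA].
apply: (law_integrable (f := fun x : R => x * x) nA).
  exact: measurable_funM.
exact: integrable_nlaw_sqr.
Qed.

Lemma gspace_integrableM A B : L A -> L B ->
  P.-integrable setT (EFin \o (fun x => A x * B x)).
Proof.
move=> LA LB.
have iS := integrableD measurableT (gspace_integrable_sqr LA) (gspace_integrable_sqr LB).
apply: (le_integrable measurableT _ _ iS).
  apply/measurable_EFinP; apply: measurable_funM; exact: gspace_measurable.
move=> x _; rewrite -[X in (_ <= `|X|)%E]/((A x * A x + B x * B x)%:E) lee_fin.
rewrite [leRHS]ger0_norm; last first.
  by rewrite addr_ge0// -expr2 sqr_ge0.
rewrite ler_norml; apply/andP; split.
  have : 0 <= (A x + B x) ^+ 2 by exact: sqr_ge0.
  have : 0 <= A x ^+ 2 by exact: sqr_ge0.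
  have : 0 <= B x ^+ 2 by exact: sqr_ge0.
  rewrite !expr2; nra.
have : 0 <= (A x - B x) ^+ 2 by exact: sqr_ge0.
have : 0 <= A x ^+ 2 by exact: sqr_ge0.
have : 0 <= B x ^+ 2 by exact: sqr_ge0.
rewrite !expr2; nra.
Qed.

Lemma covDl A A' B : L A -> L A' -> L B ->
  cov (fun x => A x + A' x) B = cov A B + cov A' B.
Proof.
move=> LA LA' LB; rewrite /cov -RintegralD//; last 2 first.
- exact: gspace_integrableM.
- exact: gspace_integrableM.
by apply: eq_Rintegral => x _; rewrite mulrDl.
Qed.

Lemma covZl a A B : L A -> L B -> cov (fun x => a * A x) B = a * cov A B.
Proof.
move=> LA LB; rewrite /cov -RintegralZl//; last exact: gspace_integrableM.
by apply: eq_Rintegral => x _; rewrite mulrA.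
Qed.

Lemma covBl A A' B : L A -> L A' -> L B ->
  cov (fun x => A x - A' x) B = cov A B - cov A' B.
Proof.
move=> LA LA' LB; rewrite /cov -RintegralB//; last 2 first.
- exact: gspace_integrableM.
- exact: gspace_integrableM.
by apply: eq_Rintegral => x _; rewrite mulrBl.
Qed.

Lemma covDr A B B' : L A -> L B -> L B' ->
  cov A (fun x => B x + B' x) = cov A B + cov A B'.
Proof. by move=> *; rewrite covC covDl// ![cov _ A]covC. Qed.

Lemma covBr A B B' : L A -> L B -> L B' ->
  cov A (fun x => B x - B' x) = cov A B - cov A B'.
Proof. by move=> *; rewrite covC covBl// ![cov _ A]covC. Qed.

Lemma covZr a A B : L A -> L B -> cov A (fun x => a * B x) = a * cov A B.
Proof. by move=> *; rewrite covC covZl// covC. Qed.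

Lemma cov_suml A (I : Type) (r : seq I) (F : I -> T -> R) B : L A -> L B ->
  (forall i, L (F i)) ->
  cov (fun x => \sum_(i <- r) F i x) B = \sum_(i <- r) cov (F i) B.
Proof.
move=> LA LB LF; elim: r => [|i r IH].
  rewrite big_nil /cov; under eq_Rintegral do rewrite big_nil mul0r.
  exact: Rintegral_cst1.
under [fun x => _]eq_fun do rewrite big_cons.
by rewrite big_cons covDl// ?IH//; exact: gspace_sum LA LF.
Qed.

Lemma cov_ge0 A : 0 <= cov A A.
Proof. by apply: Rintegral_ge0 => x _; rewrite -expr2 sqr_ge0. Qed.

Lemma gspace_cos A c : L A ->
  \int[P]_x cos (A x + c) = cos c * expR (- (cov A A / 2)).
Proof.
move=> LA; have [s nA sE] := gspace_cnormal LA.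
rewrite -sE -[X in X / 2]mul1r -[X in X * _ / 2](expr1n _ 2).
rewrite -(cnormal_cos 1 c nA).
by apply: eq_Rintegral => x _; rewrite mul1r.
Qed.

Section orthonormal_family.
Variables (n : nat) (G : nat -> T -> R).
Hypothesis LG : forall i, (i < n)%N -> L (G i).
Hypothesis oG : forall i j, (i < n)%N -> (j < n)%N -> cov (G i) (G j) = (i == j)%:R.

(** At [t = 1] and [k = n] this is the variable V. The parameter [t] stays free because the powers
    of V are again of this form, so that its moments are Gaussian integrals. *)
Definition gweight k t (x : T) := expR (- \sum_(i < k) (t * G i x ^+ 2 / 2)).

Lemma bmf_gweight k t : (k <= n)%N -> 0 <= t -> bmf (gweight k t).
Proof.
move=> kn t0; apply: bmf_expRN; last first.
  move=> x; apply: sumr_ge0 => i _.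
  by rewrite mulr_ge0 ?invr_ge0// mulr_ge0// sqr_ge0.
apply: measurable_sum => i; apply: measurable_funM => //.
apply: measurable_funM => //; apply: measurable_funX.
by apply: gspace_measurable; apply: LG; exact: leq_trans kn.
Qed.

(** Induction on the number of factors. For the next variable G_k the hypothesis of
    [integral_weighted_bump] follows from the product formula for two cosines: B + a G_k and B - a
    G_k are in [L], are orthogonal to the earlier G_i and have variance cov B B + a^2. *)
Lemma gweight_cos k t B c : (k <= n)%N -> 0 <= t -> L B ->
  (forall i, (i < k)%N -> cov (G i) B = 0) ->
  \int[P]_x (gweight k t x * cos (B x + c)) =
    kappa t 0 ^+ k * cos c * expR (- (cov B B / 2)).
Proof.
move=> kn t0; elim: k kn B c => [|k IH] kn B c LB oB.
  rewrite expr0 mul1r -gspace_cos//; apply: eq_Rintegral => x _.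
  by rewrite /gweight big_ord0 oppr0 expR0 mul1r.
have LGk : L (G k) by exact: LG.
have bW := bmf_gweight (ltnW kn) t0.
have mB := gspace_measurable LB.
have mG := gspace_measurable LGk.
have bc (a : R) : bmf (fun x => cos (a * B x + c)).
  by apply: bmf_cos; apply: measurable_funD => //; exact: measurable_funM.
have b2 : bmf (fun x => gweight k t x * cos (B x + c)).
  by apply: bmfM => //; apply: bmf_cos; apply: measurable_funD.
rewrite (@eq_Rintegral _ _ _ P setT (fun x => (gweight k t x * cos (B x + c)) *
  expR (- (t * (G k x - 0) ^+ 2 / 2)))); last first.
  move=> x _; rewrite /gweight big_ord_recr/= opprD expRD subr0.
  by rewrite mulrAC.
rewrite (integral_weighted_bump 0 (C := kappa t 0 ^+ k * cos c * expR (- (cov B B / 2)))) //.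
  by rewrite exprSr; ring.
move=> a e.
have orth (b : R) i : (i < k)%N -> cov (G i) (fun x => B x + b * G k x) = 0.
  move=> ik; rewrite covDr//; last 2 first.
  - by apply: LG; exact: ltn_trans kn.
  - exact: gspaceZ.
  rewrite covZr//; last by apply: LG; exact: ltn_trans kn.
  rewrite oB ?(ltn_trans ik)// oG// ?(ltn_trans ik kn)//.
  by rewrite ltn_eqF// mulr0 addr0.
have cv (b : R) : cov (fun x => B x + b * G k x) (fun x => B x + b * G k x) =
    cov B B + b ^+ 2.
  have LbG : L (fun x => b * G k x) by exact: gspaceZ.
  have LS : L (fun x => B x + b * G k x) by exact: gspaceD.
  rewrite covDl// !covDr// !(covZl, covZr)// oG// eqxx.
  rewrite (covC B (G k)) oB// !mulr0 addr0 add0r mulr1.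
  by rewrite expr2.
have H (b e' : R) : \int[P]_x (gweight k t x * cos (B x + b * G k x + e')) =
    kappa t 0 ^+ k * cos e' * expR (- ((cov B B + b ^+ 2) / 2)).
  rewrite -cv -IH//.
  - exact: ltnW.
  - by apply: gspaceD => //; exact: gspaceZ.
  - exact: orth.
have bI (b e' : R) : bmf (fun x => gweight k t x * cos (B x + b * G k x + e')).
  apply: bmfM => //; apply: bmf_cos; apply: measurable_funD => //.
  by apply: measurable_funD => //; exact: measurable_funM.
transitivity (2^-1 * \int[P]_x (gweight k t x * cos (B x + a * G k x + (c + e)) +
   gweight k t x * cos (B x + (- a) * G k x + (c - e)))).
  rewrite -bmf_RintegralZ//; last exact: bmfD.
  apply: eq_Rintegral => x _.
  rewrite (_ : B x + a * G k x + (c + e) = (B x + c) + (a * G k x + e)); last by ring.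
  rewrite (_ : B x + (- a) * G k x + (c - e) = (B x + c) - (a * G k x + e)); last by ring.
  set p := B x + c; set q := a * G k x + e.
  by rewrite (cosD p q) (cosB p q); field.
rewrite bmf_RintegralD// !H sqrrN cosD cosB.
by rewrite mulrDl opprD expRD; field.
Qed.

(** At natural [t] and [t'] these are the mixed moments of V and of a bump of [A]; their product
    form is what the moment problem turns into independence. *)
Lemma gweight_bump A t t' m : 0 <= t -> 0 <= t' -> L A -> cov A A = 1 ->
  (forall i, (i < n)%N -> cov (G i) A = 0) ->
  \int[P]_x (gweight n t x * expR (- (t' * (A x - m) ^+ 2 / 2))) =
    kappa t 0 ^+ n * kappa t' m.
Proof.
move=> t0 t'0 LA vA oA; apply: integral_weighted_bump => //.
- exact: bmf_gweight.
- exact: gspace_measurable.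
move=> a c; rewrite gweight_cos//.
- by rewrite covZl ?covZr ?vA ?mulr1 ?expr2//; exact: gspaceZ.
- exact: gspaceZ.
- by move=> i ni; rewrite covZr ?oA ?mulr0//; exact: LG.
Qed.

Lemma gweight_integral A t : 0 <= t -> L A -> \int[P]_x gweight n t x = kappa t 0 ^+ n.
Proof.
move=> t0 LA; have L0 := gspace0 LA.
have := @gweight_cos n t (fun=> 0) 0 (leqnn _) t0 L0.
rewrite cos0 mulr1; under eq_Rintegral do rewrite addr0 cos0 mulr1.
have c0 B : cov B (fun=> 0) = 0.
  by rewrite /cov; under eq_Rintegral do rewrite mulr0; exact: Rintegral_cst1.
rewrite c0 mul0r oppr0 expR0 mulr1; apply=> i _; exact: c0.
Qed.

End orthonormal_family.
End gaussian_space.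

(** * The Hausdorff moment problem *)

Section bernstein.
Context {R : realType}.
Implicit Types (x a : R) (f g : nat -> R).

(* [bern n f x] is the expectation of [f] under the binomial law of parameters
   [n] and [x]. *)
Fixpoint bern n f x : R :=
  if n is k.+1 then (1 - x) * bern k f x + x * bern k (fun i => f i.+1) x
  else f 0%N.

Lemma bern_le n f g x : 0 <= x <= 1 -> (forall i, f i <= g i) ->
  bern n f x <= bern n g x.
Proof.
move=> /andP[x0 x1]; elim: n f g => [|n IH] f g fg /=; first exact: fg.
by rewrite lerD// ler_wpM2l// ?subr_ge0// IH.
Qed.

Lemma bernD n f g x : bern n (fun i => f i + g i) x = bern n f x + bern n g x.
Proof. by elim: n f g => [//|n IH] f g /=; rewrite !IH; ring. Qed.

Lemma bernZ n f a x : bern n (fun i => a * f i) x = a * bern n f x.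
Proof. by elim: n f => [//|n IH] f /=; rewrite !IH; ring. Qed.

Lemma bern_cst n a x : bern n (fun=> a) x = a.
Proof. by elim: n => [//|n IH] /=; rewrite !IH; ring. Qed.

Lemma bern_affine n a (b : R) f x : bern n (fun i => a + b * f i) x = a + b * bern n f x.
Proof. by rewrite bernD bern_cst bernZ. Qed.

Lemma bern_sqr n a x :
  bern n (fun i => (i%:R - a) ^+ 2) x = n%:R * x * (1 - x) + (n%:R * x - a) ^+ 2.
Proof.
elim: n a => [|n IH] a /=; first by ring.
rewrite IH.
have -> : bern n (fun i => (i.+1%:R - a) ^+ 2) x =
    bern n (fun i => (i%:R - (a - 1)) ^+ 2) x.
  by congr bern; apply/funext => i; rewrite -natr1 opprB addrA addrAC.
by rewrite IH -natr1; ring.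
Qed.

(** Bernstein approximation of a Lipschitz function with a rate. The degree is a square, so that its
    root m + 1 can be written down, and the inequality (m + 1) |y| <= (m + 1)^2 + y^2 reduces the
    mean deviation to the binomial variance. *)
Lemma bern_approx (q : R -> R) (K : R) m x : 0 <= x <= 1 -> 0 <= K ->
  (forall y z, `|q y - q z| <= K * `|y - z|) ->
  `|bern (m.+1 ^ 2) (fun i => q (i%:R / (m.+1 ^ 2)%:R)) x - q x|
    <= 2 * K / m.+1%:R.
Proof.
move=> x01 K0 qK; set n := (m.+1 ^ 2)%N.
have nE : n%:R = m.+1%:R ^+ 2 :> R by rewrite /n natrX.
have m0 : 0 < m.+1%:R :> R by [].
have n0 : 0 < n%:R :> R by rewrite nE exprn_gt0.
have pt (i : nat) : `|q (i%:R / n%:R) - q x| <=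
    K / m.+1%:R + K / m.+1%:R ^+ 3 * (i%:R - n%:R * x) ^+ 2.
  apply: le_trans (qK _ _) _.
  set y := i%:R - n%:R * x.
  have -> : i%:R / n%:R - x = y / m.+1%:R ^+ 2.
    by rewrite /y -nE; field; rewrite gt_eqF.
  rewrite normrM normfV [`|m.+1%:R ^+ 2|]ger0_norm ?sqr_ge0//.
  have -> : K / m.+1%:R + K / m.+1%:R ^+ 3 * y ^+ 2 =
     K * ((m.+1%:R ^+ 2 + y ^+ 2) / m.+1%:R ^+ 3).
    by field; rewrite nat1r.
  rewrite ler_wpM2l//.
  have -> : `|y| / m.+1%:R ^+ 2 = (m.+1%:R * `|y|) / m.+1%:R ^+ 3.
    by field; rewrite nat1r.
  rewrite ler_wpM2r ?invr_ge0 ?exprn_ge0//.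
  rewrite -[y ^+ 2]real_normK ?num_real//.
  have : 0 <= (m.+1%:R - `|y|) ^+ 2 by exact: sqr_ge0.
  have : 0 <= `|y| ^+ 2 by exact: sqr_ge0.
  have : 0 <= m.+1%:R ^+ 2 :> R by exact: sqr_ge0.
  by rewrite !expr2; nra.
have bd : K / m.+1%:R + K / m.+1%:R ^+ 3 * bern n (fun i => (i%:R - n%:R * x) ^+ 2) x
    <= 2 * K / m.+1%:R.
  rewrite bern_sqr subrr expr0n/= addr0 -mulrA mulrA.
  have -> : 2 * K / m.+1%:R = K / m.+1%:R + K / m.+1%:R ^+ 3 * n%:R.
    by rewrite nE; field; rewrite nat1r.
  rewrite lerD2l -[n%:R * x * _]mulrA ler_wpM2l//.
    by rewrite mulr_ge0// invr_ge0 exprn_ge0.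
  case/andP: x01 => x0 x1; rewrite ler_piMr ?ler0n//.
  by rewrite mulr_ile1 ?subr_ge0// lerBlDr lerDl.
rewrite ler_norml; apply/andP; split.
  rewrite lerBrDr -(bern_cst n (q x) x) addrC.
  apply: le_trans (_ : _ <= bern n (fun i => q x - (K / m.+1%:R +
     K / m.+1%:R ^+ 3 * (i%:R - n%:R * x) ^+ 2)) x) _; last first.
    apply: bern_le => // i; have := pt i; rewrite ler_norml => /andP[+ _].
    by rewrite lerBrDr addrC.
  have -> : bern n (fun i => q x - (K / m.+1%:R +
     K / m.+1%:R ^+ 3 * (i%:R - n%:R * x) ^+ 2)) x =
     q x - (K / m.+1%:R + K / m.+1%:R ^+ 3 * bern n (fun i => (i%:R - n%:R * x) ^+ 2) x).
    transitivity (bern n (fun i => (q x - K / m.+1%:R) +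
        (- (K / m.+1%:R ^+ 3)) * (i%:R - n%:R * x) ^+ 2) x).
      by congr bern; apply/funext => i; ring.
    by rewrite bern_affine; ring.
  by rewrite bern_cst lerD2l lerN2.
rewrite lerBlDr.
apply: le_trans (_ : _ <= bern n (fun i => (K / m.+1%:R +
   K / m.+1%:R ^+ 3 * (i%:R - n%:R * x) ^+ 2) + q x) x) _.
  apply: bern_le => // i; have := pt i; rewrite ler_norml => /andP[_ +].
  by rewrite lerBlDr.
by rewrite !bernD !bern_cst bernZ lerD2r.
Qed.

End bernstein.

(** * Weighted moments on [0, 1] determine weighted laws *)

Section hausdorff.
Context d (T : measurableType d) {R : realType} (P : probability T R).
Implicit Types (w V : T -> R).

Lemma cvg_Rintegral_eventually (f_ : nat -> T -> R) (f : T -> R) (M : R) :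
  (forall n, measurable_fun setT (f_ n)) -> measurable_fun setT f ->
  (forall n x, `|f_ n x| <= M) ->
  (forall x, exists N, forall n, (N <= n)%N -> f_ n x = f x) ->
  \int[P]_x f_ n x @[n --> \oo] --> \int[P]_x f x.
Proof.
move=> mf_ mf fM ev.
have iM : P.-integrable setT (fun=> M%:E).
  by have := bmf_integrable P (bmf_cst T M).
have c1 : {ae P, forall x, setT x -> (f_ n x)%:E @[n --> \oo] --> (EFin \o f) x}.
  apply/aeW => x _; apply: cvg_near_cst; have [N HN] := ev x.
  by exists N => // n /= Nn; rewrite HN.
have c2 : {ae P, forall x n, setT x -> (`|(f_ n x)%:E| <= M%:E)%E}.
  by apply/aeW => x n _; rewrite lee_fin.
have [] := @dominated_convergence _ T R P setT measurableT
  (fun n x => (f_ n x)%:E) (EFin \o f) (fun=> M%:E)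
  (fun n => (measurable_EFinP _ _).2 (mf_ n)) ((measurable_EFinP _ _).2 mf) c1 iM c2.
move=> iF _ c.
rewrite /Rintegral; apply: fine_cvg; rewrite fineK//.
exact: integrable_fin_num.
Qed.

Variables (w1 w2 V1 V2 : T -> R).
Hypotheses (bw1 : bmf w1) (bw2 : bmf w2).
Hypotheses (mV1 : measurable_fun setT V1) (mV2 : measurable_fun setT V2).
Hypotheses (V1_01 : forall x, 0 <= V1 x <= 1) (V2_01 : forall x, 0 <= V2 x <= 1).
Hypothesis moments : forall k : nat,
  \int[P]_x (w1 x * V1 x ^+ k) = \int[P]_x (w2 x * V2 x ^+ k).

Let bmf_bern n f j w V : bmf w -> measurable_fun setT V ->
  (forall x, 0 <= V x <= 1) -> bmf (fun x => w x * V x ^+ j * bern n f (V x)).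
Proof.
move=> bw mV V01.
have bV : bmf V by exact: bmf_le1.
elim: n f j => [|n IH] f j /=.
  apply: bmfM; last exact: bmf_cst.
  apply: bmfM => //; apply: bmf_le1; first exact: measurable_funX.
  by move=> x; have /andP[Vx0 Vx1] := V01 x; rewrite exprn_ge0//= exprn_ile1.
have := bmfD (bmfD (IH f j) (bmfM (bmf_cst _ (-1)) (IH f j.+1)))
   (IH (fun i => f i.+1) j.+1).
by congr bmf; apply/funext => x; rewrite exprS; ring.
Qed.

(** The recursion of [bern] multiplies by V, so the induction has to carry a free power [j]. *)
Let bern_moments n f j :
  \int[P]_x (w1 x * V1 x ^+ j * bern n f (V1 x)) =
  \int[P]_x (w2 x * V2 x ^+ j * bern n f (V2 x)).
Proof.
elim: n f j => [|n IH] f j /=.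
  have b0 w V : bmf w -> measurable_fun setT V ->
    (forall x, 0 <= V x <= 1) -> bmf (fun x => w x * V x ^+ j).
    move=> bw mV V01; have := @bmf_bern 0 (fun=> 1) j w V bw mV V01.
    by under eq_fun do rewrite /= mulr1.
  under eq_Rintegral do rewrite mulrC.
  under [in RHS]eq_Rintegral do rewrite mulrC.
  by rewrite !bmf_RintegralZ ?moments//; exact: b0.
have E w V : bmf w -> measurable_fun setT V -> (forall x, 0 <= V x <= 1) ->
  \int[P]_x (w x * V x ^+ j * ((1 - V x) * bern n f (V x) +
     V x * bern n (fun i => f i.+1) (V x))) =
  \int[P]_x (w x * V x ^+ j * bern n f (V x)) -
  \int[P]_x (w x * V x ^+ j.+1 * bern n f (V x)) +
  \int[P]_x (w x * V x ^+ j.+1 * bern n (fun i => f i.+1) (V x)).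
  move=> bw mV V01.
  rewrite -bmf_RintegralB ?bmf_bern//; [|exact: bmf_bern..].
  rewrite -bmf_RintegralD; last 2 first.
  - under eq_fun do rewrite -[X in _ + X]mulN1r.
    by apply: bmfD; [exact: bmf_bern|apply: bmfM; [exact: bmf_cst|exact: bmf_bern]].
  - exact: bmf_bern.
  by apply: eq_Rintegral => x _; rewrite exprS; ring.
by rewrite !E// !IH.
Qed.

Let lipschitz_moments (q : R -> R) (K : R) : 0 <= K ->
  (forall y z, `|q y - q z| <= K * `|y - z|) ->
  measurable_fun setT q ->
  \int[P]_x (w1 x * q (V1 x)) = \int[P]_x (w2 x * q (V2 x)).
Proof.
move=> K0 qK mq.
have [_ [M1 wM1]] := bw1; have [_ [M2 wM2]] := bw2.
have bq w V : bmf w -> measurable_fun setT V ->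
  (forall x, 0 <= V x <= 1) -> bmf (fun x => w x * q (V x)).
  move=> bw mV V01; apply: bmfM => //; split; first exact: measurableT_comp.
  exists (`|q 0| + K) => x; rewrite -[q (V x)](subrK (q 0)) addrC.
  rewrite (le_trans (ler_normD _ _))// lerD2l (le_trans (qK _ _))//.
  rewrite subr0 -[leRHS]mulr1 ler_wpM2l//.
  by have /andP[Vx0 Vx1] := V01 x; rewrite ger0_norm.
have close w V M m : bmf w -> measurable_fun setT V ->
  (forall x, 0 <= V x <= 1) -> (forall x, `|w x| <= M) ->
  `|\int[P]_x (w x * q (V x)) -
    \int[P]_x (w x * V x ^+ 0 * bern (m.+1 ^ 2) (fun i => q (i%:R / (m.+1 ^ 2)%:R)) (V x))|
    <= M * (2 * K) / m.+1%:R.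
  move=> bw mV V01 wM.
  rewrite -bmf_RintegralB; [|exact: bq|exact: bmf_bern].
  have bB : bmf (fun x => w x * q (V x) - w x * V x ^+ 0 *
      bern (m.+1 ^ 2) (fun i => q (i%:R / (m.+1 ^ 2)%:R)) (V x)).
    under eq_fun do rewrite -[X in _ + X]mulN1r.
    by apply: bmfD; [exact: bq|apply: bmfM; [exact: bmf_cst|exact: bmf_bern]].
  rewrite (le_trans (le_normr_Rintegral measurableT (bmf_integrable P bB)))//.
  rewrite -(Rintegral_cst1 P (M * (2 * K) / m.+1%:R)).
  apply: bmf_le_Rintegral; [|exact: bmf_cst|].
    split; first by apply: measurableT_comp => //; exact: bB.1.
    by have [_ [N HN]] := bB; exists N => x; rewrite normr_id.
  move=> x; rewrite expr0 mulr1 -mulrBr normrM -mulrA ler_pM// distrC.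
  exact: bern_approx.
apply/eqP; rewrite -subr_eq0 -normr_le0; apply/ler_addgt0Pr => e e0.
rewrite add0r.
pose C := M1 * (2 * K) + M2 * (2 * K).
have [m mP] : exists m : nat, C / m.+1%:R <= e.
  exists (Num.truncn `|C / e|).
  rewrite ler_pdivrMr// -ler_pdivrMl// mulrC.
  by rewrite (le_trans (ler_norm _))// ltW// truncnS_gt.
rewrite (le_trans _ mP)// /C mulrDl.
have h1 := close w1 V1 M1 m bw1 mV1 V1_01 wM1.
have h2 := close w2 V2 M2 m bw2 mV2 V2_01 wM2.
rewrite -bern_moments distrC in h2; rewrite (le_trans _ (lerD h1 h2))//.
exact: ler_distD.
Qed.

(** The ramps [q n] are Lipschitz and, at each point, equal to the indicator of the open ray from
    some [n] on. Allowing two weights and two variables covers both uses: equality of laws (weights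
    1) and independence (one weight constant, the same variable). *)
Lemma hausdorff_moments (v : R) :
  \int[P]_x (w1 x * \1_[set x | v < V1 x] x) =
  \int[P]_x (w2 x * \1_[set x | v < V2 x] x).
Proof.
pose q (n : nat) (y : R) := Num.min 1 (Num.max 0 (n%:R * (y - v))).
have q01 n y : 0 <= q n y <= 1.
  by rewrite /q le_min ler01 le_max lexx/= ge_min lexx.
have mq n : measurable_fun [set: R] (q n).
  apply: measurable_minr => //; apply: measurable_maxr => //.
  by apply: measurable_funM => //; exact: measurable_funB.
have qK n y z : `|q n y - q n z| <= n%:R * `|y - z|.
  have -> : n%:R * `|y - z| = `|n%:R * (y - v) - n%:R * (z - v)|.
    by rewrite -mulrBr normrM ger0_norm// opprB addrA subrK.
  rewrite /q; set a := n%:R * (y - v); set b := n%:R * (z - v).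
  have l01 : (0 : R) < 1 by [].
  by case: (leP 0 a) => ?; case: (leP 0 b) => ?;
    [case: (leP 1 a) => ?; case: (leP 1 b) => ?
    |case: (leP 1 a) => ?; case: (leP 1 (0 : R)) => ?
    |case: (leP 1 b) => ?; case: (leP 1 (0 : R)) => ?
    |case: (leP 1 (0 : R)) => ?];
    rewrite ler_norml; case: (ger0P (a - b)) => ?; apply/andP; split; lra.
have qE n := @lipschitz_moments (q n) n%:R (ler0n _ _) (qK n) (mq n).
have C w V : bmf w -> measurable_fun setT V ->
    \int[P]_x (w x * q n (V x)) @[n --> \oo] -->
    \int[P]_x (w x * \1_[set x | v < V x] x).
  move=> bw mV; have [mw [M wM]] := bw.
  apply: (@cvg_Rintegral_eventually _ _ M).
  - by move=> n; apply: measurable_funM => //; exact: measurableT_comp.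
  - by apply: measurable_funM => //; apply: measurable_indic; exact: measurable_gt.
  - move=> n x; rewrite normrM -[leRHS]mulr1 ler_pM//.
    by have /andP[q0 q1] := q01 n (V x); rewrite ger0_norm.
  - move=> x; have [vV|Vv] := ltP v (V x).
      exists (Num.truncn (V x - v)^-1).+1 => n Nn.
      rewrite indicE mem_set//= /q; congr (_ * _).
      have n1 : 1 <= n%:R * (V x - v).
        rewrite -ler_pdivrMr ?subr_gt0// mul1r.
        by rewrite (le_trans (ltW (truncnS_gt _)))// ler_nat.
      by rewrite max_r ?min_l// (le_trans ler01).
    exists 0%N => n _; rewrite indicE memNset/=; last by apply/negP; rewrite -leNgt.
    congr (_ * _); rewrite /q max_l ?min_r//.
    by rewrite mulr_ge0_le0// subr_le0.
have C1 := C _ _ bw1 mV1.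
rewrite (_ : (fun n => _) = (fun n => \int[P]_x (w2 x * q n (V2 x)))) in C1; last first.
  by apply/funext => n; exact: qE.
exact: (cvg_unique _ C1 (C _ _ bw2 mV2)).
Qed.

End hausdorff.

(** * Independence *)

Section ray_uniqueness.
Context d (T : measurableType d) {R : realType} (P : probability T R).
Implicit Types (w f h : T -> R).

(** Dynkin's lemma: open rays generate the Borel sets and are stable under intersection. With
    indicators and constants as weights it extends product formulas as well as equalities of
    laws. *)
Lemma ray_uniqueness w1 w2 f1 f2 (B : set R) : bmf w1 -> bmf w2 ->
  measurable_fun setT f1 -> measurable_fun setT f2 ->
  \int[P]_x w1 x = \int[P]_x w2 x ->
  (forall a, \int[P]_x (w1 x * \1_[set x | a < f1 x] x) =
             \int[P]_x (w2 x * \1_[set x | a < f2 x] x)) ->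
  measurable B ->
  \int[P]_x (w1 x * \1_(f1 @^-1` B) x) = \int[P]_x (w2 x * \1_(f2 @^-1` B) x).
Proof.
move=> bw1 bw2 mf1 mf2 w12 ray mB.
have mpre f (C : set R) : measurable_fun setT f -> measurable C -> measurable (f @^-1` C).
  by move=> mf mC; rewrite -[X in measurable X]setTI; exact: mf.
have bI w f (C : set R) : bmf w -> measurable_fun setT f -> measurable C ->
    bmf (fun x => w x * \1_(f @^-1` C) x).
  by move=> bw mf mC; apply: bmfM => //; apply: bmf_indic; exact: mpre.
apply: (@dynkin_induction _ (measurableTypeR R) (@RGenOInfty.G R) (fun B : set R =>
  \int[P]_x (w1 x * \1_(f1 @^-1` B) x) = \int[P]_x (w2 x * \1_(f2 @^-1` B) x))).
- exact: RGenOInfty.measurableE.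
- move=> _ _ [a ->] [b ->]; exists (Num.max a b).
  apply/seteqP; split => x /=; rewrite !in_itv/= !andbT gt_max.
    by move=> [-> ->].
  by move=> /andP[-> ->].
- rewrite !preimage_setT; under eq_Rintegral do rewrite indicT mulr1.
  by under [RHS]eq_Rintegral do rewrite indicT mulr1.
- move=> _ [a ->].
  have E f : f @^-1` `]a, +oo[%classic = [set x | a < f x].
    by apply/seteqP; split => x /=; rewrite in_itv/= andbT.
  by rewrite !E.
- move=> S mS SE.
  have E w f : bmf w -> measurable_fun setT f ->
    \int[P]_x (w x * \1_(f @^-1` (~` S)) x) =
    \int[P]_x w x - \int[P]_x (w x * \1_(f @^-1` S) x).
    move=> bw mf; rewrite -bmf_RintegralB//; last exact: bI.
    apply: eq_Rintegral => x _.
    rewrite !indicE; case: (pselect (S (f x))) => Sf.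
      by rewrite memNset ?mem_set//= !mulr1 mulr0 subrr.
    by rewrite mem_set ?memNset//= mulr1 mulr0 subr0.
  by rewrite !E// w12 SE.
- move=> F mF tF FE.
  have mU n : measurable (\big[setU/set0]_(k < n) F k) by exact: bigsetU_measurable.
  have mUU : measurable (\bigcup_k F k) by exact: bigcup_measurable.
  have fin n : \int[P]_x (w1 x * \1_(f1 @^-1` (\big[setU/set0]_(k < n) F k)) x) =
     \int[P]_x (w2 x * \1_(f2 @^-1` (\big[setU/set0]_(k < n) F k)) x).
    elim: n => [|n IH].
      rewrite !big_ord0 !preimage_set0.
      by rewrite !indic0; under eq_Rintegral do rewrite /= mulr0;
        under [RHS]eq_Rintegral do rewrite /= mulr0.
    have E w f : bmf w -> measurable_fun setT f ->
      \int[P]_x (w x * \1_(f @^-1` (\big[setU/set0]_(k < n.+1) F k)) x) =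
      \int[P]_x (w x * \1_(f @^-1` (\big[setU/set0]_(k < n) F k)) x) +
      \int[P]_x (w x * \1_(f @^-1` F n) x).
      move=> bw mf; rewrite -bmf_RintegralD;
        [|exact: (bI _ _ _ bw mf (mU n))|exact: (bI _ _ _ bw mf (mF n))].
      apply: eq_Rintegral => x _; rewrite -mulrDr; congr (_ * _).
      rewrite big_ord_recr/= preimage_setU.
      rewrite !indicE in_setU.
      case: (boolP (x \in f @^-1` F n)) => [|_]; last by rewrite orbF addr0.
      rewrite inE/= => Fn; rewrite orbT memNset ?add0r//= => -/=.
      rewrite -bigcup_mkord => -[k /= kn Fk].
      have e := tF k n I I (ex_intro _ (f x) (conj Fk Fn)).
      by rewrite e ltnn in kn.
    by rewrite !E// IH FE.
  have C w f : bmf w -> measurable_fun setT f ->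
    \int[P]_x (w x * \1_(f @^-1` (\big[setU/set0]_(k < n) F k)) x) @[n --> \oo] -->
    \int[P]_x (w x * \1_(f @^-1` (\bigcup_k F k)) x).
    move=> bw mf; have [mw [M wM]] := bw.
    apply: (@cvg_Rintegral_eventually _ _ _ _ _ _ M).
    - by move=> n; exact: (bI _ _ _ bw mf (mU n)).1.
    - exact: (bI _ _ _ bw mf mUU).1.
    - move=> n x; rewrite normrM -[leRHS]mulr1 ler_pM//.
      by rewrite indicE; case: (_ \in _); rewrite ?normr1 ?normr0.
    - move=> x; have [[k _ Fk]|nF] := pselect ((\bigcup_k F k) (f x)).
        exists k.+1 => n kn; rewrite !indicE !mem_set//=; first by exists k.
        by rewrite -bigcup_mkord; exists k.
      exists 0%N => n _; rewrite !indicE !memNset//= => h; apply: nF.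
      by move: h; rewrite -bigcup_mkord => -[k _ Fk]; exists k.
  have C1 := C _ _ bw1 mf1.
  rewrite (_ : (fun n => _) = (fun n =>
    \int[P]_x (w2 x * \1_(f2 @^-1` (\big[setU/set0]_(k < n) F k)) x))) in C1; last first.
    by apply/funext => n; exact: fin.
  exact: (cvg_unique _ C1 (C _ _ bw2 mf2)).
- have mB' : (@ocitv R).-sigma.-measurable B := mB.
  by rewrite RGenOInfty.measurableE in mB'.
Qed.

(** Two applications of [ray_uniqueness], in [A] and then in [V], pass from rays to Borel
    rectangles. The joint law is thus the product measure, and the region above the graph of [h] is
    measured by its sections. *)
Lemma ray_independence_integral (A V : T -> R) (h : R -> R) :
  measurable_fun setT A -> measurable_fun setT V -> measurable_fun setT h ->
  (forall a v, fine (P ([set x | a < A x] `&` [set x | v < V x])) =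
     fine (P [set x | a < A x]) * fine (P [set x | v < V x])) ->
  fine (P [set x | h (V x) < A x]) =
    \int[P]_x fine (P [set y | h (V x) < A y]).
Proof.
move=> mA mV mh ind.
have mpre f (C : set R) : measurable_fun setT f -> measurable C -> measurable (f @^-1` C).
  by move=> mf mC; rewrite -[X in measurable X]setTI; exact: mf.
have bI f (C : set R) : measurable_fun setT f -> measurable C ->
   bmf (\1_(f @^-1` C) : T -> R).
  by move=> mf mC; apply: bmf_indic; exact: mpre.
have bG f a : measurable_fun setT f -> bmf (\1_[set x | a < f x] : T -> R).
  by move=> mf; apply: bmf_indic; exact: measurable_gt.
have IP (S : set T) : measurable S -> \int[P]_x (\1_S x : R) = fine (P S).
  exact: Rintegral_indic.
have II (S S' : set T) : measurable S -> measurable S' ->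
   \int[P]_x (\1_S x * \1_S' x : R) = fine (P (S `&` S')).
  move=> mS mS'; rewrite -IP; last exact: measurableI.
  by apply: eq_Rintegral => x _; rewrite indicI.
have mgt f a : measurable_fun setT f -> measurable [set x | a < f x].
  exact: measurable_gt.
have rect1 (B : set R) v : measurable B ->
   fine (P ([set x | v < V x] `&` A @^-1` B)) =
   fine (P [set x | v < V x]) * fine (P (A @^-1` B)).
  move=> mB; rewrite -II//; [|exact: mgt|exact: mpre].
  rewrite (@ray_uniqueness _ (fun=> fine (P [set x | v < V x])) A A)//.
  - by rewrite bmf_RintegralZ ?IP//; [exact: mpre|exact: bI].
  - exact: bG.
  - exact: bmf_cst.
  - by rewrite Rintegral_cst1 IP//; exact: mgt.
  move=> a; rewrite II; [|exact: mgt..].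
  rewrite bmf_RintegralZ; last exact: bG.
  by rewrite IP; [rewrite setIC ind mulrC|exact: mgt].
have rect2 (B C : set R) : measurable B -> measurable C ->
   fine (P (V @^-1` C `&` A @^-1` B)) = fine (P (V @^-1` C)) * fine (P (A @^-1` B)).
  move=> mB mC; rewrite setIC -II//; [|exact: mpre..].
  rewrite (@ray_uniqueness _ (fun=> fine (P (A @^-1` B))) V V)//.
  - by rewrite bmf_RintegralZ ?IP// 1?mulrC//; [exact: mpre|exact: bI].
  - exact: bI.
  - exact: bmf_cst.
  - by rewrite Rintegral_cst1 IP//; exact: mpre.
  move=> a; rewrite II; [|exact: mpre|exact: mgt].
  rewrite bmf_RintegralZ; last exact: bG.
  by rewrite IP; [rewrite setIC rect1// mulrC|exact: mgt].
pose A' : {RV P >-> R} := mfun_Sub (mem_set mA).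
pose V' : {RV P >-> R} := mfun_Sub (mem_set mV).
pose m1 := distribution P V'.
pose m2 := distribution P A'.
have mVA : measurable_fun setT (fun x => (V x, A x)) by exact: measurable_fun_pair.
pose m12 := measure_function_pushforward__canonical__measure_function_Measure P mVA.
have E (X : set (R * R)) : measurable X -> (m1 \x m2)%E X = m12 X.
  apply: product_measure_unique => C B mC mB.
  rewrite /m12 /m1 /m2 /= /distribution /pushforward.
  have fP (S : set T) : measurable S -> P S = (fine (P S))%:E.
    by move=> mS; rewrite fineK// fin_num_measure.
  rewrite [LHS]fP; last first.
    by apply: measurableI; exact: mpre.
  rewrite [X in (X * _)%E]fP; last exact: mpre.
  by rewrite [X in (_ * X)%E]fP; [rewrite -EFinM -rect2|exact: mpre].
pose X := [set z : R * R | h z.1 < z.2].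
have mX : measurable X.
  apply: measurable_lt_fun; last exact: measurable_snd.
  by apply: measurableT_comp => //; exact: measurable_fst.
have EX : P [set x | h (V x) < A x] = m12 X by [].
rewrite EX -E// /product_measure1 /Rintegral; congr fine.
rewrite [LHS](@ge0_integral_pushforward _ _ T _ R V mV P setT)//=.
- rewrite preimage_setT; apply: eq_integral => x _ /=.
  rewrite fineK ?fin_num_measure//; last exact: mgt.
  rewrite /m2 /distribution /pushforward; congr (P _).
  by apply/seteqP; split => y; rewrite /xsection /= ?inE.
- exact: measurable_fun_xsection.
Qed.

Lemma eq_law_Rintegral (f1 f2 : T -> R) (q : R -> R) :
  measurable_fun setT f1 -> measurable_fun setT f2 -> measurable_fun setT q ->
  (forall x, 0 <= q x) ->
  (forall B : set R, measurable B -> P (f1 @^-1` B) = P (f2 @^-1` B)) ->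
  \int[P]_x q (f1 x) = \int[P]_x q (f2 x).
Proof.
move=> mf1 mf2 mq q0 e; rewrite /Rintegral; congr fine.
have mq' : measurable_fun setT (EFin \o q) by exact/measurable_EFinP.
have q0' (x : R) : (0 <= (EFin \o q) x)%E by rewrite lee_fin.
have := @ge0_integral_pushforward _ _ _ (measurableTypeR R) R _ mf1 P setT _ measurableT mq'
  (fun x _ => q0' x).
have := @ge0_integral_pushforward _ _ _ (measurableTypeR R) R _ mf2 P setT _ measurableT mq'
  (fun x _ => q0' x).
rewrite !preimage_setT /= => <- <-.
by apply: eq_integral_setfun => B mB; exact: e.
Qed.

Lemma ray_eq_law (f1 f2 : T -> R) (q : R -> R) :
  measurable_fun setT f1 -> measurable_fun setT f2 -> measurable_fun setT q ->
  (forall x, 0 <= q x) ->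
  (forall a, fine (P [set x | a < f1 x]) = fine (P [set x | a < f2 x])) ->
  \int[P]_x q (f1 x) = \int[P]_x q (f2 x).
Proof.
move=> mf1 mf2 mq q0 ray.
have mpre f (C : set R) : measurable_fun setT f -> measurable C ->
    measurable (f @^-1` C : set T).
  by move=> mf mC; rewrite -[X in measurable X]setTI; exact: mf.
apply: eq_law_Rintegral => // B mB.
have fP (S : set T) : measurable S -> \int[P]_x (1 * \1_S x : R) = fine (P S).
  move=> mS; rewrite bmf_RintegralZ; last exact: bmf_indic.
  by rewrite mul1r Rintegral_indic.
have H := @ray_uniqueness (fun=> 1) (fun=> 1) f1 f2 B (bmf_cst T 1) (bmf_cst T 1) mf1 mf2 erefl.
have m1 := mpre _ _ mf1 mB; have m2 := mpre _ _ mf2 mB.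
rewrite -[LHS]fineK; last by rewrite fin_num_measure.
rewrite -[RHS]fineK; last by rewrite fin_num_measure.
rewrite -(fP _ m1) -(fP _ m2) H// => a.
by rewrite (fP _ (measurable_gt a mf1)) (fP _ (measurable_gt a mf2)).
Qed.

End ray_uniqueness.

(** * Independence of a normal variable and the length of an orthogonal family *)

Section gaussian_independence.
Context d (T : measurableType d) {R : realType} (P : probability T R).
Variable L : set (T -> R).
Hypothesis gL : gaussian_space P L.
Implicit Types A : T -> R.

Let IP (S : set T) : measurable S -> \int[P]_x (\1_S x : R) = fine (P S).
Proof. exact: Rintegral_indic. Qed.

Lemma gweight_pow (G : nat -> T -> R) n k x :
  gweight G n 1 x ^+ k = gweight G n k%:R x.
Proof.
rewrite /gweight -expRM_natl mulrN mulr_sumr; congr (expR (- _)).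
by apply: eq_bigr => i _; rewrite mul1r mulrA.
Qed.

Lemma gweight_itv (G : nat -> T -> R) n t x : 0 <= t -> 0 <= gweight G n t x <= 1.
Proof.
move=> t0; rewrite expR_ge0/= -[leRHS]expR0 ler_expR oppr_le0 sumr_ge0// => i _.
by rewrite mulr_ge0 ?invr_ge0// mulr_ge0// sqr_ge0.
Qed.

Section family.
Variables (n : nat) (G : nat -> T -> R).
Hypothesis LG : forall i, (i < n)%N -> L (G i).
Hypothesis oG : forall i j, (i < n)%N -> (j < n)%N -> cov P (G i) (G j) = (i == j)%:R.
Let V := gweight G n 1.

Lemma measurable_gweight : measurable_fun setT V.
Proof. exact: (bmf_gweight gL LG (leqnn _) ler01).1. Qed.

Let mV := measurable_gweight.

Variable A : T -> R.
Hypotheses (LA : L A) (vA : cov P A A = 1).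

Lemma gweight_moment k : \int[P]_x V x ^+ k = kappa k%:R 0 ^+ n.
Proof.
rewrite -(gweight_integral gL LG oG (ler0n _ k) LA).
by apply: eq_Rintegral => x _; exact: gweight_pow.
Qed.

Hypothesis oA : forall i, (i < n)%N -> cov P (G i) A = 0.

(** The moment problem is solved twice: over the powers of a bump of [A] with weight V^k, then over
    the powers of V with the indicator of {A > a} as weight. The bump is there because [A] itself is
    unbounded. *)
Lemma gweight_indep a v :
  fine (P ([set x | a < A x] `&` [set x | v < V x])) =
  fine (P [set x | a < A x]) * fine (P [set x | v < V x]).
Proof.
have mA := gspace_measurable gL LA.
pose bump m x := expR (- (1 * (A x - m) ^+ 2 / 2)).
have bumpX m k x : bump m x ^+ k = expR (- (k%:R * (A x - m) ^+ 2 / 2)).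
  by rewrite /bump -expRM_natl mulrN; congr (expR (- _)); rewrite mul1r mulrA.
have mbump m : measurable_fun setT (bump m).
  apply: measurableT_comp => //; apply: measurableT_comp => //.
  apply: measurable_funM => //; apply: measurable_funM => //.
  by apply: measurable_funX; exact: measurable_funB.
have bump01 m x : 0 <= bump m x <= 1.
  rewrite expR_ge0/= -[leRHS]expR0 ler_expR oppr_le0.
  by rewrite mulr_ge0 ?invr_ge0// mulr_ge0// sqr_ge0.
have bVk k : bmf (fun x => V x ^+ k).
  rewrite (_ : (fun x => _) = gweight G n k%:R); last by apply/funext => x; exact: gweight_pow.
  exact: (bmf_gweight gL LG (leqnn _)).
(* The empty family yields the moments of the bump alone. *)
have G0 i : (i < 0)%N -> L (G i) by [].
have oG0 i j : (i < 0)%N -> (j < 0)%N -> cov P (G i) (G j) = (i == j)%:R by [].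
have bumpE m j : \int[P]_x bump m x ^+ j = kappa j%:R m.
  have := @gweight_bump _ _ _ _ _ gL 0 G G0 oG0 A 0 j%:R m (lexx _) (ler0n _ _) LA vA.
  rewrite expr0 mul1r => <- //.
  by apply: eq_Rintegral => x _; rewrite bumpX /gweight big_ord0 oppr0 expR0 mul1r.
have step1 k m y : \int[P]_x (V x ^+ k * \1_[set x | y < bump m x] x) =
   kappa k%:R 0 ^+ n * fine (P [set x | y < bump m x]).
  rewrite (@hausdorff_moments _ _ _ P _ (fun=> kappa k%:R 0 ^+ n) _ (bump m))//.
  - rewrite bmf_RintegralZ ?IP//; last by apply: bmf_indic; exact: measurable_gt.
    exact: measurable_gt.
  - exact: bmf_cst.
  move=> j; rewrite bmf_RintegralZ; last first.
    apply: bmf_le1; first exact: measurable_funX.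
    by move=> x; have /andP[b0 b1] := bump01 m x; rewrite exprn_ge0//= exprn_ile1.
  rewrite bumpE -(gweight_bump gL LG oG m (ler0n _ k) (ler0n _ j) LA vA oA).
  by apply: eq_Rintegral => x _; rewrite bumpX /V gweight_pow.
(* The bump centered at a + (r + 1) exceeds its value at distance r + 1 exactly on this interval,
   which increases to the ray {A > a}. *)
pose I (r : nat) := [set x | a < A x < a + 2 * r.+1%:R].
have IE r : [set x | expR (- (1 * r.+1%:R ^+ 2 / 2)) < bump (a + r.+1%:R) x] = I r.
  have r0 : 0 < r.+1%:R :> R by [].
  apply/seteqP; split => x; rewrite /I /= ltr_expR ltrN2 !mul1r ltr_pM2r// ?invr_gt0//.
    rewrite -[_ ^+ 2 < _]ltr_sqrt ?exprn_gt0// !sqrtr_sqr [`|r.+1%:R|]gtr0_norm//.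
    by rewrite ltr_norml => /andP[h1 h2]; apply/andP; split; lra.
  move=> /andP[h1 h2]; rewrite -[_ ^+ 2 < _]ltr_sqrt ?exprn_gt0//.
  rewrite !sqrtr_sqr [`|r.+1%:R|]gtr0_norm//.
  by rewrite ltr_norml; apply/andP; split; lra.
have mI r : measurable (I r) by rewrite -IE; exact: measurable_gt.
have cvI w : bmf w -> \int[P]_x (w x * \1_(I r) x) @[r --> \oo] -->
    \int[P]_x (w x * \1_[set x | a < A x] x).
  move=> bw; have [mw [M wM]] := bw.
  apply: (@cvg_Rintegral_eventually _ _ _ _ _ _ M).
  - by move=> r; apply: (bmfM bw _).1; exact: bmf_indic.
  - by apply: (bmfM bw _).1; apply: bmf_indic; exact: measurable_gt.
  - move=> r x; rewrite normrM -[leRHS]mulr1 ler_pM//.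
    by rewrite indicE; case: (_ \in _); rewrite ?normr1 ?normr0.
  - move=> x; exists (Num.truncn (A x - a)) => r Nr; congr (_ * _).
    rewrite !indicE; have [aA|Aa] := ltP a (A x).
      rewrite !mem_set//= /I/= aA/=.
      have h : A x - a < r.+1%:R.
        by rewrite (lt_le_trans (truncnS_gt _))// ler_nat ltnS.
      have : 0 <= r.+1%:R :> R by [].
      by move: h; lra.
    by rewrite !memNset//=; [apply/negP; rewrite -leNgt|
       rewrite /I/= => /andP[+ _]; rewrite ltNge Aa].
have step2 k : \int[P]_x (V x ^+ k * \1_[set x | a < A x] x) =
    kappa k%:R 0 ^+ n * fine (P [set x | a < A x]).
  have c1 := cvI _ (bVk k).
  have c2 := cvI _ (bmf_cst T (kappa k%:R 0 ^+ n)).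
  rewrite (_ : (fun r => _) = (fun r => \int[P]_x (kappa k%:R 0 ^+ n * \1_(I r) x))) in c1.
    rewrite (cvg_unique _ c1 c2) // bmf_RintegralZ ?IP//.
      exact: measurable_gt.
    by apply: bmf_indic; exact: measurable_gt.
  apply/funext => r; rewrite -IE step1 bmf_RintegralZ ?IP//.
    exact: measurable_gt.
  by apply: bmf_indic; exact: measurable_gt.
have mgA : measurable [set x | a < A x] by exact: measurable_gt.
have mgV : measurable [set x | v < V x] by exact: measurable_gt.
rewrite -IP; last exact: measurableI.
transitivity (\int[P]_x (\1_[set x | a < A x] x * \1_[set x | v < V x] x : R)).
  by apply: eq_Rintegral => x _; rewrite indicI.
rewrite (@hausdorff_moments _ _ _ P _ (fun=> fine (P [set x | a < A x])) _ V)//.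
- by rewrite bmf_RintegralZ ?IP//; exact: bmf_indic.
- exact: bmf_indic.
- exact: bmf_cst.
- by move=> x; exact: gweight_itv.
- by move=> x; exact: gweight_itv.
- move=> k; rewrite bmf_RintegralZ; last exact: bVk.
  rewrite gweight_moment mulrC -step2.
  by apply: eq_Rintegral => x _; rewrite mulrC.
Qed.

End family.

(** Both variables have the moments [kappa k%:R 0 ^+ n], which do not depend on the family. This is
    what will make the limit function independent of u. *)
Lemma gweight_law n (G G' : nat -> T -> R) A (q : R -> R) :
  (forall i, (i < n)%N -> L (G i)) ->
  (forall i j, (i < n)%N -> (j < n)%N -> cov P (G i) (G j) = (i == j)%:R) ->
  (forall i, (i < n)%N -> L (G' i)) ->
  (forall i j, (i < n)%N -> (j < n)%N -> cov P (G' i) (G' j) = (i == j)%:R) ->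
  L A -> measurable_fun setT q -> (forall x, 0 <= q x) ->
  \int[P]_x q (gweight G n 1 x) = \int[P]_x q (gweight G' n 1 x).
Proof.
move=> LG oG LG' oG' LA mq q0.
have mV := measurable_gweight LG; have mV' := measurable_gweight LG'.
apply: (@ray_eq_law _ _ _ P _ _ _ mV mV' mq q0) => a.
rewrite -(IP (measurable_gt a mV)) -(IP (measurable_gt a mV')).
have H := @hausdorff_moments _ _ _ P (fun=> 1) (fun=> 1) _ _ (bmf_cst T 1) (bmf_cst T 1)
  mV mV' (fun x => gweight_itv G n x ler01) (fun x => gweight_itv G' n x ler01).
have E (W : T -> R) : \int[P]_x (1 * W x) = \int[P]_x (W x).
  by apply: eq_Rintegral => x _; rewrite mul1r.
have {}H := H _ a; rewrite !E in H; apply: H => k.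
by rewrite !E (gweight_moment LG oG LA) (gweight_moment LG' oG' LA).
Qed.

End gaussian_independence.

(** * The Mills ratio *)

Section mills.
Context {R : realType}.
Local Notation mu := (@lebesgue_measure R).

(** The standard normal density without its constant, in the shape that [is_derive_expR_sqr]
    differentiates. *)
Definition phi (x : R) : R := expR (x ^+ 2 * (- 2^-1)).

Lemma normal_pdf01E (x : R) : normal_pdf 0 1 x = normal_peak 1 * phi x.
Proof.
rewrite normal_pdfE ?oner_eq0// /normal_fun subr0 expr1n /phi; congr (_ * expR _).
by rewrite mulrN mulNr.
Qed.

Definition gtail (u : R) : R := fine (normal_prob 0 1 `]u, +oo[%classic).

Lemma is_derive_phi (x : R) : is_derive x 1 phi (- (x * phi x)).
Proof.
have [d v] := is_derive_expR_sqr (- 2^-1) x.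
by apply: DeriveDef => //; rewrite v /phi; field.
Qed.

Lemma phi_gt0 x : 0 < phi x. Proof. exact: expR_gt0. Qed.

Lemma continuous_phi : continuous phi.
Proof.
move=> x; apply: differentiable_continuous; apply/derivable1_diffP.
by have [] := is_derive_phi x.
Qed.

Lemma cvg_phi_y : phi x / x @[x --> +oo%R] --> (0 : R).
Proof.
apply: (@squeeze_cvgr _ _ _ _ (fun=> 0) (fun x : R => expR (- x))).
- near=> x; have x2 : 2 <= x by near: x; exact: nbhs_pinfty_ge.
  have x0 : 0 < x by lra.
  rewrite (divr_ge0 (ltW (phi_gt0 x)) (ltW x0))/= ler_pdivrMr//.
  apply: (@le_trans _ _ (expR (- x))); last by rewrite ler_peMr ?expR_ge0//; lra.
  by rewrite /phi ler_expR expr2; nra.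
- exact: cvg_cst.
- exact: cvgr_expR.
Unshelve. all: by end_near. Qed.

(** - phi(x) / x is an exact antiderivative. Since 1 <= 1 + x^-2 <= 1 + t^-2 on [t, +oo[, this
    single integral gives both Mills bounds. *)
Lemma mills_integral (t : R) : 0 < t ->
  (\int[mu]_(x in `[t, +oo[) (phi x * (1 + (x ^+ 2)^-1))%:E = (phi t / t)%:E)%E.
Proof.
move=> t0.
have dF (x : R) : x != 0 ->
   is_derive x 1 (fun x : R => - (phi x / x)) (phi x * (1 + (x ^+ 2)^-1)).
  move=> x0.
  have dV := is_deriveV x0 (is_derive_id x (1 : R)).
  have [d v] := is_deriveN (is_deriveM (is_derive_phi x) dV).
  apply: DeriveDef; first exact: d.
  by rewrite v /GRing.scale/=; field.
have cF (x : R) : x != 0 -> {for x, continuous (fun x : R => phi x * (1 + (x ^+ 2)^-1))}.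
  move=> x0; apply: cvgM; first exact: continuous_phi.
  apply: cvgD; first exact: cvg_cst.
  by apply: cvgV; [rewrite expf_eq0|exact: exprn_continuous].
rewrite (@ge0_continuous_FTC2y _ _ (fun x : R => - (phi x / x)) t 0).
- by rewrite sub0e -EFinN opprK.
- by move=> x _; rewrite mulr_ge0 ?(ltW (phi_gt0 _))// addr_ge0// invr_ge0 sqr_ge0.
- apply: continuous_in_subspaceT => x; rewrite inE/= in_itv/= andbT => tx.
  by apply: cF; rewrite gt_eqF// (lt_le_trans t0).
- by rewrite -oppr0; apply: cvgN; exact: cvg_phi_y.
- move=> x tx; have [] // := dF x; by rewrite gt_eqF// (lt_trans t0).
- apply: cvg_at_right_filter.
  have [d _] := dF t (lt0r_neq0 t0).
  have : {for t, continuous (fun x : R => - (phi x / x))}.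
    by apply: differentiable_continuous; apply/derivable1_diffP.
  exact.
- move=> x; rewrite in_itv/= andbT => tx.
  have [_ v] := dF x (lt0r_neq0 (lt_trans t0 tx)).
  by rewrite derive1E v.
Qed.

Lemma gtailE (u : R) :
  (gtail u)%:E = (\int[mu]_(x in `]u, +oo[) (normal_peak 1 * phi x)%:E)%E.
Proof.
rewrite /gtail fineK; last by rewrite fin_num_measure.
by apply: eq_integral => x _; rewrite normal_pdf01E.
Qed.

Lemma measurable_phi D : measurable_fun D phi.
Proof.
by apply: measurable_funTS; apply: continuous_measurable_fun; exact: continuous_phi.
Qed.

Let wphi (t : R) : 0 < t -> measurable_fun `[t, +oo[ (fun x : R => phi x * (1 + (x ^+ 2)^-1)).
Proof.
move=> t0; apply: measurable_funM; first exact: measurable_phi.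
apply: measurable_funD => //.
apply: subspace_continuous_measurable_fun => //.
apply: continuous_in_subspaceT => x; rewrite inE/= in_itv/= andbT => tx.
have x0 : x != 0 by rewrite gt_eqF// (lt_le_trans t0).
by apply: cvgV; [rewrite expf_eq0|exact: exprn_continuous].
Qed.

Lemma mills_bounds (t : R) : 0 < t ->
  gtail t <= normal_peak 1 * (phi t / t) <= (1 + (t ^+ 2)^-1) * gtail t.
Proof.
move=> t0.
have np0 : 0 <= normal_peak 1 :> R by exact: normal_peak_ge0.
have mp : measurable_fun (`[t, +oo[%classic : set R) (fun x : R => (phi x)%:E).
  by apply/measurable_EFinP; exact: measurable_phi.
have E : (gtail t)%:E = ((normal_peak 1)%:E * \int[mu]_(x in `[t, +oo[) (phi x)%:E)%E.
  rewrite gtailE -ge0_integralZl//; last by move=> x _; rewrite lee_fin ltW// phi_gt0.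
  rewrite integral_itv_obnd_cbnd; first by apply: eq_integral.
  by apply/measurable_EFinP; apply: measurable_funM => //; exact: measurable_phi.
have w0 := wphi t0.
have c0 : (0 <= 1 + (t ^+ 2)^-1)%R by rewrite addr_ge0// invr_ge0 sqr_ge0.
apply/andP; split; rewrite -lee_fin.
  rewrite E [leRHS]EFinM -mills_integral//; apply: lee_wpmul2l; first by rewrite lee_fin.
  apply: ge0_le_integral => //.
  - by move=> x _; rewrite lee_fin ltW// phi_gt0.
  - exact/measurable_EFinP.
  - move=> x _; rewrite lee_fin ler_peMr ?(ltW (phi_gt0 _))//.
    by rewrite lerDl invr_ge0 sqr_ge0.
rewrite [leRHS]EFinM E [leRHS]muleCA [leLHS]EFinM -mills_integral//.
apply: lee_wpmul2l; first by rewrite lee_fin.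
rewrite -ge0_integralZl//; last by move=> x _; rewrite lee_fin ltW// phi_gt0.
apply: ge0_le_integral => //.
- by move=> x _; rewrite lee_fin mulr_ge0 ?(ltW (phi_gt0 _))// addr_ge0// invr_ge0 sqr_ge0.
- exact/measurable_EFinP.
- by apply: emeasurable_funM.
- move=> x; rewrite /= in_itv/= andbT => tx; rewrite -EFinM lee_fin mulrC.
  rewrite ler_wpM2r ?(ltW (phi_gt0 _))// lerD2l lef_pV2 ?posrE ?exprn_gt0//.
    by rewrite ler_pXn2r// nnegrE ltW// (lt_le_trans t0).
  exact: lt_le_trans tx.
Qed.

Lemma gtail_gt0 (t : R) : 0 < t -> 0 < gtail t.
Proof.
move=> t0; have /andP[_ h] := mills_bounds t0.
have c0 : 0 < 1 + (t ^+ 2)^-1 by rewrite ltr_wpDr// invr_ge0 sqr_ge0.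
rewrite -(pmulr_rgt0 _ c0); apply: lt_le_trans h.
by rewrite mulr_gt0 ?divr_gt0 ?phi_gt0// normal_peak_gt0// oner_eq0.
Qed.

(** The error is uniform in [x] because e^(-x) absorbs the polynomial x^2 / 2 + x + 1. Uniformity
    matters: [x] will be replaced by a random variable and integrated. *)
Lemma gtail_ratio (u x : R) : 0 < u -> 0 <= x ->
  expR (- x) - 2 / u ^+ 2 <= gtail (u + x / u) / gtail u <= expR (- x) + 2 / u ^+ 2.
Proof.
move=> u0 x0; set t := u + x / u.
have xu0 : 0 <= x / u by rewrite divr_ge0// ltW.
have ut : u <= t by rewrite lerDl.
have t0 : 0 < t by exact: lt_le_trans ut.
have g0 := gtail_gt0 u0.
have np0 : 0 < normal_peak 1 :> R by rewrite normal_peak_gt0// oner_eq0.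
have u20 : 0 < u ^+ 2 by rewrite exprn_gt0.
have phiE : phi t = phi u * (expR (- x) * expR (- (x ^+ 2 / (2 * u ^+ 2)))).
  rewrite /phi -!expRD; congr expR; rewrite /t; field.
  by rewrite gt_eqF.
have /andP[bt1 bt2] := mills_bounds t0.
have /andP[bu1 bu2] := mills_bounds u0.
have ex0 := expR_gt0 (- x).
have ex1 : expR (- x) <= 1 by rewrite -[leRHS]expR0 ler_expR oppr_le0.
have iu0 : 0 < (u ^+ 2)^-1 by rewrite invr_gt0.
apply/andP; split; last first.
  rewrite ler_pdivrMr//.
  have h : normal_peak 1 * (phi t / t) <= expR (- x) * (normal_peak 1 * (phi u / u)).
    rewrite [leRHS]mulrCA ler_pM2l// [leRHS]mulrA phiE; apply: ler_pM.
    - by rewrite !mulr_ge0 ?expR_ge0// ltW// phi_gt0.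
    - by rewrite invr_ge0 ltW.
    - rewrite [leRHS]mulrC ler_wpM2l ?(ltW (phi_gt0 _))//.
      rewrite ler_piMr ?expR_ge0// -[leRHS]expR0 ler_expR oppr_le0.
      by rewrite divr_ge0 ?sqr_ge0// mulr_ge0// ltW.
    - by rewrite lef_pV2.
  rewrite (le_trans bt1)// (le_trans h)//.
  rewrite (le_trans (ler_wpM2l (ltW ex0) bu2))// mulrA ler_wpM2r ?(ltW g0)//.
  rewrite mulrDr mulr1 lerD2l mulr_natl mulr2n.
  rewrite (le_trans (ler_wpM2r (ltW iu0) ex1))// mul1r lerDl ltW//.
rewrite ler_pdivlMr//.
have it : (t ^+ 2)^-1 <= (u ^+ 2)^-1.
  by rewrite lef_pV2 ?posrE ?exprn_gt0// ler_pXn2r// nnegrE ltW.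
have it0 : 0 < (t ^+ 2)^-1 by rewrite invr_gt0 exprn_gt0.
(* The lower bound loses three factors: [e] from the quadratic part of the exponent, [f] from 1 / t
   against 1 / u, and [k] from the Mills bound at [t]. Each is at most 1 and at least 1 minus a
   multiple of u^-2, so the losses add up. *)
pose e := expR (- (x ^+ 2 / (2 * u ^+ 2))).
have e1 : 1 - x ^+ 2 / (2 * u ^+ 2) <= e by exact: expR_ge1Dx.
have e0 : 0 < e by exact: expR_gt0.
have e2 : e <= 1.
  rewrite -[leRHS]expR0 ler_expR oppr_le0.
  by rewrite divr_ge0 ?sqr_ge0// mulr_ge0// ltW.
pose f := u / t.
have f0 : 0 < f by rewrite divr_gt0.
have f2 : f <= 1 by rewrite ler_pdivrMr// mul1r.
have f1 : 1 - x / u ^+ 2 <= f.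
  rewrite ler_pdivlMr// /t.
  have -> : (1 - x / u ^+ 2) * (u + x / u) = u - x ^+ 2 / u ^+ 3.
    by field; rewrite gt_eqF.
  by rewrite gerBl divr_ge0 ?sqr_ge0// exprn_ge0// ltW.
pose k := (1 + (t ^+ 2)^-1)^-1.
have k0 : 0 < k by rewrite invr_gt0 addr_gt0.
have k2 : k <= 1 by rewrite invf_le1 ?addr_gt0// lerDl ltW.
have k1 : 1 - (u ^+ 2)^-1 <= k.
  apply: (@le_trans _ _ (1 - (t ^+ 2)^-1)); first by rewrite lerD2l lerN2.
  rewrite /k -[leRHS]div1r ler_pdivlMr ?addr_gt0//.
  have : 0 <= (t ^+ 2)^-1 * (t ^+ 2)^-1 by rewrite mulr_ge0// ltW.
  by move: ((t ^+ 2)^-1) => z; nra.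
have h1 : expR (- x) * (e * f * k) * (normal_peak 1 * (phi u / u)) <= gtail t.
  have -> : expR (- x) * (e * f * k) * (normal_peak 1 * (phi u / u)) =
     k * (normal_peak 1 * (phi t / t)).
    by rewrite phiE -/e /f; field; rewrite !gt_eqF.
  by rewrite /k mulrC ler_pdivrMr ?addr_gt0// [leRHS]mulrC.
rewrite (le_trans _ h1)//.
have efk : 1 - (x ^+ 2 / 2 + x + 1) / u ^+ 2 <= e * f * k.
  have -> : 1 - (x ^+ 2 / 2 + x + 1) / u ^+ 2 =
     (1 - x ^+ 2 / (2 * u ^+ 2)) + (1 - x / u ^+ 2) + (1 - (u ^+ 2)^-1) - 2.
    by field; rewrite gt_eqF.
  have : e + f - 1 <= e * f.
    have : 0 <= (1 - e) * (1 - f) by rewrite mulr_ge0// subr_ge0.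
    by nra.
  have : e * f + k - 1 <= e * f * k.
    have : 0 <= (1 - e * f) * (1 - k).
      by rewrite mulr_ge0// subr_ge0// mulr_ile1// ltW.
    by nra.
  by lra.
have pol : (x ^+ 2 / 2 + x + 1) * expR (- x) <= 2.
  rewrite expRN ler_pdivrMr ?expR_gt0//.
  have := expR_ge1Dxn 1 x0; have := expR_ge1Dx x.
  by rewrite (_ : (2`!)%N = 2%N)//; lra.
have efk0 : 0 <= expR (- x) * (e * f * k).
  by apply: mulr_ge0; [exact: ltW|apply: mulr_ge0; [apply: mulr_ge0|]; exact: ltW].
apply: (@le_trans _ _ (expR (- x) * (e * f * k) * gtail u)); last first.
  by rewrite ler_wpM2l.
rewrite ler_wpM2r ?(ltW g0)//.
apply: (@le_trans _ _ (expR (- x) * (1 - (x ^+ 2 / 2 + x + 1) / u ^+ 2))); last first.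
  by rewrite ler_wpM2l// ltW.
have -> : expR (- x) * (1 - (x ^+ 2 / 2 + x + 1) / u ^+ 2) =
    expR (- x) - ((x ^+ 2 / 2 + x + 1) * expR (- x)) / u ^+ 2 by ring.
by rewrite lerD2l lerN2 ler_wpM2r// ltW.
Qed.

End mills.

(** * Chaining *)

Section union_bounds.
Context d (T : measurableType d) {R : realType} (P : probability T R).
Implicit Types E F : set T.

Lemma fineP_ge0 E : 0 <= fine (P E).
Proof. exact: fine_ge0. Qed.

Lemma fineP_le E F : measurable E -> measurable F -> E `<=` F ->
  fine (P E) <= fine (P F).
Proof.
move=> mE mF EF; rewrite fine_le ?fin_num_measure//.
by apply: le_measure => //; rewrite inE.
Qed.

Lemma fineP_setU E F : measurable E -> measurable F ->
  fine (P (E `|` F)) <= fine (P E) + fine (P F).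
Proof.
move=> mE mF; rewrite -fineD ?fin_num_measure//.
by rewrite fine_le ?fin_numD ?fin_num_measure//;
  [exact: measurableU|exact: measureU2].
Qed.

Lemma fineP_bigcup_fin (I : finType) E (F : I -> set T) : measurable E ->
  (forall i, measurable (F i)) ->
  fine (P (E `&` \bigcup_i F i)) <= \sum_i fine (P (E `&` F i)).
Proof.
move=> mE mF.
have mU : measurable (\bigcup_i F i) by exact: fin_bigcup_measurable.
rewrite -(Rintegral_indic P (measurableI _ _ mE mU)).
under eq_bigr do rewrite -(Rintegral_indic P (measurableI _ _ mE (mF _))).
have bI i : bmf (\1_(E `&` F i) : T -> R).
  by apply: bmf_indic; exact: measurableI.
rewrite -Rintegral_sum_bmf//; apply: bmf_le_Rintegral.
- by apply: bmf_indic; exact: measurableI.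
- elim: (index_enum I) => [|i r IH].
    by under eq_fun do rewrite big_nil; exact: bmf_cst.
  by under eq_fun do rewrite big_cons; exact: bmfD.
move=> x; have [[Ex [i _ Fx]]|nEU] := pselect ((E `&` \bigcup_i F i) x).
  rewrite indicE mem_set/=; last by split => //; exists i.
  by rewrite (bigD1 i)//= indicE mem_set//= lerDl sumr_ge0.
have h : \1_(E `&` \bigcup_i F i) x = 0 :> R by rewrite indicE memNset.
by rewrite h sumr_ge0.
Qed.

Lemma fineP_bigcup E (F : nat -> set T) (C : R) : 0 <= C -> measurable E ->
  (forall n, measurable (F n)) ->
  (forall n, fine (P (E `&` F n)) <= C / (2 ^ n.+1)%:R) ->
  fine (P (E `&` \bigcup_n F n)) <= C.
Proof.
move=> C0 mE mF FC.
have mU : measurable (\bigcup_n F n) by exact: bigcup_measurable.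
rewrite -lee_fin fineK ?fin_num_measure//; last exact: measurableI.
rewrite setI_bigcupr; apply: (le_trans (generalized_Boole_inequality P _ _)).
- by move=> n; exact: measurableI.
- by rewrite -setI_bigcupr; exact: measurableI.
apply: le_trans (epsilon_trick0 xpredT C0).
apply: lee_nneseries => // n _.
rewrite -[leLHS]fineK; first by rewrite lee_fin; exact: FC.
by rewrite fin_num_measure//; exact: measurableI.
Qed.

End union_bounds.

Section chaining.
Context d0 (T : measurableType d0) {R : realType} (P : probability T R).
Variables (d : nat) (D : 'rV[R]_d -> T -> R) (E : set T) (a : R).
Let k := (2 * d).+1.
Definition in_cube (t : 'rV[R]_d) := forall i, 0 <= t 0 i <= 1.
Hypothesis mD : forall t, measurable_fun setT (D t).
Hypothesis mE : measurable E.
Hypothesis a0 : 0 <= a.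
Hypothesis tail0 : forall t (y : R), in_cube t -> 0 < y ->
  fine (P (E `&` [set w | y < `|D t w|])) <= a * (1 / y ^+ 2) ^+ k.
Hypothesis tail1 : forall t t' (y dl : R), in_cube t -> in_cube t' -> 0 < y -> 0 < dl ->
  (forall i, `|t 0 i - t' 0 i| <= dl) ->
  fine (P (E `&` [set w | y < `|D t w - D t' w|])) <= a * (dl / y ^+ 2) ^+ k.

(* Mesh [16^-n] and thresholds of order [2^-n]: the [(2 d + 1)]-th power beats
   the [16^(n d)] points of the [n]-th grid. *)
Let grid n := {ffun 'I_d -> 'I_(16 ^ n).+1}.
Let pt n (f : grid n) : 'rV[R]_d := \row_i ((f i)%:R / (16 ^ n)%:R).
Let par n (f : grid n.+1) : grid n := [ffun i => inord (f i %/ 16)].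

Let pt_cube n (f : grid n) : in_cube (pt f).
Proof.
move=> i; rewrite mxE divr_ge0//=.
by rewrite ler_pdivrMr ?ltr0n ?expn_gt0// mul1r ler_nat -ltnS.
Qed.

Let pt_par n (f : grid n.+1) i : `|pt f 0 i - pt (par f) 0 i| <= ((16 ^ n)%:R)^-1.
Proof.
rewrite !mxE ffunE inordK; last first.
  rewrite ltnS -(@leq_pmul2r 16)// -expnSr (leq_trans (leq_trunc_div _ _))//.
  by rewrite -ltnS.
set m : nat := f i.
have e : m%:R / (16 ^ n.+1)%:R - (m %/ 16)%:R / (16 ^ n)%:R = (m %% 16)%:R / (16 ^ n.+1)%:R :> R.
  rewrite {1}(divn_eq m 16) expnSr natrD !natrM.
  have h : (16 ^ n)%:R != 0 :> R by rewrite pnatr_eq0 expn_eq0.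
  by field; rewrite h.
rewrite e ger0_norm ?divr_ge0// ler_pdivrMr ?ltr0n ?expn_gt0// expnSr natrM.
by rewrite mulKf ?pnatr_eq0 ?expn_eq0// ler_nat ltnW// ltn_mod.
Qed.

Variable e : R.
Hypothesis e0 : 0 < e.

Let thr n : R := e / 2 ^+ n.+1.
Let bad0 : set T := \bigcup_(f in [set: grid 0]) [set w | thr 0 < `|D (pt f) w|].
Let badS n : set T := \bigcup_(f in [set: grid n.+1])
  [set w | thr n.+1 < `|D (pt f) w - D (pt (par f)) w|].
Let bad n := if n is m.+1 then badS m else bad0.

Let thr_gt0 n : 0 < thr n.
Proof. by rewrite divr_gt0// exprn_gt0. Qed.

Let mbad n : measurable (bad n).
Proof.
case: n => [|n] /=; (apply: fin_bigcup_measurable; first exact: finite_finset) => f _;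
  apply: measurable_gt; apply: measurableT_comp => //.
exact: measurable_funB.
Qed.

(** Level n + 1 has at most 32^d 16^(n d) grid points, and there the mesh 16^-n over the squared
    threshold is 16 / e^2 times 4^-n. The power 2 d + 1 beats the number of points by a further
    4^-n, and the factor 4 leaves room for the 2^-(n + 2) of the union bound. *)
Definition chaining_cst : R := 4 * (32 ^+ d * (16 / e ^+ 2) ^+ k).

Let bad_prob n : fine (P (E `&` bad n)) <= a * chaining_cst / (2 ^ n.+1)%:R.
Proof.
have p0 (m : nat) : 0 < (m.+1)%:R :> R by [].
have b0 : 0 <= 16 / e ^+ 2 by rewrite divr_ge0// sqr_ge0.
case: n => [|n] /=.
  apply: (le_trans (fineP_bigcup_fin P mE _)).
    by move=> f; apply: measurable_gt; exact: measurableT_comp.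
  apply: (@le_trans _ _ (\sum_(f : grid 0) a * (1 / (thr 0) ^+ 2) ^+ k)).
    by apply: ler_sum => f _; apply: tail0 => //; exact: pt_cube.
  rewrite sumr_const card_ffun !card_ord expn0 -[leLHS]mulr_natl natrX /chaining_cst.
  have -> : thr 0 = e / 2 by rewrite /thr expr1.
  have -> : 1 / (e / 2) ^+ 2 = 4 / e ^+ 2 by field; rewrite gt_eqF.
  rewrite [(2 ^ 1)%N]expn1; have -> : a * (4 * (32 ^+ d * (16 / e ^+ 2) ^+ k)) / 2 =
     32 ^+ d * (a * (2 * (16 / e ^+ 2) ^+ k)).
    by move: ((16 / e ^+ 2) ^+ k) => B; field.
  have b4 : 0 <= 4 / e ^+ 2 by rewrite divr_ge0// sqr_ge0.
  rewrite ler_pM ?exprn_ge0// ?(mulr_ge0 a0) ?exprn_ge0//.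
    by rewrite lerXn2r ?nnegrE// ler_nat.
  rewrite ler_wpM2l// -[leLHS]mul1r ler_pM ?exprn_ge0// ?ler1n//.
  by rewrite lerXn2r ?nnegrE// ler_wpM2r ?invr_ge0 ?sqr_ge0// ler_nat.
apply: (le_trans (fineP_bigcup_fin P mE _)).
  by move=> f; apply: measurable_gt; apply: measurableT_comp => //; exact: measurable_funB.
apply: (@le_trans _ _ (\sum_(f : grid n.+1) a * (((16 ^ n)%:R)^-1 / (thr n.+1) ^+ 2) ^+ k)).
  apply: ler_sum => f _; exact: tail1.
rewrite sumr_const card_ffun !card_ord -[leLHS]mulr_natl /chaining_cst.
rewrite -!mulrA mulrCA ler_wpM2l//.
have -> : (16 ^ n)%:R^-1 / thr n.+1 ^+ 2 = (16 / e ^+ 2) * ((4 ^ n)%:R)^-1 :> R.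
  rewrite /thr (_ : 16 = 4 * 4)%N// expnMn natrM !natrX.
  have -> : 2 ^+ n.+2 = 4 * 2 ^+ n :> R by rewrite -(natrX _ 2 n) 2!exprS -(natrX _ 2 n); ring.
  have h4 : 4 ^+ n = 2 ^+ n * 2 ^+ n :> R by rewrite -exprMn -natrM.
  rewrite h4; have h2 : 2 ^+ n != 0 :> R by rewrite expf_neq0.
  by field; rewrite h2 gt_eqF.
rewrite [X in _ * X <= _]exprMn.
have -> : 4 * (32 ^+ d * ((16 / e ^+ 2) ^+ k * ((2 ^ n.+2)%:R)^-1)) =
    (16 / e ^+ 2) ^+ k * (4 * (32 ^+ d / (2 ^ n.+2)%:R)) :> R by ring.
rewrite mulrCA ler_wpM2l ?exprn_ge0//.
rewrite exprVn ler_pdivrMr ?exprn_gt0 ?ltr0n ?expn_gt0//.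
have -> : 4 * (32 ^+ d / (2 ^ n.+2)%:R) = ((32 ^ d)%:R) / (2 ^ n)%:R :> R.
  rewrite !natrX !exprS; have h2 : 2 ^+ n != 0 :> R by rewrite expf_neq0.
  by field; rewrite h2.
rewrite mulrAC ler_pdivlMr ?ltr0n ?expn_gt0//.
rewrite -!natrX -!natrM ler_nat.
apply: (@leq_trans ((32 * 16 ^ n) ^ d * 4 ^ n)).
  rewrite leq_mul//; last by case: (n) => [//|m]; rewrite leq_exp2r.
  case: (d) => [|m] //; rewrite leq_exp2r// expnS.
  by rewrite ltn_pmul2r// expn_gt0.
by rewrite expnMn -mulnA leq_mul2l (_ : 16 = 4 ^ 2)%N// -!expnM -expnD /k; apply/orP; right;
  rewrite leq_exp2l// mulnS addnC leq_add2l mulnCA.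
Qed.


(** Off [N] the thresholds along the ancestors of a grid point of level n add up to at most e (1 -
    2^-(n + 1)). A point where |D| exceeds e would, by continuity, have a grid point nearby with the
    same property. *)
Lemma chaining : exists N : set T,
  [/\ measurable N, fine (P (E `&` N)) <= a * chaining_cst &
  forall w, ~ N w -> continuous (D ^~ w) ->
    forall t, in_cube t -> `|D t w| <= e].
Proof.
have c0 : 0 <= a * chaining_cst.
  rewrite mulr_ge0// /chaining_cst mulr_ge0// mulr_ge0 ?exprn_ge0//.
  by rewrite divr_ge0// sqr_ge0.
exists (\bigcup_n bad n); split.
- exact: bigcup_measurable.
- exact: fineP_bigcup.
move=> w Nw cD.
have small n (f : grid n) : `|D (pt f) w| <= e * (1 - (2 ^+ n.+1)^-1).
  elim: n f => [|n IH] f.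
    rewrite leNgt; apply/negP => h; apply: Nw; exists 0%N => //; exists f => //=.
    apply: le_lt_trans h; rewrite /thr expr1; lra.
  have bS : `|D (pt f) w - D (pt (par f)) w| <= thr n.+1.
    by rewrite leNgt; apply/negP => h; apply: Nw; exists n.+1 => //; exists f.
  rewrite -(subrK (D (pt (par f)) w) (D (pt f) w)) (le_trans (ler_normD _ _))//.
  apply: (le_trans (lerD bS (IH (par f)))).
  rewrite /thr exprS; have h2 : 2 ^+ n.+1 != 0 :> R by rewrite expf_neq0.
  by rewrite le_eqVlt; apply/orP; left; apply/eqP; field.
move=> t ct; rewrite leNgt; apply/negP => h.
have nc : \forall s \near t, e < `|D s w|.
  exact: (cvgr_gt _ (cvg_norm (cD t))).
have /nbhs_ballP[r /= r0 Br] := nc.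
(* 16^n exceeds 1 / r, so rounding the coordinates of [t] down to the grid of level n stays within r
   of [t]. *)
pose n := Num.truncn (r^-1).
have rn : ((16 ^ n)%:R)^-1 < r.
  rewrite invf_plt ?posrE ?ltr0n ?expn_gt0//.
  rewrite (lt_le_trans (truncnS_gt _))// ler_nat -/n.
  by rewrite (leq_trans _ (ltn_expl n _))// ltn_expl.
pose f : grid n := [ffun i => inord (Num.truncn (t 0 i * (16 ^ n)%:R))].
have h1 : e < `|D (pt f) w|.
  apply: Br; split=> // i j; rewrite !ord1 /ball/= mxE ffunE.
  have /andP[t0 t1] := ct j.
  have /truncn_itv/andP[u1 u2] : 0 <= t 0 j * (16 ^ n)%:R by rewrite mulr_ge0.
  have p16 : 0 < (16 ^ n)%:R :> R by rewrite ltr0n expn_gt0.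
  rewrite inordK; last first.
    rewrite ltnS -(ler_nat R) (le_trans u1)// -[leRHS]mul1r ler_wpM2r//.
  set m := Num.truncn _ in u1 u2 *.
  have tm : m%:R / (16 ^ n)%:R <= t 0 j by rewrite ler_pdivrMr.
  rewrite ger0_norm ?subr_ge0// (le_lt_trans _ rn)// lerBlDr.
  by rewrite -[X in _ <= X + _]mul1r -mulrDl ler_pdivlMr// addrC natr1 ltW.
have := small n f; rewrite leNgt => /negP; apply; apply: le_lt_trans h1.
rewrite ler_piMr ?(ltW e0)// gerBl invr_ge0 exprn_ge0.
Qed.

End chaining.

(** * Gaussian tails and norms *)

Section gaussian_tails.
Context d (T : measurableType d) {R : realType} (P : probability T R).
Variable L : set (T -> R).
Hypothesis gL : gaussian_space P L.
Variable A : T -> R.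
Hypotheses (LA : L A) (vA : cov P A A = 1).

Lemma gspace_gtail (u : R) : fine (P [set w | u < A w]) = gtail u.
Proof.
have [s [mA As] s1] := gspace_cnormal gL LA; rewrite vA in s1.
have s0 : s != 0 by apply: contra_eq_neq s1 => ->; rewrite expr0n eq_sym oner_eq0.
have e : [set w | u < A w] = A @^-1` `]u, +oo[%classic.
  by apply/seteqP; split => x /=; rewrite in_itv/= andbT.
rewrite e As; last exact: measurable_itv.
rewrite /nlaw (negbTE s0) /gtail /=; congr fine.
rewrite /normal_prob; apply: eq_integral => x _; congr EFin.
rewrite !normal_pdfE ?oner_eq0// /normal_peak /normal_fun.
by rewrite s1 expr1n.
Qed.

(** The factor P(u < A) is exact because |B| is independent of [A]: apply [gweight_indep] to the
    single variable B divided by its standard deviation. Complements of {z < V} are events y <= |B|;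
    they are put inside y / 2 < |B| to return to the strict tail bound, whence the factor 4. *)
Lemma gspace_orth_tail B (u y : R) k : L B -> cov P B A = 0 -> 0 < y ->
  fine (P ([set w | u < A w] `&` [set w | y < `|B w|])) <=
  fine (P [set w | u < A w]) *
    (2 * expR (1 / 2) * (k.+1.*2)`!%:R * (4 * cov P B B / y ^+ 2) ^+ k.+1).
Proof.
move=> LB oB y0.
have mA := gspace_measurable gL LA; have mB := gspace_measurable gL LB.
have mnB : measurable_fun setT (fun w => `|B w|) by exact: measurableT_comp.
have mE : measurable [set w | u < A w] by exact: measurable_gt.
have mF z : measurable [set w | z < `|B w|] by exact: measurable_gt.
have [s nB sB] := gspace_cnormal gL LB.
have [v0|v0] := eqVneq (cov P B B) 0.
  apply: (@le_trans _ _ 0); last first.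
    by rewrite v0 mulr0 mul0r expr0n/= mulr0 mulr0.
  have := cnormal_tail k nB y0; rewrite sB v0 mul0r expr0n/= mulr0.
  by apply: le_trans; apply: fineP_le => //; exact: measurableI.
have {}v0 : 0 < cov P B B by rewrite lt_neqAle eq_sym v0 cov_ge0.
set v := cov P B B in v0 sB *.
pose q := Num.sqrt v; have q0 : 0 < q by rewrite sqrtr_gt0.
have qv : q ^+ 2 = v by rewrite sqr_sqrtr// ltW.
pose G (i : nat) w := q^-1 * B w.
have LG i : (i < 1)%N -> L (G i) by move=> _; exact: (gspaceZ gL).
have oG i j : (i < 1)%N -> (j < 1)%N -> cov P (G i) (G j) = (i == j)%:R.
  move=> i1 j1; rewrite /G (covZl gL)//; last exact: (gspaceZ gL).
  rewrite (covZr gL)// -/v -qv; move: i1 j1; rewrite !ltnS !leqn0 => /eqP -> /eqP ->.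
  by rewrite mulrA -expr2 exprVn mulVf// expf_neq0 ?gt_eqF.
have oA i : (i < 1)%N -> cov P (G i) A = 0 by move=> _; rewrite (covZl gL)// oB mulr0.
pose z := expR (- (y ^+ 2 / v / 2)).
have ind := gweight_indep gL LG oG LA vA oA u z.
have mV : measurable_fun setT (gweight G 1 1) by exact: (measurable_gweight gL).
have VE w : (gweight G 1 1 w <= z) = (y <= `|B w|).
  rewrite /gweight big_ord1 mul1r ler_expR lerN2 ler_pM2r ?invr_gt0// /G.
  rewrite exprMn exprVn qv [X in _ <= X]mulrC ler_pM2r ?invr_gt0//.
  by rewrite -[in RHS]ler_sqr ?nnegrE ?(ltW y0)// real_normK// num_real.
have mW : measurable [set w | z < gweight G 1 1 w] by exact: measurable_gt.
apply: (@le_trans _ _ (fine (P ([set w | u < A w] `\` [set w | z < gweight G 1 1 w])))).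
  apply: fineP_le; [exact: measurableI|exact: measurableD|].
  by move=> w [/= uA yB]; split => //=; apply/negP; rewrite -leNgt VE ltW.
rewrite measureD//; last by rewrite ltey_eq fin_num_measure.
rewrite fineB ?fin_num_measure//; last exact: measurableI.
rewrite ind -[X in X - _]mulr1 -mulrBr ler_wpM2l ?fineP_ge0//.
have -> : 1 - fine (P [set w | z < gweight G 1 1 w]) =
    fine (P (~` [set w | z < gweight G 1 1 w])).
  by rewrite probability_setC// fineB ?fin_num_measure.
have y2 : 0 < y / 2 by rewrite divr_gt0.
have := cnormal_tail k nB y2; rewrite sB.
have -> : v / (y / 2) ^+ 2 = 4 * v / y ^+ 2 by field; rewrite gt_eqF.
apply: le_trans; apply: fineP_le => //; first exact: measurableC.
move=> w /= /negP; rewrite -leNgt VE; apply: lt_le_trans.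
by rewrite ltr_pdivrMr// ltr_pMr// ltr1n.
Qed.

End gaussian_tails.

(** * Covariance of a stationary Gaussian field *)

Section random_field.
Context {R : realType} {d : nat} {dO : measure_display} {Omega : measurableType dO}.
Variables (P : probability Omega R) (X : 'rV[R]_d -> {RV P >-> R}).
Implicit Types (A B : Omega -> R) (s t h : 'rV[R]_d).

Lemma normal_law_cnormal A : measurable_fun setT A ->
  is_normal_law (pushforward P A) -> P.-integrable setT (EFin \o A) /\
  (\int[P]_x A x = 0 -> exists sg, cnormal P A sg).
Proof.
move=> mA [m [s AE]]; have [s0|s0] := eqVneq s 0.
  have lA : has_law P A (\d_(m : measurableTypeR R) : probability _ _).
    by split => // B mB; have := AE _ mB; rewrite s0 eqxx.
  have im : (\d_(m : measurableTypeR R) : probability _ R).-integrable setT (EFin \o (@id R)).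
    apply/integrableP; split; first exact/measurable_EFinP.
    rewrite integral_dirac//=; first by rewrite diracT mul1e ltry.
    by apply/measurable_EFinP; exact: normr_measurable.
  split; first exact: (law_integrable (f := id) lA).
  rewrite (law_Rintegral (f := id) lA)// /Rintegral integral_dirac// diracT mul1e/= => m0.
  by exists 0; rewrite /cnormal /nlaw eqxx -m0.
have lA : has_law P A (normal_prob m s : probability _ _).
  by split => // B mB; have := AE _ mB; rewrite (negbTE s0).
split; first exact: (law_integrable (f := id) lA _ (integrable_normal_id m s0)).
rewrite (law_Rintegral (f := id) lA _ (integrable_normal_id m s0))// normal_mean// => m0.
by exists s; rewrite /cnormal /nlaw (negbTE s0) -m0.
Qed.

Definition field_space : set (Omega -> R) :=
  [set A | exists r : seq (R * 'rV[R]_d), A = fun w => \sum_(p <- r) p.1 * X p.2 w].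

Lemma field_spaceX s : field_space (X s).
Proof. by exists [:: (1, s)]; apply/funext => w; rewrite big_seq1 mul1r. Qed.

Hypotheses (X_gaussian : gaussian_field X) (X_centered : centered X).

Lemma field_gaussian_space : gaussian_space P field_space.
Proof.
split=> [a b _ _ [r ->] [r' ->]|_ [r ->]].
  exists ([seq (a * p.1, p.2) | p <- r] ++ [seq (b * p.1, p.2) | p <- r']).
  apply/funext => w; rewrite big_cat !big_map !mulr_sumr.
  by congr (_ + _); apply: eq_bigr => p _; rewrite mulrA.
(* Integrability of the single values is read off their normal laws first; only then can means of
   linear combinations be added up. *)
have iX s : P.-integrable setT (EFin \o X s).
  have := X_gaussian (fun=> 1) (fun _ : 'I_1 => s).
  rewrite (_ : (fun w => _) = X s); last by apply/funext => w; rewrite big_ord1 mul1r.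
  by move=> /(normal_law_cnormal (measurable_funPT (X s)))[].
have mr : measurable_fun setT (fun w => \sum_(p <- r) p.1 * X p.2 w).
  by apply: measurable_sum => p; exact: measurable_funM.
have nr : is_normal_law (pushforward P (fun w => \sum_(p <- r) p.1 * X p.2 w)).
  have := X_gaussian (fun i : 'I_(size r) => (nth (0, 0) r i).1) (fun i => (nth (0, 0) r i).2).
  congr (is_normal_law (pushforward P _)); apply/funext => w.
  by rewrite (big_nth (0, 0)) big_mkord.
have [_] := normal_law_cnormal mr nr; apply.
have X0 s : \int[P]_w X s w = 0 by rewrite /Rintegral -[RHS]/(fine 0%E) -(X_centered s) unlock.
clear mr nr; have : P.-integrable setT (EFin \o (fun w => \sum_(p <- r) p.1 * X p.2 w)) /\
    \int[P]_w (\sum_(p <- r) p.1 * X p.2 w) = 0.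
  elim: r => [|p r [IH1 IH2]].
    have -> : (fun w => \sum_(p <- [::]) p.1 * X p.2 w) = fun=> 0.
      by apply/funext => w; rewrite big_nil.
    by split; [exact: (bmf_integrable _ (bmf_cst _ 0))|exact: Rintegral_cst1].
  have -> : (fun w => \sum_(p <- p :: r) p.1 * X p.2 w) =
      fun w => p.1 * X p.2 w + \sum_(p <- r) p.1 * X p.2 w.
    by apply/funext => w; rewrite big_cons.
  have i1 : P.-integrable setT (EFin \o (fun w => p.1 * X p.2 w)) by exact: integrable_cstM.
  split; first exact: (integrableD measurableT i1 IH1).
  by rewrite RintegralD// IH2 RintegralZl// X0 mulr0 addr0.
by case.
Qed.

Let gL := field_gaussian_space.

Hypotheses (X_stationary : stationary X) (X_isotropic : isotropic X).

Lemma covariance_funE h : covariance_fun X h = cov P (X 0) (X h).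
Proof. by rewrite /covariance_fun unlock. Qed.

(* Polarization: the one-dimensional laws of the sums determine the covariance. *)
Lemma fdd_cov s t s' t' :
  (forall C : set (2.-tuple R), measurable C ->
    fdd X (fun i : 'I_2 => if i == 0 then s else t) C =
    fdd X (fun i : 'I_2 => if i == 0 then s' else t') C) ->
  cov P (X s) (X t) = cov P (X s') (X t').
Proof.
move=> H.
have sqr_eq a b : \int[P]_w ((a * X s w + b * X t w) ^+ 2) =
    \int[P]_w ((a * X s' w + b * X t' w) ^+ 2).
  apply: (@eq_law_Rintegral _ _ _ P _ _ (fun x : R => x ^+ 2)).
  - by apply: measurable_funD; exact: measurable_funM.
  - by apply: measurable_funD; exact: measurable_funM.
  - exact: measurable_funX.
  - by move=> x; exact: sqr_ge0.
  move=> B mB.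
  pose g (x : 2.-tuple R) := a * tnth x 0 + b * tnth x 1.
  have mg : measurable_fun setT g.
    by apply: measurable_funD; apply: measurable_funM => //; exact: measurable_tnth.
  have mgB : measurable (g @^-1` B) by rewrite -[X in measurable X]setTI; exact: mg.
  have := H _ mgB; rewrite /fdd.
  by congr (P _ = P _); apply/seteqP; split => w; rewrite /= /g !tnth_mktuple.
have E a b u v : \int[P]_w ((a * X u w + b * X v w) ^+ 2) =
    a ^+ 2 * cov P (X u) (X u) + 2 * a * b * cov P (X u) (X v) + b ^+ 2 * cov P (X v) (X v).
  have Lu := field_spaceX u; have Lv := field_spaceX v.
  have La := gspaceZ gL a Lu; have Lb := gspaceZ gL b Lv.
  have Lab := gspaceD gL La Lb.
  transitivity (cov P (fun w => a * X u w + b * X v w) (fun w => a * X u w + b * X v w)).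
    by apply: eq_Rintegral => w _; rewrite expr2.
  rewrite (covDl gL)// !(covDr gL)// !(covZl gL)// !(covZr gL)// (covC P (X v) (X u)).
  by ring.
have h1 := sqr_eq 1 0; have h2 := sqr_eq 0 1; have h3 := sqr_eq 1 1.
by move: h1 h2 h3; rewrite !E; lra.
Qed.

Lemma cov_field s t : cov P (X s) (X t) = covariance_fun X (t - s).
Proof.
rewrite covariance_funE; apply: fdd_cov => C mC.
rewrite -[RHS](X_stationary s _ mC); congr (fdd X _ C); apply/funext => i.
by case: ifP => _; rewrite ?add0r ?subrK.
Qed.

Lemma covariance_funN h : covariance_fun X (- h) = covariance_fun X h.
Proof. by rewrite -sub0r -cov_field covC cov_field subr0. Qed.

Lemma covariance_fun_orthogonal h (Q : 'M[R]_d) : Q *m Q^T = 1%:M ->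
  covariance_fun X (h *m Q) = covariance_fun X h.
Proof.
move=> oQ; rewrite !covariance_funE; symmetry; apply: fdd_cov => C mC.
rewrite -(X_isotropic oQ _ mC); congr (fdd X _ C); apply/funext => i.
by case: ifP => _; rewrite ?mul0mx.
Qed.

End random_field.

(** * The length of an orthonormal family and exceedance of a random level *)

Section slope_norm.
Context d (T : measurableType d) {R : realType} (P : probability T R).
Variable L : set (T -> R).
Hypothesis gL : gaussian_space P L.

Definition fnorm n (G : nat -> T -> R) (w : T) : R := Num.sqrt (\sum_(i < n) G i w ^+ 2).

(* Inverts [v = exp (- |g|^2 / 2)]. *)
Let nrm (v : R) : R := Num.sqrt (- (2 * ln v)).

Let fnormE n G w : fnorm n G w = nrm (gweight G n 1 w).
Proof.
rewrite /nrm /gweight expRK mulrN opprK mulr_sumr; congr Num.sqrt.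
by apply: eq_bigr => i _; field.
Qed.

Let measurable_nrm : measurable_fun setT nrm.
Proof.
apply: (@measurableT_comp _ _ _ _ _ _ (@Num.sqrt R)).
  by apply: continuous_measurable_fun; exact: sqrt_continuous.
by apply: measurableT_comp => //; apply: measurable_funM.
Qed.

Lemma measurable_fnorm n G : (forall i, (i < n)%N -> L (G i)) ->
  measurable_fun setT (fnorm n G).
Proof.
move=> LG; rewrite (_ : fnorm n G = nrm \o gweight G n 1); last first.
  by apply/funext => w; exact: fnormE.
by apply: measurableT_comp => //; exact: (measurable_gweight gL LG).
Qed.

Lemma measurable_gtail D : measurable_fun D (@gtail R).
Proof.
apply: measurable_funTS; apply: nonincreasing_measurable => // x y xy.
by apply: fineP_le => //; apply: subset_itvr; rewrite bnd_simp.
Qed.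

Lemma gtail_itv (x : R) : 0 <= gtail x <= 1.
Proof.
rewrite fineP_ge0/= -lee_fin fineK ?fin_num_measure//.
exact: probability_le1.
Qed.

(** By independence the probability is the mean of gtail (u + f(|G|) / u), and the uniform estimate
    [gtail_ratio] compares the integrand with gtail u e^(-f). The function [f] is left free so as to
    carry the error terms of the linear approximation. *)
Lemma exceed_prob n (G : nat -> T -> R) A (u : R) (f : R -> R) :
  (forall i, (i < n)%N -> L (G i)) ->
  (forall i j, (i < n)%N -> (j < n)%N -> cov P (G i) (G j) = (i == j)%:R) ->
  L A -> cov P A A = 1 -> (forall i, (i < n)%N -> cov P (G i) A = 0) ->
  measurable_fun setT f -> (forall x, 0 <= f x) -> 0 < u ->
  `|fine (P [set w | u + f (fnorm n G w) / u < A w]) -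
    gtail u * \int[P]_w expR (- f (fnorm n G w))| <= gtail u * (2 / u ^+ 2).
Proof.
move=> LG oG LA vA oA mf f0 u0.
have mV := measurable_gweight gL LG; have mA := gspace_measurable gL LA.
have mg := measurable_fnorm LG.
have mfg : measurable_fun setT (fun w => f (fnorm n G w)) by exact: measurableT_comp.
pose h v := u + f (nrm v) / u.
have mh : measurable_fun setT h.
  by apply: measurable_funD => //; apply: measurable_funM => //; exact: measurableT_comp.
have := ray_independence_integral mA mV mh (gweight_indep gL LG oG LA vA oA).
rewrite [X in fine (P X) = _](_ : _ = [set w | u + f (fnorm n G w) / u < A w]); last first.
  by apply/seteqP; split => w /=; rewrite /h fnormE.
rewrite (@eq_Rintegral _ _ _ P setT (fun w => gtail (u + f (fnorm n G w) / u))); last first.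
  by move=> w _; rewrite (gspace_gtail gL LA vA) /h fnormE.
move=> ->.
have be : bmf (fun w => expR (- f (fnorm n G w))) by exact: bmf_expRN.
have bg : bmf (fun w => gtail (u + f (fnorm n G w) / u)).
  apply: bmf_le1; last by move=> w; exact: gtail_itv.
  apply: measurableT_comp; first exact: measurable_gtail.
  by apply: measurable_funD => //; exact: measurable_funM.
have gu := gtail_gt0 u0.
rewrite -(bmf_RintegralZ _ _ be).
have bge : bmf (fun w => gtail u * expR (- f (fnorm n G w))).
  by apply: bmfM => //; exact: bmf_cst.
have bc := bmf_cst T (gtail u * (2 / u ^+ 2)).
rewrite ler_norml; apply/andP; split.
  rewrite lerBrDl -(Rintegral_cst1 P (- (gtail u * (2 / u ^+ 2)))) -bmf_RintegralD//; last exact: bmf_cst.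
  apply: bmf_le_Rintegral => //; first by apply: bmfD => //; exact: bmf_cst.
  move=> w; have /andP[h1 _] := gtail_ratio u0 (f0 (fnorm n G w)).
  by rewrite -mulrN -mulrDr mulrC -ler_pdivlMr.
rewrite lerBlDl -(Rintegral_cst1 P (gtail u * (2 / u ^+ 2))) -bmf_RintegralD//.
apply: bmf_le_Rintegral => //; first exact: bmfD.
move=> w; have /andP[_ h1] := gtail_ratio u0 (f0 (fnorm n G w)).
by rewrite -mulrDr [leRHS]mulrC -ler_pdivrMr.
Qed.

Lemma fnorm_law n (G G' : nat -> T -> R) A (q : R -> R) :
  (forall i, (i < n)%N -> L (G i)) ->
  (forall i j, (i < n)%N -> (j < n)%N -> cov P (G i) (G j) = (i == j)%:R) ->
  (forall i, (i < n)%N -> L (G' i)) ->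
  (forall i j, (i < n)%N -> (j < n)%N -> cov P (G' i) (G' j) = (i == j)%:R) ->
  L A -> measurable_fun setT q -> (forall x, 0 <= q x) ->
  \int[P]_w q (fnorm n G w) = \int[P]_w q (fnorm n G' w).
Proof.
move=> LG oG LG' oG' LA mq q0.
under eq_Rintegral do rewrite fnormE; under [RHS]eq_Rintegral do rewrite fnormE.
have mqn : measurable_fun setT (q \o nrm) by exact: measurableT_comp.
by apply: (gweight_law gL LG oG LG' oG' LA mqn) => v; exact: q0.
Qed.

(** From sqrt x <= 1 + x and E |G|^2 = n; a crude bound is enough for the Lipschitz estimate of the
    limit function. *)
Lemma fnorm_mean_le n (G : nat -> T -> R) A :
  (forall i, (i < n)%N -> L (G i)) ->
  (forall i j, (i < n)%N -> (j < n)%N -> cov P (G i) (G j) = (i == j)%:R) -> L A ->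
  P.-integrable setT (EFin \o fnorm n G) /\ \int[P]_w fnorm n G w <= 1 + n%:R.
Proof.
move=> LG oG LA.
pose S k w := \sum_(i < k) G i w * G i w.
have HS k : (k <= n)%N -> P.-integrable setT (EFin \o S k) /\ \int[P]_w S k w = k%:R.
  elim: k => [_|k IH kn].
    rewrite (_ : S 0%N = fun=> 0); last by apply/funext => w; rewrite /S big_ord0.
    by split; [exact: (bmf_integrable _ (bmf_cst _ 0))|exact: Rintegral_cst1].
  have [i1 e1] := IH (ltnW kn).
  rewrite (_ : S k.+1 = fun w => S k w + G k w * G k w); last first.
    by apply/funext => w; rewrite /S big_ord_recr.
  have i2 := gspace_integrable_sqr gL (LG _ kn).
  split; first exact: (integrableD measurableT i1 i2).
  by rewrite RintegralD// e1 -[X in _ + X]/(cov P (G k) (G k)) oG// eqxx natr1.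
have [iS ES] := HS n (leqnn n).
have i1 : P.-integrable setT (EFin \o (fun=> 1 : R)) by exact: (bmf_integrable _ (bmf_cst _ 1)).
have i1S : P.-integrable setT (EFin \o (fun w => 1 + S n w)) := integrableD measurableT i1 iS.
have le1 w : fnorm n G w <= 1 + S n w.
  rewrite /fnorm /S; under eq_bigr do rewrite expr2.
  have : 0 <= \sum_(i < n) G i w * G i w by apply: sumr_ge0 => i _; rewrite -expr2 sqr_ge0.
  move: (\sum_(i < n) _) => x x0; have := sqr_sqrtr x0; have := sqr_ge0 (1 - Num.sqrt x).
  by have := sqrtr_ge0 x; rewrite !expr2; lra.
have ig : P.-integrable setT (EFin \o fnorm n G).
  apply: (le_integrable measurableT _ _ i1S).
    by apply/measurable_EFinP; exact: measurable_fnorm.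
  move=> w _; rewrite lee_fin ger0_norm ?sqrtr_ge0// ger0_norm//.
  exact: le_trans (sqrtr_ge0 _) (le1 w).
split=> //; rewrite (le_trans (le_Rintegral _ _ _ (fun w _ => le1 w)))//.
by rewrite RintegralD// ES Rintegral_cst1.
Qed.

End slope_norm.

(** * The rescaled field and its linear approximation *)

Section euclidean.
Context {R : realType} {d : nat}.
Implicit Types (s t x : 'rV[R]_d).

Definition sqn x : R := \sum_(i < d) x 0 i ^+ 2.
(** Indexed by [nat] to match the orthonormal families above; it is the zero vector for n >= d. *)
Definition unitv (n : nat) : 'rV[R]_d := \row_(j < d) (n == j)%:R.

Lemma sqn_ge0 x : 0 <= sqn x.
Proof. by apply: sumr_ge0 => i _; exact: sqr_ge0. Qed.

Lemma sqnE x : enorm x ^+ 2 = sqn x.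
Proof. by rewrite sqr_sqrtr// sqn_ge0. Qed.

Lemma enorm_ge0 x : 0 <= enorm x.
Proof. exact: sqrtr_ge0. Qed.

Lemma sqnZ (a : R) x : sqn (a *: x) = a ^+ 2 * sqn x.
Proof. by rewrite /sqn mulr_sumr; apply: eq_bigr => i _; rewrite mxE exprMn. Qed.

Lemma unitvE (i j : 'I_d) : unitv i 0 j = (j == i)%:R.
Proof. by rewrite mxE eq_sym. Qed.

Lemma sqn_unitv (i : 'I_d) : sqn (unitv i) = 1.
Proof.
rewrite /sqn (bigD1 i)//= unitvE eqxx expr1n big1 ?addr0// => j ji.
by rewrite unitvE (negbTE ji) expr0n.
Qed.

Lemma sqnD_unitv s (i : 'I_d) (a : R) :
  sqn (s + a *: unitv i) = sqn s + 2 * a * s 0 i + a ^+ 2.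
Proof.
have E j : (s + a *: unitv i) 0 j = s 0 j + a * (j == i)%:R.
  by rewrite !mxE eq_sym.
rewrite /sqn (bigD1 i)//= [in RHS](bigD1 i)//= E eqxx.
rewrite (@eq_bigr _ _ _ _ _ _ _ (fun j => s 0 j ^+ 2)); last first.
  by move=> j ji; rewrite E (negbTE ji) mulr0 addr0.
by rewrite mulr1; ring.
Qed.

Lemma unitv_le1 (n : nat) (j : 'I_d) : `|unitv n 0 j| <= 1.
Proof. by rewrite mxE; case: eqP; rewrite ?normr1 ?normr0. Qed.

Lemma cauchy_schwarz_sum (a b : 'I_d -> R) :
  (\sum_i a i * b i) ^+ 2 <= (\sum_i a i ^+ 2) * \sum_i b i ^+ 2.
Proof.
set B := \sum_i a i * b i; set A := \sum_i b i ^+ 2; set S := \sum_i a i ^+ 2.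
have A0 : 0 <= A by apply: sumr_ge0 => i _; exact: sqr_ge0.
have : 0 <= \sum_i (A * a i - B * b i) ^+ 2 by apply: sumr_ge0 => i _; exact: sqr_ge0.
have -> : \sum_i (A * a i - B * b i) ^+ 2 = A * (S * A - B ^+ 2).
  rewrite (eq_bigr (fun i => A ^+ 2 * a i ^+ 2 - 2 * A * B * (a i * b i) + B ^+ 2 * b i ^+ 2)).
    by rewrite big_split /= sumrB -!mulr_sumr -/A -/B -/S; ring.
  by move=> i _; ring.
have [A00|A1] := eqVneq A 0; last by rewrite pmulr_rge0 ?lt_neqAle 1?eq_sym ?A1// subr_ge0.
move=> _; rewrite A00 mulr0 /B big1 ?expr0n// => i _.
have /eqP : b i ^+ 2 = 0.
  apply/eqP; rewrite eq_le sqr_ge0 andbT -A00 /A (bigD1 i)//= lerDl.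
  by apply: sumr_ge0 => j _; exact: sqr_ge0.
by rewrite expf_eq0 => /= /eqP ->; rewrite mulr0.
Qed.

End euclidean.

Section cov_square.
Context d (T : measurableType d) {R : realType} (P : probability T R).
Variables (L : set (T -> R)) (gL : gaussian_space P L).
Implicit Types A B : T -> R.

Lemma cov_sqrB A B : L A -> L B -> cov P (fun w => A w - B w) (fun w => A w - B w) =
  cov P A A - 2 * cov P A B + cov P B B.
Proof.
move=> LA LB; have LAB := gspaceB gL LA LB.
rewrite (covBl gL LA LB LAB) (covBr gL LA LA LB) (covBr gL LB LA LB) (covC P B A).
by ring.
Qed.

Lemma cov_sqrB_le A B : L A -> L B ->
  cov P (fun w => A w - B w) (fun w => A w - B w) <= 2 * (cov P A A + cov P B B).
Proof.
move=> LA LB; have LAB := gspaceD gL LA LB.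
have := cov_ge0 P (fun w => A w + B w).
rewrite (covDl gL LA LB LAB) (covDr gL LA LA LB) (covDr gL LB LA LB) (covC P B A).
by rewrite cov_sqrB//; lra.
Qed.

End cov_square.

(** Used with a^2 = lam and b^2 the variance of a slope, which differ by at most 2 eta. *)
Lemma ratio_bounds {R : realType} (a b e : R) : 0 < a -> 0 < b -> 0 < e ->
  4 * e <= a ^+ 2 -> `|b ^+ 2 - a ^+ 2| <= 2 * e ->
  a / b <= 2 /\ a ^+ 2 * (1 - a / b) <= 2 * e.
Proof.
move=> a0 b0 e0 e1; rewrite ler_norml => /andP[h1 h2]; split.
  rewrite ler_pdivrMr// -ler_sqr ?nnegrE ?mulr_ge0 ?ltW//.
  by rewrite exprMn; lra.
have -> : a ^+ 2 * (1 - a / b) = a ^+ 2 * (b - a) / b by field; rewrite gt_eqF.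
rewrite ler_pdivrMr//; have [ba|ab] := leP b a.
  rewrite (@le_trans _ _ 0)//; last by rewrite !mulr_ge0 ?ltW.
  by rewrite mulr_ge0_le0 ?sqr_ge0// subr_le0.
have ab0 : 0 < a + b by rewrite addr_gt0.
rewrite -(ler_pM2r ab0).
have -> : a ^+ 2 * (b - a) * (a + b) = (b ^+ 2 - a ^+ 2) * a ^+ 2 by ring.
rewrite -[leRHS]mulrA ler_pM ?sqr_ge0//.
  by rewrite subr_ge0 ler_sqr ?nnegrE ltW.
by rewrite expr2 ler_pM ?ltW// ltr_wpDl// ltW.
Qed.

(** * The rescaled field at a fixed level and its residual *)

Section rescaled_field.
Context d0 (T : measurableType d0) {R : realType} (P : probability T R).
(** In the application [Y s] is X (s / u) and [q x] is u^2 (1 - rho (x / u)), which is close to lam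
    / 2 |x|^2. All estimates are explicit in [eta] and [K], so that u tends to infinity only at the
    end. *)
Variables (L : set (T -> R)) (d : nat) (Y : 'rV[R]_d -> T -> R) (q : 'rV[R]_d -> R).
Variables (u lam eta K : R).
Implicit Types (s t x : 'rV[R]_d).
Hypotheses (gL : gaussian_space P L) (LY : forall s, L (Y s)).
Hypotheses (u0 : 0 < u) (lam0 : 0 < lam) (eta0 : 0 < eta) (eta_lam : 4 * eta <= lam) (K0 : 0 <= K).
Hypothesis covY : forall s t, cov P (Y s) (Y t) = 1 - q (t - s) / u ^+ 2.
Hypothesis qN : forall x, q (- x) = q x.
Hypothesis q_reflect : forall i j : 'I_d, i != j ->
  q (unitv i + unitv j) = q (unitv i - unitv j).
(** The half-width 2 K + 2 accommodates differences of two points of [-K, K]^d, their translates by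
    a unit vector and the points [2 *: unitv n]. *)
Hypothesis q_approx : forall x, (forall i, `|x 0 i| <= 2 * K + 2) ->
  `|q x - lam / 2 * sqn x| <= eta * sqn x.

Let q0 : q 0 = 0.
Proof.
have := q_approx (x := 0); rewrite /sqn big1 ?mulr0 ?subr0; last first.
  by move=> i _; rewrite mxE expr0n.
move=> h; apply/eqP; rewrite -normr_le0; apply: h => i.
by rewrite mxE normr0 addr_ge0// mulr_ge0.
Qed.

(** The difference of [Y] at the two points has variance 2 q(2 e_n) / u^2, so with this
    normalisation the slopes have variance exactly 1. The value itself is within 2 eta of lam. *)
Definition slope_var (n : nat) : R := q (2 *: unitv n) / 2.
Definition slope (n : nat) (w : T) : R :=
  u / (2 * Num.sqrt (slope_var n)) * (Y (unitv n) w - Y (- unitv n) w).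

Let small_unitv (a : R) (n : nat) (i : 'I_d) : `|a| <= 2 * K + 2 -> `|(a *: unitv n) 0 i| <= 2 * K + 2 :> R.
Proof.
move=> h; rewrite mxE normrM (le_trans _ h)//.
by rewrite ler_piMr// unitv_le1.
Qed.

Let slope_var_approx (i : 'I_d) : `|slope_var i - lam| <= 2 * eta.
Proof.
have b2 : `|2| <= 2 * K + 2 :> R by rewrite ger0_norm// lerDr mulr_ge0.
have := q_approx (fun j => @small_unitv 2 i j b2).
rewrite sqnZ sqn_unitv mulr1.
by rewrite /slope_var !ler_norml => /andP[h1 h2]; apply/andP; split; lra.
Qed.

Let slope_var_gt0 (i : 'I_d) : 0 < slope_var i.
Proof.
have := slope_var_approx i; rewrite ler_norml => /andP[h1 h2].
by move: lam0 eta_lam; lra.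
Qed.

Let sg (n : nat) := Num.sqrt (slope_var n).

Let sg_gt0 (i : 'I_d) : 0 < sg i.
Proof. by rewrite sqrtr_gt0. Qed.

Let sg_sqr (i : 'I_d) : sg i ^+ 2 = slope_var i.
Proof. by rewrite sqr_sqrtr// ltW. Qed.

Lemma slope_in n : L (slope n).
Proof. by apply: (gspaceZ gL); exact: (gspaceB gL). Qed.

Lemma cov_field_slope s (i : 'I_d) :
  cov P (Y s) (slope i) = (q (s + unitv i) - q (s - unitv i)) / (2 * sg i * u).
Proof.
have LB : L (fun w => Y (unitv i) w - Y (- unitv i) w) by exact: (gspaceB gL).
rewrite (covZr gL)// (covBr gL)// !covY.
rewrite -[unitv i - s]opprB (_ : - unitv i - s = - (s + unitv i)); last by rewrite opprD addrC.
rewrite !qN -/(sg i).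
have := sg_gt0 i; move=> g0; field.
by rewrite !gt_eqF.
Qed.

(** Off the diagonal the covariances cancel by reflection of one axis; this is where isotropy
    enters. *)
Lemma slope_orthonormal (i j : 'I_d) : cov P (slope i) (slope j) = (i == j)%:R.
Proof.
have LB : L (fun w => Y (unitv i) w - Y (- unitv i) w) by exact: (gspaceB gL).
have Lj := slope_in j.
rewrite (covZl gL)// (covBl gL)// !cov_field_slope.
have -> : - unitv i + unitv j = - (unitv i - unitv j) :> 'rV[R]_d by rewrite opprB addrC.
have -> : - unitv i - unitv j = - (unitv i + unitv j) :> 'rV[R]_d by rewrite opprD.
rewrite !qN -/(sg i).
have g0 := sg_gt0 i; have g0' := sg_gt0 j.
have [<-|ij] := eqVneq i j.
  rewrite subrr q0 (_ : unitv i + unitv i = 2 *: unitv i); last by rewrite scaler_nat mulr2n.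
  have -> : q (2 *: unitv i) = 2 * sg i ^+ 2 by rewrite sg_sqr /slope_var; field.
  by rewrite mulr1n; field; rewrite !gt_eqF.
by rewrite (q_reflect ij) subrr mulr0.
Qed.

Lemma cov_slope_origin (i : 'I_d) : cov P (slope i) (Y 0) = 0.
Proof. by rewrite covC cov_field_slope !(add0r, sub0r) qN subrr mul0r. Qed.

Lemma cov_origin : cov P (Y 0) (Y 0) = 1.
Proof. by rewrite covY subrr q0 mul0r subr0. Qed.

Let r s := 1 - q s / u ^+ 2.
Let residual_field s w := u * (Y s w - r s * Y 0 w).
Let residual_plane s w := Num.sqrt lam * \sum_(i < d) s 0 i * slope i w.
(* Error of the linear approximation of the field, made orthogonal to [Y 0]. *)
Definition residual s w := residual_field s w - residual_plane s w.

Let L0 := LY 0.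
Let LF s : L (residual_field s).
Proof. by apply: (gspaceZ gL); apply: (gspaceB gL) => //; exact: (gspaceZ gL). Qed.
Let Lsl s : L (fun w => \sum_(i < d) s 0 i * slope i w).
Proof.
apply: (gspace_sum gL _ (F := fun (i : 'I_d) w => s 0 i * slope i w) L0) => i.
by apply: (gspaceZ gL); exact: slope_in.
Qed.
Let LP s : L (residual_plane s).
Proof. exact: (gspaceZ gL). Qed.
Lemma residual_in s : L (residual s).
Proof. exact: (gspaceB gL). Qed.

Let cov_plane s A : L A ->
  cov P (residual_plane s) A = Num.sqrt lam * \sum_(i < d) s 0 i * cov P (slope i) A.
Proof.
move=> LA; rewrite (covZl gL)//; congr (_ * _).
have Li (i : 'I_d) : L (fun w => s 0 i * slope i w).
  by apply: (gspaceZ gL); exact: slope_in.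
rewrite (cov_suml gL (F := fun (i : 'I_d) w => s 0 i * slope i w) _ LA LA Li).
by apply: eq_bigr => i _; rewrite (covZl gL)//; exact: slope_in.
Qed.

Let cov_plane_sqr s : cov P (residual_plane s) (residual_plane s) = lam * sqn s.
Proof.
have sl : Num.sqrt lam ^+ 2 = lam by rewrite sqr_sqrtr// ltW.
rewrite cov_plane// -[in RHS]sl expr2 -mulrA; congr (_ * _).
rewrite [in RHS]/sqn mulr_sumr; apply: eq_bigr => i _.
rewrite covC cov_plane; last exact: slope_in.
rewrite mulrCA; congr (_ * _); rewrite expr2 mulrC (bigD1 i)//= slope_orthonormal eqxx mulr1.
by rewrite big1 ?addr0// => j ji; rewrite slope_orthonormal (negbTE ji) mulr0.
Qed.

Let cov_planeB s t : cov P (fun w => residual_plane s w - residual_plane t w)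
  (fun w => residual_plane s w - residual_plane t w) = lam * sqn (s - t).
Proof.
rewrite (_ : (fun w => _) = residual_plane (s - t)); first exact: cov_plane_sqr.
apply/funext => w; rewrite /residual_plane -mulrBr -sumrB; congr (_ * _).
by apply: eq_bigr => i _; rewrite !mxE mulrBl.
Qed.

Lemma residual_orth s : cov P (residual s) (Y 0) = 0.
Proof.
rewrite (covBl gL)// cov_plane// big1 ?mulr0 ?subr0; last first.
  by move=> i _; rewrite cov_slope_origin mulr0.
rewrite (covZl gL)//; last by apply: (gspaceB gL) => //; exact: (gspaceZ gL).
rewrite (covBl gL)//; last exact: (gspaceZ gL).
by rewrite (covZl gL)// cov_origin covY sub0r qN mulr1 subrr mulr0.
Qed.

Let cov_fieldBE s t : cov P (fun w => residual_field s w - residual_field t w)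
    (fun w => residual_field s w - residual_field t w) =
  2 * q (s - t) - (u * (r s - r t)) ^+ 2.
Proof.
pose W w := u * (Y s w - Y t w).
have LW : L W by apply: (gspaceZ gL); exact: (gspaceB gL).
set c := u * (r s - r t).
have E : (fun w => residual_field s w - residual_field t w) = fun w => W w - c * Y 0 w.
  by apply/funext => w; rewrite /residual_field /W /c; ring.
have Lc : L (fun w => c * Y 0 w) by exact: (gspaceZ gL).
have WY : cov P W (Y 0) = c.
  rewrite (covZl gL)//; last exact: (gspaceB gL).
  by rewrite (covBl gL)// !covY !sub0r !qN.
rewrite E (cov_sqrB gL)// (covZr gL _ LW L0) WY (covZl gL _ L0 Lc) (covZr gL _ L0 L0) cov_origin.
have -> : cov P W W = 2 * q (s - t).
  have LYst : L (fun w => Y s w - Y t w) by exact: (gspaceB gL).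
  rewrite (covZl gL _ LYst LW) (covZr gL _ LYst LYst) (cov_sqrB gL)// !covY !subrr q0.
  by rewrite -[t - s]opprB qN; field; rewrite gt_eqF.
by ring.
Qed.

Let cov_fieldB s t : cov P (fun w => residual_field s w - residual_field t w)
  (fun w => residual_field s w - residual_field t w) <= 2 * q (s - t).
Proof. by rewrite cov_fieldBE gerBl sqr_ge0. Qed.

(** Nonnegativity of a variance controls the increments of the correlation [r] by [q]; continuity of
    [r] follows. *)
Let covariance_sqr_le s t : (u * (r s - r t)) ^+ 2 <= 2 * q (s - t).
Proof. have := cov_ge0 P (fun w => residual_field s w - residual_field t w).
by rewrite cov_fieldBE subr_ge0. Qed.

Let LB A B : L A -> L B -> L (fun w => A w - B w).
Proof. exact: (gspaceB gL). Qed.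

Lemma residual_incr s t : (forall i, `|s 0 i| <= K) -> (forall i, `|t 0 i| <= K) ->
  cov P (fun w => residual s w - residual t w) (fun w => residual s w - residual t w) <=
  8 * lam * sqn (s - t).
Proof.
move=> sK tK.
have E : (fun w => residual s w - residual t w) =
    fun w => (residual_field s w - residual_field t w) -
             (residual_plane s w - residual_plane t w).
  by apply/funext => w; rewrite /residual; ring.
rewrite E (le_trans (cov_sqrB_le gL (LB (LF s) (LF t)) (LB (LP s) (LP t))))// cov_planeB.
have := cov_fieldB s t; have : `|q (s - t) - lam / 2 * sqn (s - t)| <= eta * sqn (s - t).
  apply: q_approx => i; rewrite !mxE (le_trans (ler_normB _ _))//.
  by have := sK i; have := tK i; lra.
rewrite ler_norml => /andP[_ h1] h2.
have h3 : 4 * (eta * sqn (s - t)) <= lam * sqn (s - t).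
  by rewrite mulrA ler_wpM2r// sqn_ge0.
have : 0 <= lam * sqn (s - t) by rewrite mulr_ge0 ?sqn_ge0 ?ltW.
by move: (cov P _ _) h2 => v h2; lra.
Qed.

Let slope_ratio (i : 'I_d) :
  Num.sqrt lam / sg i <= 2 /\ lam * (1 - Num.sqrt lam / sg i) <= 2 * eta.
Proof.
have sl : Num.sqrt lam ^+ 2 = lam by rewrite sqr_sqrtr// ltW.
rewrite -[X in X * (1 - _)]sl; apply: ratio_bounds; rewrite ?sl ?sqrtr_gt0//.
by rewrite sg_sqr.
Qed.

Definition residual_cst : R := d%:R * (6 * K ^+ 2 + 4 * K * (d%:R * K ^+ 2 + 1)).

(** The field and the plane each contribute about lam |s|^2 to the variance, and twice their
    covariance removes as much. The leading terms cancel coordinate by coordinate and a multiple of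
    eta is left. *)
Lemma residual_small s : (forall i, `|s 0 i| <= K) ->
  cov P (residual s) (residual s) <= eta * residual_cst.
Proof.
move=> sK.
have sqnK : sqn s <= d%:R * K ^+ 2.
  rewrite /sqn (le_trans (ler_sum _ (_ : forall i, true -> s 0 i ^+ 2 <= K ^+ 2)))//.
    by move=> i _; rewrite -real_normK ?num_real// lerXn2r ?nnegrE.
  by rewrite sumr_const card_ord mulr_natl.
have LYs := LY s; have LrY : L (fun w => r s * Y 0 w) by exact: (gspaceZ gL).
have LYrY := gspaceB gL LYs LrY.
have cFF : cov P (residual_field s) (residual_field s) <= (lam + 2 * eta) * sqn s.
  rewrite (covZl gL _ LYrY (LF s)) (covZr gL _ LYrY LYrY) (cov_sqrB gL LYs LrY).
  rewrite (covZr gL _ LYs L0) (covZl gL _ L0 LrY) (covZr gL _ L0 L0) cov_origin.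
  rewrite !covY subrr q0 sub0r qN -/(r s).
  have -> : u * (u * (1 - 0 / u ^+ 2 - 2 * (r s * r s) + r s * (r s * 1))) =
     2 * q s - (q s / u) ^+ 2 by rewrite /r; field; rewrite gt_eqF.
  have : `|q s - lam / 2 * sqn s| <= eta * sqn s.
    by apply: q_approx => i; have := sK i; move: K0; lra.
  rewrite ler_norml => /andP[_ h]; have := sqr_ge0 (q s / u).
  by move: (_ ^+ 2) => v v0; lra.
have cPF : cov P (residual_field s) (residual_plane s) =
    Num.sqrt lam * \sum_(i < d) s 0 i * ((q (s + unitv i) - q (s - unitv i)) / (2 * sg i)).
  rewrite covC cov_plane//; congr (_ * _); apply: eq_bigr => i _; congr (_ * _).
  rewrite (covZr gL _ (slope_in i) LYrY) (covBr gL (slope_in i) LYs LrY).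
  rewrite (covZr gL _ (slope_in i) L0) cov_slope_origin mulr0 subr0 covC cov_field_slope.
  by have g0 := sg_gt0 i; field; rewrite !gt_eqF.
rewrite (cov_sqrB gL (LF s) (LP s)) cPF cov_plane_sqr.
(* Of 6 K^2, a part 2 K^2 comes from the error of q at s and 4 K^2 from replacing sqrt lam / sg i by
   1. The last summand is the error of q at s + e_i and s - e_i. *)
pose c := 6 * K ^+ 2 + 4 * K * (d%:R * K ^+ 2 + 1).
have term (i : 'I_d) : 2 * (lam + eta) * s 0 i ^+ 2 -
    2 * Num.sqrt lam * (s 0 i * ((q (s + unitv i) - q (s - unitv i)) / (2 * sg i))) <= eta * c.
  have g0 := sg_gt0 i; have [t2 t1] := slope_ratio i.
  have bnd (a : R) : `|a| <= 1 -> forall j, `|(s + a *: unitv i) 0 j| <= 2 * K + 2.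
    move=> a1 j; rewrite mxE (le_trans (ler_normD _ _))//.
    have : `|(a *: unitv i) 0 j : R| <= 1.
      by rewrite mxE normrM mulr_ile1// unitv_le1.
    by have := sK j; move: K0; lra.
  have hp := q_approx (bnd 1 _); have hm := q_approx (bnd (-1) _).
  rewrite !sqnD_unitv !(scaleN1r, scale1r) normrN1 normr1 in hp hm.
  have {hp} := hp (lexx _); have {hm} := hm (lexx _).
  set qm := q _; set qp := q _; rewrite !ler_norml => /andP[m1 m2] /andP[p1 p2].
  set tau := Num.sqrt lam / sg i in t1 t2.
  have tau0 : 0 <= tau by rewrite divr_ge0 ?sqrtr_ge0 ?ltW.
  have -> : 2 * Num.sqrt lam * (s 0 i * ((qp - qm) / (2 * sg i))) = tau * (s 0 i * (qp - qm)).
    by rewrite /tau; field; rewrite gt_eqF.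
  have dq : `|qp - qm - 2 * lam * s 0 i| <= eta * (2 * (d%:R * K ^+ 2 + 1)).
    have : eta * sqn s <= eta * (d%:R * K ^+ 2) by rewrite ler_wpM2l// ltW.
    by rewrite ler_norml => e1; apply/andP; split; lra.
  have sd : 2 * lam * s 0 i ^+ 2 - K * (eta * (2 * (d%:R * K ^+ 2 + 1))) <= s 0 i * (qp - qm).
    have := ler_pM (normr_ge0 _) (normr_ge0 _) (sK i) dq.
    by rewrite -normrM ler_norml => /andP[+ _]; rewrite expr2; lra.
  have := ler_wpM2l tau0 sd.
  have sK2 : s 0 i ^+ 2 <= K ^+ 2 by rewrite -real_normK ?num_real// lerXn2r ?nnegrE.
  have s20 := sqr_ge0 (s 0 i).
  have : s 0 i ^+ 2 * (lam * (1 - tau)) <= s 0 i ^+ 2 * (2 * eta) by rewrite ler_wpM2l.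
  have : 6 * eta * s 0 i ^+ 2 <= 6 * eta * K ^+ 2 by rewrite ler_wpM2l// mulr_ge0// ltW.
  have : tau * (K * (eta * (2 * (d%:R * K ^+ 2 + 1)))) <= 2 * (K * (eta * (2 * (d%:R * K ^+ 2 + 1)))).
    by rewrite ler_wpM2r// !mulr_ge0// ?(ltW eta0)// addr_ge0// mulr_ge0// sqr_ge0.
  by rewrite /c; lra.
have := ler_sum (index_enum 'I_d) (fun i (_ : true) => term i).
rewrite sumr_const card_ord sumrB -!mulr_sumr -/(sqn s) -[_ *+ d]mulr_natl /residual_cst -/c.
by lra.
Qed.

Let sqn_le s (m : R) : (forall i, `|s 0 i| <= m) -> sqn s <= d%:R * m ^+ 2.
Proof.
move=> sm; have m2 i : s 0 i ^+ 2 <= m ^+ 2.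
  by rewrite -real_normK ?num_real// lerXn2r ?nnegrE// (le_trans _ (sm i)).
rewrite /sqn (le_trans (ler_sum _ (fun i _ => m2 i)))//.
by rewrite sumr_const card_ord mulr_natl.
Qed.

Let q_le x : (forall i, `|x 0 i| <= 2 * K + 2) -> q x <= lam * sqn x.
Proof.
move=> /q_approx; rewrite ler_norml => /andP[_ h].
have : 4 * eta * sqn x <= lam * sqn x by rewrite ler_wpM2r ?sqn_ge0.
by have := mulr_ge0 (ltW lam0) (sqn_ge0 x); lra.
Qed.

Let continuous_r : continuous r.
Proof.
move=> s; apply: (cvgrPdist_le (F := nbhs s) _ _).2 => e e0.
have up : 0 < u ^+ 2 by rewrite exprn_gt0.
pose C := 2 * lam * d%:R / u ^+ 2.
have C0 : 0 <= C by rewrite divr_ge0 ?(ltW up)// !mulr_ge0// ltW.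
have C1 : 0 < C + 1 by rewrite ltr_wpDl.
pose dl := Num.min (2 * K + 2) (e / (C + 1)).
have dl0 : 0 < dl.
  by rewrite lt_min divr_gt0// andbT ltr_wpDl// mulr_ge0.
apply/nbhs_ballP; exists dl => //= t [_ st].
have st' i : `|(s - t) 0 i| <= dl by rewrite !mxE; apply: ltW; exact: st.
have h1 : q (s - t) <= lam * sqn (s - t).
  by apply: q_le => i; rewrite (le_trans (st' i))// ge_min lexx.
have h2 := sqn_le st'.
have h3 : dl ^+ 2 <= (e / (C + 1)) ^+ 2.
  by rewrite lerXn2r ?nnegrE ?(ltW dl0) ?divr_ge0 ?(ltW e0) ?(ltW C1)// ge_min lexx orbT.
have h4 := covariance_sqr_le s t.
rewrite -ler_sqr ?nnegrE ?(ltW e0)// real_normK ?num_real//.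
have {h4} : (r s - r t) ^+ 2 <= C * (e / (C + 1)) ^+ 2.
  rewrite -(ler_pM2l up) -exprMn (le_trans h4)// /C mulrA [u ^+ 2 * _]mulrC divfK ?gt_eqF//.
  have h5 : sqn (s - t) <= d%:R * (e / (C + 1)) ^+ 2.
    by rewrite (le_trans h2)// ler_wpM2l.
  by have := ler_wpM2l (ltW lam0) h5; lra.
move=> /le_trans; apply.
rewrite expr_div_n mulrCA ger_pMr ?exprn_gt0// ler_pdivrMr ?exprn_gt0// mul1r.
by rewrite expr2; have := sqr_ge0 C; rewrite expr2; lra.
Qed.

Let continuous_residual w : continuous (Y ^~ w) -> continuous (residual ^~ w).
Proof.
move=> cY s.
have cF : {for s, continuous (fun s => u * (Y s w - r s * Y 0 w))}.
  apply: (@cvgM _ _ (nbhs s) _ (fun=> u)); first exact: cvg_cst.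
  apply: (@cvgB _ _ _ (nbhs s)); first exact: cY.
  by apply: (@cvgM _ _ (nbhs s) _ r (fun=> Y 0 w)); [exact: continuous_r|exact: cvg_cst].
have cP : {for s, continuous (fun s : 'rV[R]_d => Num.sqrt lam * \sum_(i < d) s 0 i * slope i w)}.
  apply: (@cvgM _ _ (nbhs s) _ (fun=> Num.sqrt lam)); first exact: cvg_cst.
  apply: (@cvg_big _ _ +%R 0 xpredT (@add_continuous _) _ (nbhs s)) => i _.
  apply: (@cvgM _ _ (nbhs s) _ (fun s : 'rV[R]_d => s 0 i) (fun=> slope i w)).
    exact: coord_continuous.
  exact: cvg_cst.
exact: (cvgB cF cP).
Qed.

(** Here 4 kappa serves single values. Increments at distance dl in the unit cube have variance at
    most 4 kappa and at most 32 lam d K^2 dl^2; the square root of the product is dl sqrt (128 lam d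
    K^2 kappa), linear in dl with a coefficient that vanishes with eta. *)
Definition uniform_cst : R :=
  let kappa := eta * residual_cst in
  2 * expR (1 / 2) * ((2 * d).+1.*2)`!%:R *
  (4 * kappa + 4 * Num.sqrt (128 * lam * d%:R * K ^+ 2 * kappa)) ^+ (2 * d).+1.

Lemma residual_uniform (U e : R) : 0 < e -> exists N : set T,
  [/\ measurable N, fine (P ([set w | U < Y 0 w] `&` N)) <=
     fine (P [set w | U < Y 0 w]) * uniform_cst * chaining_cst d e &
  forall w, ~ N w -> continuous (Y ^~ w) ->
    forall s, (forall i, `|s 0 i| <= K) -> `|residual s w| <= e].
Proof.
move=> e0; set kappa := eta * residual_cst.
have kappa0 : 0 <= kappa.
  rewrite mulr_ge0 ?(ltW eta0)// mulr_ge0// addr_ge0// mulr_ge0 ?sqr_ge0//.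
    by rewrite mulr_ge0.
  by rewrite addr_ge0// mulr_ge0// sqr_ge0.
pose m := Num.sqrt (128 * lam * d%:R * K ^+ 2 * kappa).
have m0 : 0 <= m by rewrite sqrtr_ge0.
have m2 : m ^+ 2 = 128 * lam * d%:R * K ^+ 2 * kappa.
  rewrite sqr_sqrtr// mulr_ge0// mulr_ge0 ?sqr_ge0// mulr_ge0// mulr_ge0//.
  exact: ltW.
(* Chaining works on the unit cube, which this affine map carries onto [-K, K]^d. *)
pose f (t : 'rV[R]_d) : 'rV[R]_d := (2 * K) *: t - const_mx K.
have fE t i : f t 0 i = 2 * K * t 0 i - K by rewrite !mxE.
have fK t : in_cube t -> forall i, `|f t 0 i| <= K.
  move=> ct i; rewrite fE; have /andP[t0 t1] := ct i.
  have := mulr_ge0 K0 t0; have : K * t 0 i <= K by rewrite ler_piMr.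
  by rewrite ler_norml => h1 h2; apply/andP; split; lra.
have cf : continuous f.
  move=> t; apply: (@cvgB R 'rV[R]_d _ (nbhs t) _ (fun t => (2 * K) *: t)).
    exact: (@scaler_continuous R 'rV[R]_d).
  exact: cvg_cst.
pose k := (2 * d)%N; pose Ck : R := 2 * expR (1 / 2) * (k.+1.*2)`!%:R.
have Ck0 : 0 <= Ck by rewrite !mulr_ge0// expR_ge0.
set pE := fine _.
have pE0 : 0 <= pE by exact: fineP_ge0.
have tail B (v y : R) : L B -> cov P B (Y 0) = 0 -> 0 < y -> cov P B B <= v ->
    fine (P ([set w | U < Y 0 w] `&` [set w | y < `|B w|])) <=
    pE * Ck * (4 * v / y ^+ 2) ^+ k.+1.
  move=> LB' oB y0 Bv; apply: (le_trans (gspace_orth_tail gL L0 cov_origin U k LB' oB y0)).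
  rewrite -/pE -/Ck mulrA ler_wpM2l ?mulr_ge0//.
  have y2 : 0 <= (y ^+ 2)^-1 by rewrite invr_ge0 sqr_ge0.
  have v0 : 0 <= v by exact: le_trans (cov_ge0 P B) Bv.
  have B4 : 4 * cov P B B <= 4 * v by rewrite ler_wpM2l.
  rewrite lerXn2r ?nnegrE; [|by rewrite mulr_ge0// mulr_ge0// cov_ge0
    |by rewrite mulr_ge0// mulr_ge0|by rewrite ler_wpM2r].
  by [].
have mono (v y : R) : 0 < y -> 0 <= v -> v <= 4 * kappa + 4 * m ->
   pE * Ck * (v / y ^+ 2) ^+ k.+1 <=
   pE * uniform_cst * (1 / y ^+ 2) ^+ k.+1.
  move=> y0 v0 vm; rewrite /uniform_cst -/kappa -/m -/k -/Ck [X in _ <= X * _]mulrA -[leRHS]mulrA.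
  rewrite ler_wpM2l ?(mulr_ge0 pE0 Ck0)//.
  have y2 : 0 <= (y ^+ 2)^-1 by rewrite invr_ge0 sqr_ge0.
  rewrite -exprMn lerXn2r ?nnegrE; [|by rewrite mulr_ge0
    |by rewrite mul1r mulr_ge0// (le_trans v0 vm)|by rewrite mul1r ler_wpM2r].
  by [].
have [|||||N [mN PN HN]] := @chaining _ _ _ P d (fun t w => residual (f t) w)
  [set w | U < Y 0 w] (pE * uniform_cst) _ _ _ _ _ e e0.
- by move=> t; apply: (gspace_measurable gL); exact: residual_in.
- by apply: measurable_gt; exact: (gspace_measurable gL).
- rewrite !mulr_ge0// exprn_ge0// addr_ge0// mulr_ge0//.
- move=> t y ct y0; apply: le_trans (mono _ _ y0 _ _).
  + apply: (tail _ kappa _ (residual_in _) (residual_orth _) y0).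
    exact: (residual_small (fK _ ct)).
  + by rewrite mulr_ge0.
  + by rewrite lerDl mulr_ge0.
- move=> t t' y dl ct ct' y0 dl0 tt'.
  have Lt := residual_in (f t); have Lt' := residual_in (f t').
  have v1 := residual_incr (fK _ ct) (fK _ ct').
  have := cov_sqrB_le gL Lt Lt'.
  have := residual_small (fK _ ct); have := residual_small (fK _ ct').
  rewrite -/kappa => k1 k2 v2.
  have v3 : sqn (f t - f t') <= d%:R * (2 * K * dl) ^+ 2.
    apply: sqn_le => i; rewrite mxE [X in _ + X]mxE !fE.
    rewrite (_ : _ - _ = 2 * K * (t 0 i - t' 0 i)); last by ring.
    rewrite normrM.
    by rewrite ger0_norm ?mulr_ge0// ler_wpM2l ?mulr_ge0.
  apply: (@le_trans _ _ (pE * Ck * (4 * (dl * m) / y ^+ 2) ^+ k.+1)).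
    apply: tail => //; first exact: (gspaceB gL).
      by rewrite (covBl gL)// !residual_orth subrr.
    rewrite -ler_sqr ?nnegrE ?cov_ge0 ?mulr_ge0 ?(ltW dl0)// exprMn m2.
    have v0 := cov_ge0 P (fun w => residual (f t) w - residual (f t') w).
    move: v1 v2 v0; set v := cov P _ _ => v1 v2 v0.
    apply: (@le_trans _ _ ((4 * kappa) * (8 * lam * (d%:R * (2 * K * dl) ^+ 2)))).
      rewrite expr2 ler_pM//; first lra.
      by rewrite (le_trans v1)// ler_wpM2l// mulr_ge0// ltW.
    by rewrite le_eqVlt; apply/orP; left; apply/eqP; ring.
  have -> : 4 * (dl * m) / y ^+ 2 = dl * (4 * m / y ^+ 2) by ring.
  have -> : dl / y ^+ 2 = dl * (1 / y ^+ 2) by ring.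
  rewrite [(dl * (4 * m / _)) ^+ _]exprMn [(dl * (1 / _)) ^+ _]exprMn mulrCA [leRHS]mulrCA.
  rewrite ler_wpM2l ?exprn_ge0 ?(ltW dl0)//.
  by apply: mono => //; rewrite ?mulr_ge0// lerDr mulr_ge0.
exists N; split=> // w Nw cY s sK.
have cD : continuous (fun t => residual (f t) w).
  move=> t; apply: (@continuous_comp _ _ _ f (residual ^~ w)); first exact: cf.
  exact: (continuous_residual cY).
(* For K = 0 the cube collapses to one point and the affine map has no inverse. *)
have [K00|KN0] := eqVneq K 0.
  have ct : in_cube (0 : 'rV[R]_d) by move=> i; rewrite mxE lexx ler01.
  have -> : s = f 0.
    apply/rowP => i; rewrite fE mxE mulr0 sub0r K00 oppr0.
    by apply/eqP; rewrite -normr_le0 -K00.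
  exact: HN.
have Kp : 0 < K by rewrite lt_neqAle eq_sym KN0.
pose t : 'rV[R]_d := \row_i ((s 0 i + K) / (2 * K)).
have -> : s = f t by apply/rowP => i; rewrite fE mxE; field; rewrite gt_eqF.
apply: HN => // i; rewrite mxE; have := sK i; rewrite ler_norml => /andP[h1 h2].
rewrite divr_ge0 ?mulr_ge0//=; last by rewrite -lerBlDr sub0r.
by rewrite ler_pdivrMr ?mulr_gt0// mul1r; lra.
Qed.

Let g w := fnorm d slope w.
(** The maximum over |s| <= rho of lam / 2 |s|^2 - sqrt lam times the inner product of s and G, at y
    = |G|. The absolute value keeps it nonnegative at every real y, as [exceed_prob] asks. *)
Definition required_excess (rho : R) (y : R) : R := lam / 2 * rho ^+ 2 + rho * Num.sqrt lam * `|y|.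
Let excess w := u * (Y 0 w - u).

Let exceedE w (z : R) : (u + z / u < Y 0 w) = (z < excess w).
Proof. by rewrite -ltrBrDl ltr_pdivrMr// /excess mulrC. Qed.

Let fnorm_ge0 w : 0 <= g w.
Proof. exact: sqrtr_ge0. Qed.

Let expansion s w : u * (Y s w - u) =
  excess w * r s - q s + Num.sqrt lam * (\sum_(i < d) s 0 i * slope i w) + residual s w.
Proof.
rewrite /residual /residual_field /residual_plane /excess /r.
by field; rewrite gt_eqF.
Qed.

Let inner_le s w : `|\sum_(i < d) s 0 i * slope i w| <= enorm s * g w.
Proof.
rewrite -ler_sqr ?nnegrE ?mulr_ge0 ?enorm_ge0// real_normK ?num_real//.
rewrite exprMn sqnE /g /fnorm sqr_sqrtr; first exact: cauchy_schwarz_sum.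
by apply: sumr_ge0 => i _; exact: sqr_ge0.
Qed.

Let coord_le s (rho : R) : enorm s <= rho -> forall i, `|s 0 i| <= rho.
Proof.
move=> sr i; apply: le_trans sr; rewrite -ler_sqr ?nnegrE ?enorm_ge0//.
rewrite real_normK ?num_real// sqnE /sqn (bigD1 i)//= lerDl.
by apply: sumr_ge0 => j _; exact: sqr_ge0.
Qed.

(** * Balls above the level, path by path *)

Section pathwise.
Variables (w : T) (rho e eps : R).
Hypotheses (rho0 : 0 <= rho) (rhoK : rho <= K).
Hypothesis small_residual : forall s, (forall i, `|s 0 i| <= K) -> `|residual s w| <= e.

Let ball_facts s : enorm s <= rho ->
  [/\ `|residual s w| <= e, `|q s - lam / 2 * sqn s| <= eta * sqn s,
      `|\sum_(i < d) s 0 i * slope i w| <= rho * g w, sqn s <= rho ^+ 2 & 0 <= sqn s].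
Proof.
move=> sr; have cs := coord_le sr.
have sK i : `|s 0 i| <= K by exact: le_trans rhoK.
split.
- exact: small_residual.
- by apply: q_approx => i; have := sK i; move: K0; lra.
- by rewrite (le_trans (inner_le s w))// ler_wpM2r// fnorm_ge0.
- by rewrite -sqnE lerXn2r ?nnegrE ?enorm_ge0.
- exact: sqn_ge0.
Qed.

(** The factor 1 + eps makes up for the correlation r(s), which is at least 1 - lam rho^2 / u^2; the
    added eps absorbs the residual and the error of q. *)
Lemma ball_of_exceed : 0 <= eps -> eta * rho ^+ 2 + e < eps ->
  1 <= (1 - lam * rho ^+ 2 / u ^+ 2) * (1 + eps) ->
  u + (1 + eps) * (required_excess rho (g w) + eps) / u < Y 0 w ->
  forall s, enorm s <= rho -> u < Y s w.
Proof.
move=> eps0 small u_large ex s /ball_facts[D1 q1 S1 n1 n0].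
have {}ex : (1 + eps) * (required_excess rho (g w) + eps) < excess w.
  by rewrite -exceedE.
have x0 : 0 <= required_excess rho (g w).
  by rewrite addr_ge0 ?mulr_ge0 ?sqr_ge0 ?sqrtr_ge0 ?(ltW lam0).
have ex0 : 0 < excess w.
  by apply: le_lt_trans ex; apply: mulr_ge0; exact: addr_ge0.
rewrite -subr_gt0 -(pmulr_rgt0 _ u0) expansion.
have up : 0 < u ^+ 2 by rewrite exprn_gt0.
have el : eta * sqn s <= lam / 4 * sqn s.
  by rewrite ler_wpM2r//; move: eta_lam; lra.
have ln : lam * sqn s <= lam * rho ^+ 2 by rewrite ler_wpM2l// ltW.
have en : eta * sqn s <= eta * rho ^+ 2 by rewrite ler_wpM2l// ltW.
move: q1; rewrite ler_norml => /andP[q1 q2].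
have ln0 : 0 <= lam * sqn s by rewrite mulr_ge0// ltW.
have r1 : 1 - lam * rho ^+ 2 / u ^+ 2 <= r s.
  rewrite /r lerD2l lerN2 ler_wpM2r ?invr_ge0 ?(ltW up)//; lra.
have h1 : required_excess rho (g w) + eps <= excess w * r s.
  have h2 : 0 <= required_excess rho (g w) + eps by rewrite addr_ge0.
  have h3 := ler_wpM2r h2 u_large; rewrite mul1r in h3.
  have k0 : 0 <= 1 - lam * rho ^+ 2 / u ^+ 2.
    by rewrite -(pmulr_lge0 _ (_ : 0 < 1 + eps)) ?(le_trans ler01)// ltr_wpDr.
  rewrite (le_trans h3)// [leRHS]mulrC.
  apply: (@le_trans _ _ ((1 - lam * rho ^+ 2 / u ^+ 2) * excess w)).
    by rewrite -[leLHS]mulrA ler_wpM2l// ltW.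
  by rewrite ler_wpM2r// ltW.
move: D1 S1; rewrite !ler_norml => /andP[D1 _] /andP[S1 _].
have := ler_wpM2l (sqrtr_ge0 lam) S1.
move: h1; rewrite /required_excess (ger0_norm (fnorm_ge0 w)) /g.
by lra.
Qed.

Lemma exceed_of_ball : (0 < d)%N -> (forall s, enorm s <= rho -> u < Y s w) ->
  u + Num.max 0 (required_excess rho (g w) - (eta * rho ^+ 2 + e)) / u < Y 0 w.
Proof.
move=> d0' ball.
have ex0 : u < Y 0 w.
  by apply: ball; rewrite /enorm big1 ?sqrtr0// => i _; rewrite mxE expr0n.
suff : Num.max 0 (required_excess rho (g w) - (eta * rho ^+ 2 + e)) < excess w.
  by rewrite exceedE.
have xp : 0 < excess w by rewrite mulr_gt0// subr_gt0.
rewrite gt_max xp /=.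
(* On the sphere of radius rho, s = - rho G / |G| makes the linear term minimal. If G = 0, any point
   of the sphere will do, and one exists because d > 0. *)
have [s [sE sS]] : exists s, sqn s = rho ^+ 2 /\
    \sum_(i < d) s 0 i * slope i w = - (rho * g w).
  have [g00|g1] := eqVneq (g w) 0.
    exists (rho *: unitv (Ordinal d0')); split; first by rewrite sqnZ sqn_unitv mulr1.
    rewrite g00 mulr0 oppr0; apply/eqP; rewrite -normr_le0 (le_trans (inner_le _ _))//.
    by rewrite g00 mulr0.
  exists (- (rho / g w) *: \row_i slope i w); split.
    rewrite sqnZ sqrrN expr_div_n (_ : sqn _ = g w ^+ 2); last first.
      rewrite /g sqr_sqrtr ?sumr_ge0// => [|i _]; last exact: sqr_ge0.
      by apply: eq_bigr => i _; rewrite mxE.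
    by rewrite divfK// expf_neq0.
  rewrite (eq_bigr (fun i : 'I_d => - (rho / g w) * slope i w ^+ 2)); last first.
    by move=> i _; rewrite !mxE -mulrA -expr2.
  rewrite -mulr_sumr (_ : \sum_(i < d) _ = g w ^+ 2); last first.
    by rewrite /g sqr_sqrtr ?sumr_ge0// => i _; exact: sqr_ge0.
  by field.
have sn : enorm s = rho by rewrite -[RHS](ger0_norm rho0) -sqrtr_sqr -sE.
have sr : enorm s <= rho by rewrite sn.
have [D1 q1 _ _ _] := ball_facts sr.
have := ball _ sr; rewrite -subr_gt0 -(pmulr_rgt0 _ u0) expansion sS.
move: D1 q1; rewrite !ler_norml sE => /andP[_ D1] /andP[q1 _].
have eta_rho : eta * rho ^+ 2 <= lam / 4 * rho ^+ 2.
  by rewrite ler_wpM2r ?sqr_ge0//; move: eta_lam; lra.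
have q0' : 0 <= q s.
  have : 0 <= lam * rho ^+ 2 by rewrite mulr_ge0 ?sqr_ge0// ltW.
  by lra.
have : excess w * r s <= excess w.
  by rewrite ler_piMr ?(ltW xp)// /r gerBl divr_ge0 ?sqr_ge0.
by rewrite /required_excess (ger0_norm (fnorm_ge0 w)); lra.
Qed.

End pathwise.

(** * Probability that a ball lies above the level *)

Variable N0 : set T.
Hypotheses (mN0 : measurable N0) (PN0 : P N0 = 0%E).
Hypothesis cY : forall w, ~ N0 w -> continuous (Y ^~ w).

Let gu := gtail_gt0 u0.
Let LG (i : nat) (_ : (i < d)%N) : L (slope i) := slope_in i.
Let oG (i j : nat) : (i < d)%N -> (j < d)%N -> cov P (slope i) (slope j) = (i == j)%:R.
Proof. by move=> id jd; exact: (slope_orthonormal (Ordinal id) (Ordinal jd)). Qed.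
Let oG0 (i : nat) : (i < d)%N -> cov P (slope i) (Y 0) = 0.
Proof. by move=> id; exact: (cov_slope_origin (Ordinal id)). Qed.

Let mY0 : measurable_fun setT (Y 0).
Proof. exact: (gspace_measurable gL). Qed.
Let mE : measurable [set w | u < Y 0 w].
Proof. exact: measurable_gt. Qed.
Let mg : measurable_fun setT g.
Proof. exact: (measurable_fnorm gL). Qed.

Lemma measurable_required_excess (rho : R) : measurable_fun setT (required_excess rho).
Proof.
by apply: measurable_funD => //; apply: measurable_funM => //; exact: normr_measurable.
Qed.

Lemma required_excess_ge0 (rho y : R) : 0 <= rho -> 0 <= required_excess rho y.
Proof.
by move=> rho0; rewrite addr_ge0 ?mulr_ge0 ?sqr_ge0 ?sqrtr_ge0 ?(ltW lam0).
Qed.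

Definition survival (rho : R) : R := \int[P]_w expR (- required_excess rho (g w)).

Let bmf_survival (rho : R) : 0 <= rho -> bmf (fun w => expR (- required_excess rho (g w))).
Proof.
move=> rho0; apply: bmf_expRN; last by move=> w; exact: required_excess_ge0.
by apply: measurableT_comp => //; exact: measurable_required_excess.
Qed.

Let exceed_lower (f : R -> R) (b : R) (rho : R) : 0 <= rho ->
  measurable_fun setT f -> (forall y, 0 <= f y) ->
  (forall y, expR (- required_excess rho y) - b <= expR (- f y)) ->
  gtail u * (survival rho - b - 2 / u ^+ 2) <= fine (P [set w | u + f (g w) / u < Y 0 w]).
Proof.
move=> rho0 mf f0 fb.
have := exceed_prob gL LG oG L0 cov_origin oG0 mf f0 u0.
rewrite ler_norml lerBrDl => /andP[+ _]; apply: le_trans.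
rewrite -mulrBr ler_wpM2l ?(ltW gu)// lerB// lerBlDr.
have bf : bmf (fun w => expR (- f (g w))).
  by apply: bmf_expRN => //; exact: measurableT_comp.
rewrite -(Rintegral_cst1 P b) -bmf_RintegralD//; last exact: bmf_cst.
apply: bmf_le_Rintegral; [exact: bmf_survival|by apply: bmfD => //; exact: bmf_cst|].
by move=> w; rewrite -lerBlDr; exact: fb.
Qed.

Let exceed_upper (f : R -> R) (b : R) (rho : R) : 0 <= rho ->
  measurable_fun setT f -> (forall y, 0 <= f y) ->
  (forall y, expR (- f y) <= expR (- required_excess rho y) + b) ->
  fine (P [set w | u + f (g w) / u < Y 0 w]) <= gtail u * (survival rho + b + 2 / u ^+ 2).
Proof.
move=> rho0 mf f0 fb.
have := exceed_prob gL LG oG L0 cov_origin oG0 mf f0 u0.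
rewrite ler_norml lerBlDl => /andP[_ h]; apply: (le_trans h).
rewrite -mulrDr ler_wpM2l ?(ltW gu)// lerD2r.
have bf : bmf (fun w => expR (- f (g w))).
  by apply: bmf_expRN => //; exact: measurableT_comp.
rewrite -(Rintegral_cst1 P b) -bmf_RintegralD//; [|exact: bmf_survival|exact: bmf_cst].
apply: bmf_le_Rintegral => //.
by apply: bmfD; [exact: bmf_survival|exact: bmf_cst].
Qed.

Let mexceed (f : R -> R) : measurable_fun setT f ->
  measurable [set w | u + f (g w) / u < Y 0 w].
Proof.
move=> mf; apply: measurable_lt_fun => //; apply: measurable_funD => //.
by apply: measurable_funM => //; exact: measurableT_comp.
Qed.

Let fineP_setU3 (F A B : set T) : measurable F -> measurable A -> measurable B ->
  F `<=` A `|` B `|` N0 -> fine (P F) <= fine (P A) + fine (P B).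
Proof.
move=> mF mA mB FAB.
apply: (le_trans (fineP_le _ mF _ FAB)); first by do 2 apply: measurableU => //.
rewrite (le_trans (fineP_setU _ (measurableU _ _ mA mB) mN0))// PN0 addr0.
exact: fineP_setU.
Qed.

Let delta (e : R) := uniform_cst * chaining_cst d e.

(** That a whole ball lies above the level is an uncountable intersection of events. It is compared,
    off the null set, with a measurable [M]; the upper bound below uses the opposite implication. *)
Lemma prob_ball_lower (M : set T) (rho e eps : R) : measurable M ->
  0 <= rho -> rho <= K -> 0 < e -> 0 <= eps <= 1 -> eta * rho ^+ 2 + e < eps ->
  1 <= (1 - lam * rho ^+ 2 / u ^+ 2) * (1 + eps) ->
  (forall w, ~ N0 w -> (forall s, enorm s <= rho -> u < Y s w) -> M w) ->
  gtail u * (survival rho - 3 * eps - 2 / u ^+ 2 - delta e) <=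
  fine (P ([set w | u < Y 0 w] `&` M)).
Proof.
move=> mM rho0 rhoK e0 /andP[eps0 eps1] small u_large BM.
have [N [mN PN HN]] := residual_uniform u e0.
pose f y := (1 + eps) * (required_excess rho y + eps).
have f0 y : 0 <= f y by apply: mulr_ge0; apply: addr_ge0 => //; exact: required_excess_ge0.
have mf : measurable_fun setT f.
  by apply: measurable_funM => //; apply: measurable_funD => //; exact: measurable_required_excess.
(* With f = x + (eps x + eps + eps^2), each of the three added terms costs at most eps, because x
   e^(-x) <= 1 and eps <= 1. *)
have fb y : expR (- required_excess rho y) - 3 * eps <= expR (- f y).
  have x0 := required_excess_ge0 y rho0; set x := required_excess rho y in x0 *.
  have -> : - f y = - x + - (eps * x + eps + eps ^+ 2) by rewrite /f -/x; ring.
  rewrite expRD; have h1 := expR_ge1Dx (- (eps * x + eps + eps ^+ 2)).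
  have ex0 := expR_gt0 (- x).
  have h2 : x * expR (- x) <= 1.
    rewrite expRN ler_pdivrMr ?expR_gt0// mul1r (le_trans _ (expR_ge1Dx x))//.
    by rewrite lerDr.
  have h3 : expR (- x) <= 1 by rewrite -[leRHS]expR0 ler_expR oppr_le0.
  have := ler_wpM2l (ltW ex0) h1; apply: le_trans.
  have h4 : eps * (x * expR (- x)) <= eps * 1 by rewrite ler_wpM2l.
  have h5 : (eps + eps ^+ 2) * expR (- x) <= (eps + eps ^+ 2) * 1.
    by rewrite ler_wpM2l// addr_ge0// sqr_ge0.
  have h6 : eps ^+ 2 <= eps by rewrite expr2 ler_piMr.
  by lra.
have := exceed_lower rho0 mf f0 fb; set F := [set w | _] => PF.
have mF : measurable F by exact: mexceed.
have FE w : F w -> u < Y 0 w.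
  by apply: le_lt_trans; rewrite lerDl divr_ge0// ltW.
have h : fine (P F) <= fine (P ([set w | u < Y 0 w] `&` M)) + fine (P ([set w | u < Y 0 w] `&` N)).
  apply: fineP_setU3 => //; [exact: measurableI|exact: measurableI|] => w Fw.
  have [N0w|nN0] := pselect (N0 w); first by right.
  left; have [Nw|nN] := pselect (N w); first by right; split => //; exact: FE.
  left; split; first exact: FE.
  apply: BM => // s; apply: (@ball_of_exceed w rho e eps) => //.
  exact: (HN w nN (cY nN0)).
rewrite (gspace_gtail gL L0 cov_origin) in PN.
by rewrite mulrBr /delta; lra.
Qed.

Lemma prob_ball_upper (M : set T) (rho e eps : R) : (0 < d)%N -> measurable M ->
  0 <= rho -> rho <= K -> 0 < e -> 0 <= eps -> eta * rho ^+ 2 + e <= eps ->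
  (forall w, ~ N0 w -> M w -> forall s, enorm s <= rho -> u < Y s w) ->
  fine (P ([set w | u < Y 0 w] `&` M)) <=
  gtail u * (survival rho + eps + 2 / u ^+ 2 + delta e).
Proof.
move=> d_gt0 mM rho0 rhoK e0 eps0 small MB.
have [N [mN PN HN]] := residual_uniform u e0.
pose f y := Num.max 0 (required_excess rho y - (eta * rho ^+ 2 + e)).
have f0 y : 0 <= f y by rewrite le_max lexx.
have mf : measurable_fun setT f.
  apply: measurable_maxr => //; apply: measurable_funB => //; exact: measurable_required_excess.
have fb y : expR (- f y) <= expR (- required_excess rho y) + eps.
  have x0 := required_excess_ge0 y rho0; have fx : required_excess rho y - f y <= eps.
    rewrite lerBlDr -lerBlDl le_max; apply/orP; right; lra.
  have fx0 : 0 <= required_excess rho y - f y.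
    rewrite subr_ge0 ge_max x0/= gerBl addr_ge0// ?(ltW e0)// mulr_ge0 ?sqr_ge0//.
    exact: ltW.
  have -> : - required_excess rho y = - f y + - (required_excess rho y - f y) by ring.
  rewrite expRD; have h1 := expR_ge1Dx (- (required_excess rho y - f y)).
  have ex0 := expR_gt0 (- f y).
  have h3 : expR (- f y) <= 1 by rewrite -[leRHS]expR0 ler_expR oppr_le0.
  have := ler_wpM2l (ltW ex0) h1.
  have : expR (- f y) * (required_excess rho y - f y) <= 1 * (required_excess rho y - f y).
    by rewrite ler_wpM2r.
  by lra.
have := exceed_upper rho0 mf f0 fb; set F := [set w | _] => PF.
have mF : measurable F by exact: mexceed.
have h : fine (P ([set w | u < Y 0 w] `&` M)) <= fine (P F) + fine (P ([set w | u < Y 0 w] `&` N)).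
  apply: fineP_setU3 => //; [exact: measurableI|exact: measurableI|] => w [Ew Mw].
  have [N0w|nN0] := pselect (N0 w); first by right.
  left; have [Nw|nN] := pselect (N w); first by right.
  left; apply: (@exceed_of_ball w rho e) => //; last exact: MB.
  exact: (HN w nN (cY nN0)).
rewrite (gspace_gtail gL L0 cov_origin) in PN.
by rewrite mulrDr /delta; lra.
Qed.

End rescaled_field.

(** * The limiting survival function *)

(** The base of the power tends to 0 with eta, for fixed K; once it is at most 1 the power may be
    dropped. *)
Lemma uniform_cst_small {R : realType} (d : nat) (lam K tau : R) : 0 < lam -> 0 <= K -> 0 < tau ->
  exists2 eta0 : R, 0 < eta0 &
    forall eta : R, 0 < eta -> eta <= eta0 -> uniform_cst d lam eta K <= tau.
Proof.
move=> lam0 K0 tau0.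
set B : R := 2 * expR (1 / 2) * ((2 * d).+1.*2)`!%:R.
have B0 : 0 <= B by rewrite !mulr_ge0// expR_ge0.
set C := residual_cst d K.
have C0 : 0 <= C.
  rewrite mulr_ge0// addr_ge0// mulr_ge0 ?sqr_ge0//; first by rewrite mulr_ge0.
  by rewrite addr_ge0// mulr_ge0// sqr_ge0.
set c := 128 * lam * d%:R * K ^+ 2.
have c0 : 0 <= c by rewrite mulr_ge0 ?sqr_ge0// mulr_ge0// mulr_ge0// ltW.
pose t := Num.min 1 (tau / (B + 1)).
have B1 : 0 < B + 1 by rewrite ltr_wpDl.
have t0 : 0 < t by rewrite lt_min ltr01/= divr_gt0.
have C1 : 0 < C + 1 by rewrite ltr_wpDl.
have cC1 : 0 < c * C + 1 by rewrite ltr_wpDl// mulr_ge0.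
(* Each of the two bounds makes one of the summands 4 kappa and 4 sqrt (c kappa) at most t / 2. *)
exists (Num.min (t / 8 / (C + 1)) ((t / 8) ^+ 2 / (c * C + 1))).
  by rewrite lt_min !divr_gt0// exprn_gt0// divr_gt0.
move=> eta eta0; rewrite le_min !ler_pdivlMr// => /andP[h1 h2].
rewrite /uniform_cst -/B -/C -/c.
have k1 : eta * C <= t / 8.
  by have := ltW eta0; lra.
have k2 : Num.sqrt (c * (eta * C)) <= t / 8.
  rewrite -[leRHS]ger0_norm ?divr_ge0 ?(ltW t0)// -sqrtr_sqr ler_sqrt ?sqr_ge0//.
  by apply: le_trans h2; rewrite mulrCA ler_wpM2l ?(ltW eta0)// lerDl.
set z := 4 * _ + _.
have z0 : 0 <= z.
  by rewrite addr_ge0// mulr_ge0 ?sqrtr_ge0// mulr_ge0// ltW.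
have zt : z <= t by rewrite /z; lra.
have z1 : z <= 1 by rewrite (le_trans zt)// ge_min lexx.
have zB : z <= tau / (B + 1) by rewrite (le_trans zt)// ge_min lexx orbT.
have : z ^+ (2 * d).+1 <= z by rewrite exprS ler_piMr// exprn_ile1.
move=> /(ler_wpM2l B0)/le_trans; apply.
apply: (@le_trans _ _ ((B + 1) * z)); first by rewrite ler_wpM2r// lerDl.
by rewrite mulrC -ler_pdivlMr.
Qed.

(** * Convergence of the conditional survival functions *)

Section limit_law.
Context {R : realType} {d : nat} {dO : measure_display} {Omega : measurableType dO}.
Variables (P : probability Omega R) (X : 'rV[R]_d -> {RV P >-> R}).
Hypotheses (d_gt0 : (0 < d)%N) (X_stationary : stationary X) (X_isotropic : isotropic X).
Hypotheses (X_centered : centered X) (X_gaussian : gaussian_field X).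
Variable lam : R.
Hypothesis lam0 : 0 < lam.
Hypothesis X_cov : (fun h => covariance_fun X h - (1 - lam / 2 * enorm h ^+ 2))
  =o_ (0 : 'rV[R]_d) (fun h => enorm h ^+ 2).
Variable N0 : set Omega.
Hypotheses (mN0 : measurable N0) (PN0 : P N0 = 0%E).
Hypothesis cX : forall w, ~ N0 w -> continuous (fun s => X s w).
Implicit Types (s t x : 'rV[R]_d) (u K eta : R).

Let L := field_space X.
Let gL : gaussian_space P L := field_gaussian_space X_gaussian X_centered.
Let Y u s : Omega -> R := X (u^-1 *: s).
Let q u x := u ^+ 2 * (1 - covariance_fun X (u^-1 *: x)).
Let LY u s : L (Y u s).
Proof. exact: field_spaceX. Qed.

Let covY u s t : 0 < u -> cov P (Y u s) (Y u t) = 1 - q u (t - s) / u ^+ 2.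
Proof.
move=> u0; rewrite (cov_field X_gaussian X_centered X_stationary) -scalerBr /q.
by field; rewrite gt_eqF.
Qed.

Let qN u x : q u (- x) = q u x.
Proof. by rewrite /q scalerN (covariance_funN X_gaussian X_centered X_stationary). Qed.

Let q_reflect u (i j : 'I_d) : i != j -> q u (unitv i + unitv j) = q u (unitv i - unitv j).
Proof.
move=> ij; pose Q : 'M[R]_d := diag_mx (\row_k (if k == j then -1 else 1)).
have oQ : Q *m Q^T = 1%:M.
  rewrite tr_diag_mx mulmx_diag; apply/matrixP => k l; rewrite !mxE.
  by case: (k == j); rewrite ?mulrNN mulr1.
rewrite /q -(covariance_fun_orthogonal X_gaussian X_centered X_isotropic _ oQ).
congr (_ * (1 - covariance_fun X _)); rewrite -scalemxAl; congr (_ *: _).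
apply/rowP => k; rewrite mul_mx_diag !mxE.
have [->|kj] := eqVneq k j.
  have nij : ((i : nat) == j) = false by rewrite -[LHS]/(i == j) (negbTE ij).
  by rewrite nij eqxx mulrN1 opprD mulr0n oppr0.
have njk : ((j : nat) == k) = false by rewrite -[LHS]/(j == k) eq_sym (negbTE kj).
by rewrite mulr1 njk mulr0n oppr0.
Qed.

(** For x in a bounded box, x / u tends to 0 uniformly; multiplying the expansion of the covariance
    by u^2 restores the scale of x. *)
Let q_approx K eta : 0 < K -> 0 < eta -> exists2 U : R, 0 < U & forall u, U <= u ->
  forall x, (forall i, `|x 0 i| <= K) -> `|q u x - lam / 2 * sqn x| <= eta * sqn x.
Proof.
move=> K0 eta0.
have /eqoP/(_ _ eta0)/nbhs_ballP[r /= r0 Br] := X_cov.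
exists (2 * K / r); first by rewrite divr_gt0// mulr_gt0.
move=> u Uu x xK.
have u0 : 0 < u by apply: lt_le_trans Uu; rewrite divr_gt0// mulr_gt0.
have up : 0 < u ^+ 2 by rewrite exprn_gt0.
have /Br /= : ball (0 : 'rV[R]_d) r (u^-1 *: x).
  split=> // i j; rewrite !ord1 /ball/= !mxE sub0r normrN normrM.
  rewrite gtr0_norm ?invr_gt0// mulrC ltr_pdivrMr//.
  apply: le_lt_trans (xK j) _; rewrite mulrC -ltr_pdivrMr//.
  by apply: lt_le_trans Uu; rewrite ltr_pM2r ?invr_gt0// ltr_pMl// ltr1n.
rewrite [`|enorm _ ^+ 2|]ger0_norm ?sqr_ge0// sqnE sqnZ.
set rho := covariance_fun X _ => h.
have -> : q u x - lam / 2 * sqn x = - (u ^+ 2 * (rho - (1 - lam / 2 * (u^-1 ^+ 2 * sqn x)))).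
  by rewrite /q -/rho; field; rewrite gt_eqF.
rewrite normrN normrM (gtr0_norm up).
have := ler_wpM2l (ltW up) h; congr (_ <= _).
by field; rewrite gt_eqF.
Qed.

Let slope_family u (i : nat) : Omega -> R := slope (Y u) (q u) u i.

Let slope_family_in u (i : nat) (_ : (i < d)%N) : L (slope_family u i).
Proof. exact: (slope_in _ _ gL (LY u)). Qed.

Let slope_family_orthonormal : exists2 U : R, 0 < U & forall u, U <= u ->
  forall i j : nat, (i < d)%N -> (j < d)%N ->
    cov P (slope_family u i) (slope_family u j) = (i == j)%:R.
Proof.
(* Orthonormality involves only the points s + e_i and s - e_i with s a unit vector or its opposite,
   so K = 0 and the coarse error lam / 4 suffice. *)
have l4 : 0 < lam / 4 by rewrite divr_gt0.
have two : 0 < 2 * 0 + 2 :> R by rewrite mulr0 add0r.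
have [U U0 HU] := q_approx two l4; exists U => // u Uu i j id jd.
have u0 : 0 < u by exact: lt_le_trans Uu.
have el : 4 * (lam / 4) <= lam by rewrite mulrC divfK.
exact: (slope_orthonormal gL (LY u) u0 lam0 el (lexx 0)
  (fun s t => covY s t u0) (qN u) (q_reflect u) (HU u Uu) (Ordinal id) (Ordinal jd)).
Qed.

Let chaining_cst_ge0 (e : R) : 0 <= chaining_cst d e.
Proof.
by rewrite /chaining_cst mulr_ge0// mulr_ge0 ?exprn_ge0// divr_ge0// sqr_ge0.
Qed.

(** The first four properties are what [survival_distribution] asks of the limit. In the last one,
    [M] is any measurable version of {u R > r}, described by balls. *)
Lemma survival_limit : exists H : R -> R,
  [/\ H 0 = 1, forall r r', 0 <= r -> r <= r' -> H r' <= H r,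
     forall r, 0 <= r -> 0 <= H r <= expR (- (lam / 2 * r ^+ 2)),
     forall r r', 0 <= r -> r <= r' ->
       H r - H r' <= (r' - r) * (lam * r' + Num.sqrt lam * (1 + d%:R)) &
     forall r tau, 0 < r -> 0 < tau -> exists2 U : R, 0 < U & forall u, U <= u ->
       forall M : set Omega, measurable M ->
       (forall w, ~ N0 w -> (M w <-> exists2 rho, r < rho &
           forall s, enorm s <= rho -> u < X (u^-1 *: s) w)) ->
       `|fine (P ([set w | u < X 0 w] `&` M)) / gtail u - H r| <= tau].
Proof.
have [U1 U10 oG] := slope_family_orthonormal.
(* The slopes at the single level [U1] define [H]: by [fnorm_law] their length has the same law at
   every higher level. *)
pose g := fnorm d (slope_family U1).
have mg : measurable_fun setT g := measurable_fnorm gL (@slope_family_in U1).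
pose H r := \int[P]_w expR (- required_excess lam r (g w)).
have X0Y u : Y u 0 = X 0 by rewrite /Y scaler0.
have LX0 : L (X 0) := field_spaceX X 0.
have sl0 : 0 <= Num.sqrt lam by exact: sqrtr_ge0.
have mH r : measurable_fun setT (fun y => expR (- required_excess lam r y)).
  by apply: measurableT_comp => //; apply: measurableT_comp => //; exact: measurable_required_excess.
have bH r : 0 <= r -> bmf (fun w => expR (- required_excess lam r (g w))).
  move=> r0; apply: bmf_expRN; last by move=> w; exact: required_excess_ge0.
  by apply: measurableT_comp => //; exact: measurable_required_excess.
have HE u r : U1 <= u -> survival P (Y u) (q u) u lam r = H r.
  move=> Uu; apply: (fnorm_law gL (@slope_family_in u) (oG u Uu) (@slope_family_in U1)
    (oG U1 (lexx _)) LX0 (mH r)) => x; exact: expR_ge0.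
have Hmono r r' : 0 <= r -> r <= r' -> H r' <= H r.
  move=> r0 rr'; have r'0 := le_trans r0 rr'.
  apply: bmf_le_Rintegral; [exact: bH|exact: bH|] => w.
  rewrite ler_expR lerN2 /required_excess lerD//.
    by rewrite ler_wpM2l ?divr_ge0 ?(ltW lam0)// lerXn2r ?nnegrE.
  by rewrite ler_wpM2r// ler_wpM2r.
have Hlip r r' : 0 <= r -> r <= r' ->
    H r - H r' <= (r' - r) * (lam * r' + Num.sqrt lam * (1 + d%:R)).
  move=> r0 rr'; have r'0 := le_trans r0 rr'.
  have [ig Eg] := fnorm_mean_le gL (@slope_family_in U1) (oG U1 (lexx _)) LX0.
  pose c := lam * r' * (r' - r).
  have i1 : P.-integrable setT (EFin \o (fun w => (r' - r) * Num.sqrt lam * g w)).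
    exact: integrable_cstM.
  have i2 : P.-integrable setT (EFin \o (fun=> c)) := bmf_integrable _ (bmf_cst _ c).
  rewrite -bmf_RintegralB; [|exact: bH|exact: bH].
  apply: (@le_trans _ _ (\int[P]_w (c + (r' - r) * Num.sqrt lam * g w))).
    apply: le_Rintegral => //.
    - exact: (integrableB measurableT (bmf_integrable _ (bH _ r0)) (bmf_integrable _ (bH _ r'0))).
    - exact: (integrableD measurableT i2 i1).
    move=> w _; set x := required_excess lam r (g w); set x' := required_excess lam r' (g w).
    have x0 : 0 <= x by exact: required_excess_ge0.
    have -> : - x' = - x + - (x' - x) by ring.
    have h : x' - x <= c + (r' - r) * Num.sqrt lam * g w.
      have gw0 : 0 <= g w by exact: sqrtr_ge0.
      rewrite /x' /x /required_excess (ger0_norm gw0) /c.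
      have : lam * (r' - r) * (r' + r) <= lam * (r' - r) * (2 * r').
        by rewrite ler_wpM2l ?mulr_ge0 ?(ltW lam0) ?subr_ge0//; lra.
      by rewrite expr2; lra.
    have xx' : 0 <= x' - x.
      rewrite subr_ge0 /x /x' /required_excess lerD//.
        by rewrite ler_wpM2l ?divr_ge0 ?(ltW lam0)// lerXn2r ?nnegrE.
      by rewrite ler_wpM2r// ler_wpM2r.
    apply: le_trans h; rewrite expRD.
    have ex1 : expR (- x) <= 1 by rewrite -[leRHS]expR0 ler_expR oppr_le0.
    have := ler_wpM2l (expR_ge0 (- x)) (expR_ge1Dx (- (x' - x))).
    have : expR (- x) * (x' - x) <= 1 * (x' - x) by rewrite ler_wpM2r.
    by lra.
  rewrite RintegralD// Rintegral_cst1 RintegralZl//.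
  have : (r' - r) * Num.sqrt lam * \int[P]_w g w <= (r' - r) * Num.sqrt lam * (1 + d%:R).
    by rewrite ler_wpM2l// mulr_ge0// subr_ge0.
  by rewrite /c; lra.
exists H; split=> //.
- rewrite /H; under eq_Rintegral do rewrite /required_excess expr0n mulr0 !mul0r addr0 oppr0 expR0.
  exact: Rintegral_cst1.
- move=> r r0; apply/andP; split.
    by apply: Rintegral_ge0 => w _; exact: expR_ge0.
  rewrite -(Rintegral_cst1 P (expR (- (lam / 2 * r ^+ 2)))).
  apply: bmf_le_Rintegral; [exact: bH|exact: bmf_cst|] => w.
  by rewrite ler_expR lerN2 /required_excess lerDl mulr_ge0// mulr_ge0.
move=> r tau r0 tau0.
pose K := r + 1.
have K0 : 0 < K by rewrite addr_gt0.
pose c := lam * K + Num.sqrt lam * (1 + d%:R).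
have c0 : 0 <= c by rewrite addr_ge0// ?mulr_ge0 ?ltW.
have c1 : 0 < 4 * (c + 1) by rewrite mulr_gt0// ltr_wpDl.
(* The lower bound needs a ball of radius strictly above r; this radius costs at most tau / 4 in
   H. *)
pose rho := r + Num.min 1 (tau / (4 * (c + 1))).
have rrho : r < rho by rewrite ltrDl lt_min ltr01/= divr_gt0.
have rhoK : rho <= K by rewrite lerD2l ge_min lexx.
have rho0 : 0 <= rho by rewrite (le_trans _ (ltW rrho))// ltW.
have Hrho : H r - H rho <= tau / 4.
  apply: (le_trans (Hlip _ _ (ltW r0) (ltW rrho))).
  apply: (@le_trans _ _ ((rho - r) * (c + 1))).
    rewrite ler_wpM2l ?subr_ge0 ?(ltW rrho)//.
    have : lam * rho <= lam * K by rewrite ler_wpM2l// ltW.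
    by rewrite /c; lra.
  have h : rho - r <= tau / (4 * (c + 1)) by rewrite /rho addrC addKr ge_min lexx orbT.
  have c2 : 0 <= c + 1 by rewrite addr_ge0.
  have := ler_wpM2r c2 h; congr (_ <= _); field.
  by rewrite gt_eqF// ltr_wpDl.
pose eps := Num.min 1 (tau / 16).
have eps0 : 0 < eps by rewrite lt_min ltr01 divr_gt0.
have eps1 : eps <= 1 by rewrite ge_min lexx.
have epst : eps <= tau / 16 by rewrite ge_min lexx orbT.
pose e := eps / 4; have e0 : 0 < e by rewrite divr_gt0.
have cc0 := chaining_cst_ge0 e.
have tau'0 : 0 < tau / (4 * (chaining_cst d e + 1)).
  by rewrite divr_gt0// mulr_gt0// ltr_wpDl.
have [eta0 eta00 chaos] := uniform_cst_small d lam0 (ltW K0) tau'0.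
have K2 : 0 < 2 * (K ^+ 2 + 1) by rewrite mulr_gt0// ltr_wpDl// sqr_ge0.
(* eta is chosen after [e], since it has to beat [chaining_cst d e], which grows as [e] decreases; u
   is chosen last. *)
pose eta := Num.min (Num.min (lam / 4) (eps / (2 * (K ^+ 2 + 1)))) eta0.
have eta_gt0 : 0 < eta by rewrite !lt_min eta00 !divr_gt0.
have eta_lam : 4 * eta <= lam.
  have : eta <= lam / 4 by rewrite !ge_min lexx.
  by lra.
have eta_eps : eta * (2 * (K ^+ 2 + 1)) <= eps.
  by rewrite -ler_pdivlMr// !ge_min lexx orbT.
have dlt : uniform_cst d lam eta K * chaining_cst d e <= tau / 4.
  have h : uniform_cst d lam eta K <= tau / (4 * (chaining_cst d e + 1)).
    by apply: chaos => //; rewrite ge_min lexx orbT.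
  apply: (le_trans (ler_wpM2r cc0 h)).
  rewrite -[leLHS]mulrA ler_wpM2l ?(ltW tau0)//.
  rewrite ler_pdivrMl ?mulr_gt0// ?ltr_wpDl//.
  by rewrite mulrAC mulfV// mul1r lerDl.
have small (x : R) : 0 <= x -> x <= K -> eta * x ^+ 2 + e < eps.
  move=> x0 xK; have : eta * x ^+ 2 <= eta * K ^+ 2.
    by rewrite ler_wpM2l ?(ltW eta_gt0)// lerXn2r ?nnegrE// ltW.
  by have := eta_gt0; rewrite /e; lra.
have K22 : 0 < 2 * K + 2 by rewrite addr_gt0// mulr_gt0.
have [U2 U20 HU] := q_approx K22 eta_gt0.
exists (Num.max (Num.max U1 U2) (Num.max 1 (Num.max (16 / tau) (2 * lam * K ^+ 2 / eps)))).
  by rewrite !lt_max U10.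
move=> u; rewrite !ge_max => /andP[/andP[uU1 uU2] /and3P[u1 ut ue]] M mM ME.
have u0 : 0 < u by exact: lt_le_trans u1.
have uu : u <= u ^+ 2 by rewrite expr2 ler_pMl.
have up : 0 < u ^+ 2 by rewrite exprn_gt0.
have tu : 2 / u ^+ 2 <= tau / 8.
  rewrite ler_pdivrMr//; have : tau * (16 / tau) <= tau * u ^+ 2.
    by rewrite ler_wpM2l ?(ltW tau0)// (le_trans ut).
  by rewrite mulrC divfK ?gt_eqF//; lra.
have cYu w : ~ N0 w -> continuous (Y u ^~ w).
  move=> nN s; apply: (@continuous_comp _ _ _ (fun s : 'rV[R]_d => u^-1 *: s) (fun s => X s w)).
    exact: (@scaler_continuous R 'rV[R]_d).
  exact: cX.
have cYst s t := covY s t u0.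
have gu := gtail_gt0 u0.
have lo := @prob_ball_lower _ _ _ P L d (Y u) (q u) u lam eta K gL (LY u) u0 lam0 eta_gt0
  eta_lam (ltW K0) cYst (qN u) (q_reflect u) (HU u uU2) N0 mN0 PN0 cYu M rho e eps mM rho0
  rhoK e0.
have hi := @prob_ball_upper _ _ _ P L d (Y u) (q u) u lam eta K gL (LY u) u0 lam0 eta_gt0
  eta_lam (ltW K0) cYst (qN u) (q_reflect u) (HU u uU2) N0 mN0 PN0 cYu M r e eps d_gt0 mM
  (ltW r0).
rewrite X0Y HE// in lo; rewrite X0Y HE// in hi.
have {}lo : gtail u * (H r - tau) <= fine (P ([set w | u < X 0 w] `&` M)).
  apply: le_trans (lo _ _ _ _).
  - by rewrite ler_wpM2l ?(ltW gu)//; lra.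
  - by rewrite eps1 ltW.
  - exact: small.
  - have h : lam * rho ^+ 2 / u ^+ 2 <= eps / 2.
      rewrite ler_pdivrMr//; have : lam * rho ^+ 2 <= lam * K ^+ 2.
        by rewrite ler_wpM2l ?(ltW lam0)// lerXn2r ?nnegrE// ltW.
      have : eps * (2 * lam * K ^+ 2 / eps) <= eps * u ^+ 2.
        by rewrite ler_wpM2l ?(ltW eps0)// (le_trans ue).
      by rewrite mulrC divfK ?gt_eqF//; lra.
    have : (1 - eps / 2) * (1 + eps) <= (1 - lam * rho ^+ 2 / u ^+ 2) * (1 + eps).
      by rewrite ler_wpM2r ?addr_ge0 ?(ltW eps0)// lerD2l lerN2.
    apply: le_trans; have : eps * eps <= eps * 1 by rewrite ler_wpM2l// ltW.
    by lra.
  - by move=> w nN B; apply/(ME w nN); exists rho.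
have {}hi : fine (P ([set w | u < X 0 w] `&` M)) <= gtail u * (H r + tau).
  apply: (le_trans (hi _ _ _ _ _)) => //.
  - by rewrite lerDl.
  - exact: ltW.
  - by apply/ltW/small; rewrite ?(ltW r0)// lerDl.
  - by move=> w nN /(ME w nN)[rho' rr' B] s sr; apply: B; rewrite (le_trans sr)// ltW.
  by rewrite ler_wpM2l ?(ltW gu)//; lra.
rewrite ler_distl; apply/andP; split; first by rewrite ler_pdivlMr// mulrC.
by rewrite ler_pdivrMr// mulrC.
Qed.

End limit_law.

(** * Measurability of the extremal range *)

Section measurable_range.
Context {R : realType} {d : nat} {dO : measure_display} {Omega : measurableType dO}.
Variables (P : probability Omega R) (X : 'rV[R]_d -> {RV P >-> R}).
Implicit Types (s : 'rV[R]_d) (r u : R).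

Lemma continuous_enorm : continuous (@enorm R d).
Proof.
move=> s; apply: (@continuous_comp _ _ _ (fun s : 'rV[R]_d => \sum_(i < d) s 0 i ^+ 2) (@Num.sqrt R)).
  apply: (@cvg_big _ _ +%R 0 xpredT (@add_continuous _) _ (nbhs s)) => i _.
  apply: (@continuous_comp _ _ _ (fun s : 'rV[R]_d => s 0 i) (fun x : R => x ^+ 2)).
    exact: coord_continuous.
  exact: exprn_continuous.
exact: sqrt_continuous.
Qed.

Lemma compact_enorm_ball r : compact [set s : 'rV[R]_d | enorm s <= r].
Proof.
have cB : compact [set v : 'rV[R]_d | forall i, v ord0 i \in `[- r, r]].
  apply: (@rV_compact _ _ (fun=> `[- r, r]%classic)) => _; exact: segment_compact.
apply: subclosed_compact cB _.
  apply: (@preimage_closed _ _ (@enorm R d) [set x : R | x <= r]); last exact: closed_le.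
  by move=> s _; exact: continuous_enorm.
move=> s /= sr i; rewrite in_itv/= -ler_norml; apply: le_trans sr.
rewrite -ler_sqr ?nnegrE ?enorm_ge0// real_normK ?num_real// sqnE /sqn (bigD1 i)//= lerDl.
by apply: sumr_ge0 => j _; exact: sqr_ge0.
Qed.

Lemma rV_rat_dense (A : set 'rV[R]_d) s : nbhs s A ->
  exists v : 'rV[rat]_d, A (map_mx ratr v).
Proof.
move=> /nbhs_ballP[e /= e0 eA].
have H i : exists x : rat, `|s 0 i - ratr x| < e.
  have /rat_in_itvoo[x] : s 0 i - e < s 0 i + e by move: e0; lra.
  rewrite in_itv/= => /andP[h1 h2]; exists x.
  by rewrite ltr_norml; apply/andP; split; lra.
pose f i := projT1 (cid (H i)).
exists (\row_i f i); apply: eA; split => // i j.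
by rewrite !ord1 /ball/= !mxE /f; case: cid.
Qed.

(** On a compact ball a continuous path attains its minimum, which gives the margin 1 / (n + 1)
    above u. The margin keeps the inequality strict on the way back from rational points, where the
    enlargement of the radius is halved. *)
Lemma ball_subset_rat u r w : continuous (fun s => X s w) -> 0 <= r ->
  (exists2 rho, r < rho & forall s, enorm s <= rho -> u < X s w) <->
  exists m n : nat, forall v : 'rV[rat]_d, enorm (map_mx ratr v : 'rV[R]_d) <= r + m.+1%:R^-1 ->
    u + n.+1%:R^-1 <= X (map_mx ratr v) w.
Proof.
move=> cX r0; split=> [[rho rrho B]|[m [n B]]].
  have [m hm] : exists m : nat, m.+1%:R^-1 < rho - r.
    exists (Num.truncn (rho - r)^-1).
    rewrite invf_plt ?posrE ?subr_gt0//; exact: truncnS_gt.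
  have ne : [set s : 'rV[R]_d | enorm s <= r + m.+1%:R^-1] !=set0.
    by exists 0; rewrite /= /enorm big1 ?sqrtr0 ?addr_ge0// => i _; rewrite mxE expr0n.
  have cX' : {within [set s : 'rV[R]_d | enorm s <= r + m.+1%:R^-1], continuous (fun s => X s w)}.
    exact: continuous_subspaceT.
  have [c cB cmin] := compact_EVT_min ne (@compact_enorm_ball _) cX'.
  have uc : 0 < X c w - u.
    rewrite subr_gt0; apply: B; move: cB; rewrite inE/= => /le_trans; apply.
    by rewrite -lerBrDl ltW.
  exists m, (Num.truncn (X c w - u)^-1) => v vB.
  have vA : (map_mx ratr v : 'rV[R]_d) \in [set s : 'rV[R]_d | enorm s <= r + m.+1%:R^-1].
    by rewrite inE.
  apply: le_trans (cmin _ vA); rewrite -lerBrDl; apply: ltW.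
  by rewrite invf_plt ?posrE//; exact: truncnS_gt.
have m0 : 0 < m.+1%:R^-1 :> R by rewrite invr_gt0.
have n0 : 0 < n.+1%:R^-1 :> R by rewrite invr_gt0.
exists (r + m.+1%:R^-1 / 2) => [|s sr]; first by rewrite ltrDl divr_gt0.
rewrite ltNge; apply/negP => su.
have h1 : \forall v \near s, enorm v < r + m.+1%:R^-1.
  apply: (cvgr_lt _ (@continuous_enorm s)); apply: le_lt_trans sr _; rewrite ltrD2l.
  by rewrite ltr_pdivrMr// ltr_pMr// ltr1n.
have h2 : \forall v \near s, X v w < u + n.+1%:R^-1.
  by apply: (cvgr_lt _ (cX s)); apply: le_lt_trans su _; rewrite ltrDl.
have [v [v1 v2]] := rV_rat_dense (filterI h1 h2).
by have := B v (ltW v1); rewrite leNgt v2.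
Qed.

Lemma Rtilde_gt u r w : 0 <= r -> (r%:E < Rtilde X u 0 w)%E <->
  exists2 rho, r < rho & forall s, enorm s <= rho -> u < X s w.
Proof.
move=> r0; rewrite /Rtilde; split.
  rewrite lt_max => /orP[|]; first by rewrite lte_fin ltNge r0.
  move=> /ereal_sup_gtP[_ [rho [rho0 B] <-]].
  rewrite lte_fin => rrho; exists rho => // s sr; apply: B.
  by rewrite /eball /= subr0.
move=> [rho rrho B]; rewrite lt_max; apply/orP; right; apply/ereal_sup_gtP.
exists rho%:E; last by rewrite lte_fin.
exists rho => //; split; first exact: le_lt_trans rrho.
by move=> s; rewrite /eball /= subr0; exact: B.
Qed.

Lemma Rtilde_ge0 u w : (0 <= Rtilde X u 0 w)%E.
Proof. by rewrite le_max lexx. Qed.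

Variable N0 : set Omega.
Hypothesis mN0 : measurable N0.
Hypothesis cX : forall w, ~ N0 w -> continuous (fun s => X s w).

Lemma measurable_Rtilde u :
  measurable_fun setT (fun w => if w \in N0 then 0%E else Rtilde X u 0 w).
Proof.
apply: (measurability _ (ErealGenOInfty.measurableE R)) => // _ [_ [r ->] <-].
rewrite setTI; have [r0|r0] := ltP r 0.
  rewrite (_ : _ @^-1` _ = setT) //; apply/seteqP; split => // w _ /=.
  rewrite in_itv/= andbT; case: ifP => _; first by rewrite lte_fin.
  by rewrite (lt_le_trans _ (Rtilde_ge0 u w))// lte_fin.
rewrite (_ : _ @^-1` _ = ~` N0 `&` \bigcup_m \bigcup_n \bigcap_(v in [set: 'rV[rat]_d])
   [set w | enorm (map_mx ratr v : 'rV[R]_d) <= r + m.+1%:R^-1 ->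
     u + n.+1%:R^-1 <= X (map_mx ratr v) w]).
  apply: measurableI; first exact: measurableC.
  apply: bigcupT_measurable => m; apply: bigcupT_measurable => n.
  rewrite -[X in measurable X]setCK setC_bigcap; apply: measurableC.
  rewrite bigcup_mkcond; apply: countable_bigcupT_measurable => // v.
  rewrite mem_set//; apply: measurableC.
  have [vr|vr] := leP (enorm (map_mx ratr v : 'rV[R]_d)) (r + m.+1%:R^-1).
    rewrite (_ : [set w | _] = [set w | u + n.+1%:R^-1 <= X (map_mx ratr v) w]).
      exact: measurable_ge.
    by apply/seteqP; split => w //=; apply.
  by rewrite (_ : [set w | _] = setT)//; apply/seteqP; split.
apply/seteqP; split => w /=; rewrite in_itv/= andbT.
  case: ifP => [|/negbT]; first by rewrite lte_fin ltNge r0.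
  rewrite notin_setE => nN /(Rtilde_gt _ _ r0)/(ball_subset_rat _ (cX nN) r0)[m [n B]].
  by split => //; exists m => //; exists n => // v _; exact: B.
move=> [nN [m _ [n _ B]]]; rewrite memNset//.
apply/(Rtilde_gt _ _ r0)/(ball_subset_rat _ (cX nN) r0); exists m, n => v; exact: B.
Qed.

End measurable_range.

(** * Weak convergence from survival functions *)

Section step_approximation.
Context {R : realType}.

(** Heine's theorem with only [x] confined to the compact interval, obtained from the filter form of
    compactness. *)
Lemma uniform_oscillation (phi : R -> R) (B eps : R) : continuous phi -> 0 < eps ->
  exists2 dl : R, 0 < dl & forall x y, 0 <= x <= B -> `|x - y| < dl -> `|phi x - phi y| <= eps.
Proof.
move=> cphi eps0.
have /compact_near_coveringP cB := @segment_compact R 0 B.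
have H : \forall dl \near (0 : R)^'+, `[0, B]%classic `<=`
    [set x | forall y, `|x - y| < dl -> `|phi x - phi y| <= eps].
  apply: cB => x _.
  have e2 : 0 < eps / 2 by rewrite divr_gt0.
  have /cvgrPdist_le/(_ _ e2)/nbhs_ballP[r /= r0 rB] := cphi x.
  have r2 : 0 < r / 2 by rewrite divr_gt0.
  exists (ball x (r / 2), [set dl : R | dl < r / 2]) => /=.
    by split; [exact: nbhsx_ballx|exact: nbhs_right_lt].
  move=> [x' dl] /= [xx' dlr] y x'y.
  have h1 : `|phi x - phi x'| <= eps / 2.
    by apply: rB; apply: lt_trans xx' _; rewrite ltr_pdivrMr// ltr_pMr// ltr1n.
  have h2 : `|phi x - phi y| <= eps / 2.
    apply: rB; rewrite /ball/= (le_lt_trans (ler_distD x' _ _))//.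
    by have := ltrD xx' (lt_trans x'y dlr); rewrite /ball/= -splitr.
  rewrite (le_trans (ler_distD (phi x) _ _))// [leRHS]splitr lerD//.
  by rewrite distrC.
have /nbhs_ballP[r /= r0 rB] := H.
exists (r / 2); first by rewrite divr_gt0.
move=> x y xB; apply: (rB (r / 2)) => //=; last by rewrite divr_gt0.
  by rewrite /ball/= sub0r normrN gtr0_norm ?divr_gt0// ltr_pdivrMr// ltr_pMr// ltr1n.
Qed.

Lemma continuous_EFin : continuous (@EFin R).
Proof. by move=> x; apply: cvg_EFin => //; near=> y. Unshelve. all: by end_near. Qed.

(** A preimage splits into its finite part, where composition with [EFin] is continuous, and the two
    infinite points. *)
Lemma measurable_continuous_ereal (f : \bar R -> R) : continuous f -> measurable_fun setT f.
Proof.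
move=> cf _ A mA; rewrite setTI.
have mphi : measurable_fun setT (f \o EFin).
  apply: continuous_measurable_fun => x; apply: continuous_comp; last exact: cf.
  exact: continuous_EFin.
have mB (x : \bar R) : measurable ([set x] `&` f @^-1` A).
  have [fx|fx] := pselect (A (f x)).
    rewrite (_ : _ `&` _ = [set x]); first exact: emeasurable_set1.
    by apply/seteqP; split => [y []|y /= ->].
  rewrite (_ : _ `&` _ = set0) //.
  by apply/seteqP; split => [y [/= -> /fx]|].
have -> : f @^-1` A = (EFin @` ((f \o EFin) @^-1` A)) `|`
    ([set +oo%E] `&` f @^-1` A) `|` ([set -oo%E] `&` f @^-1` A).
  apply/seteqP; split => [[x| |] fA|x [[[y fA <-]//|[]//]|[]//]].
  - by left; left; exists x.
  - by left; right.
  - by right.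
apply: measurableU => //; apply: measurableU => //.
apply: measurable_image_EFin; rewrite -[X in measurableR X]setTI.
exact: mphi.
Qed.

Variables (f : \bar R -> R) (M : R).
Hypotheses (cf : continuous f) (fM : forall x, `|f x| <= M).

Let mf : measurable_fun setT f := measurable_continuous_ereal cf.

(** The step function with value c k on ]t (k - 1), t k], written by its jumps (Abel summation), so
    that its integral involves the survival function only. *)
Definition step (c t : nat -> R) (n : nat) (v : \bar R) : R :=
  c 1%N + \sum_(1 <= i < n) (c i.+1 - c i) * \1_[set v | ((t i)%:E < v)%E] v.

Lemma stepE (c t : nat -> R) (n : nat) (v : \bar R) : (0 < n)%N ->
  {homo t : i j / (i <= j)%N >-> i <= j} ->
  exists k : nat, [/\ (0 < k <= n)%N, step c t n v = c k,
    (1 < k)%N -> ((t k.-1)%:E < v)%E & (k < n)%N -> (v <= (t k)%:E)%E].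
Proof.
move=> + tm; elim: n => [//|[|n] IH] _.
  by exists 1%N; split => //; rewrite /step big_geq ?addr0.
have [k [/andP[k0 kn] SE kl ku]] := IH isT.
rewrite /step big_nat_recr//= addrA -/(step c t n.+1 v) SE indicE.
have [tv|vt] := ltP (t n.+1)%:E v.
  rewrite mem_set//= mulr1.
  have -> : k = n.+1.
    apply/eqP; rewrite eqn_leq kn/= leqNgt; apply/negP => kn'.
    have := lt_le_trans tv (ku kn'); rewrite lte_fin ltNge tm//; exact: ltnW.
  by exists n.+2; split; rewrite ?leqnn ?ltnn//; ring.
rewrite memNset /=; last by apply/negP; rewrite -leNgt.
rewrite mulr0 addr0; exists k; split => //; first by rewrite k0 ltnW.
move=> _; have [kn'|nk] := ltnP k n.+1; first exact: ku.
by have -> : k = n.+1 by apply/eqP; rewrite eqn_leq kn.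
Qed.

Context d (T : measurableType d).

(** Values in [0, B] are approximated by oscillation; those beyond B, the value +oo included, are
    charged 2 M each. *)
Lemma step_integral (Q : probability T R) (V : T -> \bar R) (B eps : R) (n : nat) :
  measurable_fun setT V -> (forall w, 0 <= V w)%E -> 0 < B -> (0 < n)%N ->
  (forall x y, 0 <= x <= B -> `|x - y| <= B / n%:R -> `|f x%:E - f y%:E| <= eps) ->
  `|\int[Q]_w f (V w) - (f (B / n%:R)%:E + \sum_(1 <= i < n)
      (f (i.+1%:R * (B / n%:R))%:E - f (i%:R * (B / n%:R))%:E) *
      fine (Q [set w | ((i%:R * (B / n%:R))%:E < V w)%E]))| <=
  eps + 2 * M * fine (Q [set w | (B%:E < V w)%E]).
Proof.
move=> mV V0 B0 n0 osc.
pose h := B / n%:R; have h0 : 0 < h by rewrite divr_gt0// ltr0n.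
have nh : n%:R * h = B by rewrite mulrC divfK// pnatr_eq0 -lt0n.
pose t i : R := i%:R * h; pose c i := f (t i)%:E.
have tm : {homo t : i j / (i <= j)%N >-> i <= j}.
  by move=> i j ij; rewrite ler_wpM2r ?ler_nat// ltW.
have M0 : 0 <= M by apply: le_trans (fM 0%E).
have mlt (x : R) : measurable [set w | (x%:E < V w)%E].
  by rewrite -[X in measurable X]setTI; exact: emeasurable_fun_o_infty.
have mf' : measurable_fun setT (fun w => f (V w)) by exact: measurableT_comp.
have bf : bmf (fun w => f (V w)) by split => //; exists M.
have b1 (x : R) : bmf (\1_[set w | (x%:E < V w)%E] : T -> R) by exact: bmf_indic.
have bS1 i : bmf (fun w => (c i.+1 - c i) * \1_[set w | ((t i)%:E < V w)%E] w).
  by apply: bmfM => //; exact: bmf_cst.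
have SV w : step c t n (V w) = c 1%N +
    \sum_(i <- index_iota 1 n) (c i.+1 - c i) * \1_[set w | ((t i)%:E < V w)%E] w.
  by congr (_ + _); apply: eq_bigr => i _; rewrite !indicE; congr (_ * (_)%:R); apply/idP/idP; rewrite !inE.
have bS : bmf (fun w => \sum_(i <- index_iota 1 n) (c i.+1 - c i) * \1_[set w | ((t i)%:E < V w)%E] w).
  elim: (index_iota 1 n) => [|i r IH].
    by under eq_fun do rewrite big_nil; exact: bmf_cst.
  by under eq_fun do rewrite big_cons; exact: bmfD.
have bc := bmf_cst T (c 1%N).
set S := f _ + _.
have -> : S = \int[Q]_w step c t n (V w).
  under eq_Rintegral do rewrite SV.
  rewrite bmf_RintegralD// Rintegral_cst1 Rintegral_sum_bmf// /S -/h.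
  congr (_ + _); first by rewrite /c /t mul1r.
  by apply: eq_bigr => i _; rewrite bmf_RintegralZ// Rintegral_indic.
have bst : bmf (fun w => step c t n (V w)).
  by under eq_fun do rewrite SV; exact: bmfD.
have point w : `|f (V w) - step c t n (V w)| <= eps + 2 * M * \1_[set w | (B%:E < V w)%E] w.
  have [k [/andP[k0 kn] -> kl ku]] := stepE c (V w) n0 tm.
  have eps0 : 0 <= eps.
    apply: le_trans (osc 0 0 _ _); rewrite ?subrr ?normr0 ?lexx//=; last exact: ltW.
    exact: ltW.
  rewrite indicE; have [BV|VB] := ltP B%:E (V w).
    rewrite mem_set// mulr1 (le_trans (ler_normB _ _))//.
    by have := fM (V w); have := fM (t k)%:E; rewrite -/(c k); lra.
  rewrite memNset/=; last by apply/negP; rewrite -leNgt.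
  rewrite mulr0 addr0; move: (V0 w) VB kl ku; case: (V w) => [x| |]//.
  rewrite !lee_fin => x0 xB kl ku; apply: osc; first by rewrite x0.
  have xt : x <= t k.
    move: kn; rewrite leq_eqVlt => /orP[/eqP ->|/ku]; first by rewrite /t nh.
    by [].
  have tx : t k - h <= x.
    have -> : t k - h = t k.-1.
      by rewrite /t -{1}(prednK k0) -natr1 mulrDl mul1r addrK.
    have [k1|k1] := ltnP 1 k; first by have := kl k1; rewrite lte_fin => /ltW.
    have -> : k = 1%N by apply/eqP; rewrite eqn_leq k1.
    by rewrite /t mul0r.
  by rewrite ler_norml -/h; apply/andP; split; lra.
rewrite -bmf_RintegralB//.
have bd : bmf (fun w => f (V w) - step c t n (V w)).
  have := bmfD bf (bmfM (bmf_cst T (-1)) bst).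
  by under eq_fun do rewrite mulN1r.
have bR : bmf (fun w => eps + 2 * M * \1_[set w | (B%:E < V w)%E] w).
  by apply: bmfD; [exact: bmf_cst|apply: bmfM => //; exact: bmf_cst].
apply: (@le_trans _ _ (\int[Q]_w (eps + 2 * M * \1_[set w | (B%:E < V w)%E] w))); last first.
  rewrite bmf_RintegralD//; [|exact: bmf_cst|by apply: bmfM => //; exact: bmf_cst].
  by rewrite Rintegral_cst1 bmf_RintegralZ// Rintegral_indic.
rewrite ler_norml; apply/andP; split.
  have -> : - (\int[Q]_w (eps + 2 * M * \1_[set w | (B%:E < V w)%E] w)) =
      \int[Q]_w (-1 * (eps + 2 * M * \1_[set w | (B%:E < V w)%E] w)).
    by rewrite bmf_RintegralZ// mulN1r.
  apply: bmf_le_Rintegral => //; first by apply: bmfM => //; exact: bmf_cst.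
  by move=> w; have := point w; rewrite mulN1r ler_norml => /andP[].
by apply: bmf_le_Rintegral => // w; have := point w; rewrite ler_norml => /andP[].
Qed.

End step_approximation.

Section weak_limit.
Context {R : realType}.
Variables (f : \bar R -> R) (M : R).
Hypotheses (cf : continuous f) (fM : forall x, `|f x| <= M).
Context d' (T' : measurableType d') (Q' : probability T' R) (V' : T' -> \bar R) (H : R -> R).
Hypotheses (mV' : measurable_fun setT V') (V'0 : forall w, (0 <= V' w)%E).
Hypothesis V'H : forall t : R, 0 < t -> fine (Q' [set w | (t%:E < V' w)%E]) = H t.
Hypothesis H_small : forall tau : R, 0 < tau -> exists2 B : R, 0 < B & H B <= tau.
Context d (T : measurableType d).

(** A test function sees the survival function only at finitely many points. These and the tolerance
    are fixed before [Q] and [V], so one choice serves every level u. *)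
Lemma survival_weak_close (tau : R) : 0 < tau -> exists (ts : seq R) (dl : R),
  [/\ 0 < dl, {in ts, forall t, 0 < t} & forall (Q : probability T R) (V : T -> \bar R),
    measurable_fun setT V -> (forall w, 0 <= V w)%E ->
    {in ts, forall t, `|fine (Q [set w | (t%:E < V w)%E]) - H t| <= dl} ->
    `|\int[Q]_w f (V w) - \int[Q']_w f (V' w)| <= tau].
Proof.
move=> tau0; have M0 : 0 <= M by apply: le_trans (fM 0%E).
have M1 : 0 < 16 * (M + 1) by rewrite mulr_gt0// ltr_wpDl.
have tM : 0 < tau / (16 * (M + 1)) by rewrite divr_gt0.
have [B B0 HB] := H_small tM.
have e0 : 0 < tau / 8 by rewrite divr_gt0.
have cphi : continuous (f \o EFin).
  by move=> x; apply: continuous_comp; [exact: continuous_EFin|exact: cf].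
have [dl0 dl00 osc] := uniform_oscillation B cphi e0.
have [n n_gt0 nd] : exists2 n : nat, (0 < n)%N & B / n%:R < dl0.
  exists (Num.truncn (B / dl0)).+1 => //.
  by rewrite ltr_pdivrMr ?ltr0n// mulrC -ltr_pdivrMr//; exact: truncnS_gt.
have Bn0 : 0 < B / n%:R by rewrite divr_gt0// ltr0n.
have osc' x y : 0 <= x <= B -> `|x - y| <= B / n%:R -> `|f x%:E - f y%:E| <= tau / 8.
  by move=> xB xy; apply: osc => //; exact: le_lt_trans nd.
(* Division by n + 1 because the errors at the n - 1 jumps and in the tail add up. *)
pose dl := tau / (16 * (M + 1)) / n.+1%:R.
have dlp : 0 < dl by rewrite divr_gt0// ltr0n.
exists (B :: [seq i%:R * (B / n%:R) | i <- index_iota 1 n]), dl; split => //.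
  move=> t; rewrite inE => /orP[/eqP -> //|/mapP[i]].
  by rewrite mem_index_iota => /andP[i0 _] ->; rewrite mulr_gt0// ltr0n.
move=> Q V mV V0 Qts.
have hB := Qts B (mem_head _ _); rewrite ler_distl in hB.
have s1 := step_integral cf fM Q mV V0 B0 n_gt0 osc'.
have s2 := step_integral cf fM Q' mV' V'0 B0 n_gt0 osc'.
rewrite V'H// in s2.
pose S (p : R -> R) := \sum_(1 <= i < n)
      (f (i.+1%:R * (B / n%:R))%:E - f (i%:R * (B / n%:R))%:E) * p (i%:R * (B / n%:R)).
have s3 : `|S (fun t => fine (Q [set w | (t%:E < V w)%E])) -
    S (fun t => fine (Q' [set w | (t%:E < V' w)%E]))| <= n%:R * (2 * M * dl).
  rewrite /S -sumrB (le_trans (ler_norm_sum _ _ _))//.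
  apply: (@le_trans _ _ (\sum_(1 <= i < n) (2 * M * dl))).
    rewrite big_nat_cond [leRHS]big_nat_cond; apply: ler_sum => i /andP[/andP[i0 ni] _].
    rewrite -mulrBr normrM V'H ?(mulr_gt0 _ Bn0) ?ltr0n//.
    rewrite ler_pM//.
      rewrite (le_trans (ler_normB _ _))//.
      by move: (fM (i.+1%:R * (B / n%:R))%:E) (fM (i%:R * (B / n%:R))%:E); lra.
    apply: Qts; rewrite inE; apply/orP; right; apply/mapP; exists i => //.
    by rewrite mem_index_iota i0.
  rewrite sumr_const_nat -[leLHS]mulr_natl ler_wpM2r//.
    by apply: mulr_ge0; [exact: mulr_ge0|exact: ltW].
  by rewrite ler_nat leq_subr.
have dlE : 16 * (M + 1) * (n%:R + 1) * dl = tau.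
  by rewrite /dl natr1; field; rewrite !gt_eqF// ltr_wpDl.
have HBE : 16 * (M * H B + H B) <= tau.
  by move: HB; rewrite ler_pdivlMr//; lra.
have h1 : 2 * M * fine (Q [set w | (B%:E < V w)%E]) <= 2 * M * (H B + dl).
  by rewrite ler_wpM2l ?mulr_ge0//; case/andP: hB.
have HB0 : 0 <= H B by rewrite -V'H// fineP_ge0.
move: s1 s2 s3; rewrite -/(S (fun t => fine (Q [set w | (t%:E < V w)%E])))
  -/(S (fun t => fine (Q' [set w | (t%:E < V' w)%E]))).
move: (S _) (S _) (\int[Q]_w _) (\int[Q']_w _) => a b i1 i2.
rewrite !ler_norml => /andP[x1 x2] /andP[y1 y2] /andP[z1 z2].
have n0 : 0 <= n%:R * dl by rewrite mulr_ge0// ltW.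
have Mn0 : 0 <= M * (n%:R * dl) by rewrite mulr_ge0.
have Md0 : 0 <= M * dl by rewrite mulr_ge0// ltW.
apply/andP; split; lra.
Qed.

End weak_limit.

(** * The limit law *)

Section limit_distribution.
Context {R : realType}.
Variables (H : R -> R) (lam c : R).
Hypotheses (lam0 : 0 < lam) (c0 : 0 <= c) (H0 : H 0 = 1).
Hypothesis H_mono : forall r r', 0 <= r -> r <= r' -> H r' <= H r.
Hypothesis H_bound : forall r, 0 <= r -> 0 <= H r <= expR (- (lam / 2 * r ^+ 2)).
Hypothesis H_lip : forall r r', 0 <= r -> r <= r' -> H r - H r' <= (r' - r) * (lam * r' + c).

Lemma survival_small (tau : R) : 0 < tau ->
  exists2 B : R, 0 < B & forall r, B <= r -> H r <= tau.
Proof.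
move=> tau0; exists (Num.max 1 (2 / (lam * tau))).
  by rewrite lt_max ltr01.
move=> r; rewrite ge_max => /andP[r1 rt].
have r0 : 0 <= r by exact: le_trans r1.
have /andP[_ hr] := H_bound r0; apply: (le_trans hr); rewrite expRN.
rewrite invf_ple ?posrE ?expR_gt0//.
apply: le_trans (expR_ge1Dx _); rewrite ler_pdivrMr ?mulr_gt0// in rt.
have rr : r <= r ^+ 2 by rewrite expr2 ler_peMr.
have : lam * tau * r <= lam * tau * r ^+ 2 by rewrite ler_wpM2l// mulr_ge0// ltW.
rewrite -div1r ler_pdivrMr// => h.
by lra.
Qed.

Let F (r : R) : R := 1 - H (Num.max 0 r).

Let F_nondecreasing : nondecreasing F.
Proof.
move=> x y xy; rewrite /F lerD2l lerN2; apply: H_mono; first by rewrite le_max lexx.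
by rewrite ge_max !le_max lexx/= xy orbT.
Qed.

Let F_continuous : continuous F.
Proof.
move=> r; apply/cvgrPdist_le => e e0.
pose m := `|r| + 1; have m0 : 0 < lam * m + c + 1.
  by rewrite ltr_wpDl// addr_ge0// mulr_ge0 ?addr_ge0// ltW.
have lip x y : x <= y -> y <= m -> F y - F x <= (y - x) * (lam * m + c + 1).
  move=> xy ym; rewrite /F opprB addrC addrA subrK.
  have mx : Num.max 0 x <= Num.max 0 y by rewrite ge_max !le_max lexx/= xy orbT.
  have m00 : 0 <= Num.max 0 x by rewrite le_max lexx.
  have mm : 0 <= m by rewrite addr_ge0.
  apply: (le_trans (H_lip m00 mx)).
  have h1 : Num.max 0 y - Num.max 0 x <= y - x.
    case: (leP 0 x) => hx; case: (leP 0 y) => hy; lra.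
  have h2 : Num.max 0 y <= m by rewrite ge_max mm ym.
  rewrite ler_pM ?subr_ge0//; first by rewrite addr_ge0 ?mulr_ge0 ?(ltW lam0)// le_max lexx.
  have := ler_wpM2l (ltW lam0) h2; lra.
apply/nbhs_ballP; exists (Num.min 1 (e / (lam * m + c + 1))) => /=.
  by rewrite lt_min ltr01 divr_gt0.
move=> y; rewrite /ball/= lt_min ltr_pdivlMr// => /andP[ry1 rye].
have ym : y <= m.
  rewrite /m; move: ry1; rewrite ltr_norml => /andP[]; have := ler_norm r; lra.
have rm : r <= m by rewrite /m; have := ler_norm r; lra.
have [yr|ry] := leP y r.
  have f0 : 0 <= F r - F y by rewrite subr_ge0 F_nondecreasing.
  rewrite ger0_norm//; apply: (le_trans (lip _ _ yr rm)).
  by move: rye; rewrite ger0_norm ?subr_ge0// => /ltW.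
have f0 : 0 <= F y - F r by rewrite subr_ge0 F_nondecreasing// ltW.
rewrite distrC ger0_norm//; apply: (le_trans (lip _ _ (ltW ry) ym)).
by move: rye; rewrite distrC ger0_norm ?subr_ge0 ?(ltW ry)// => /ltW.
Qed.

Let F_right_continuous : right_continuous F.
Proof. by move=> r; apply: cvg_at_right_filter; exact: F_continuous. Qed.

HB.instance Definition _ := isCumulative.Build R _ R F F_nondecreasing F_right_continuous.

Let F_Ny : F @ -oo --> (0 : R).
Proof.
apply: cvg_near_cst; exists 0; split => // x x0.
by rewrite /F max_l ?(ltW x0)// H0 subrr.
Qed.

Let F_y : F @ +oo --> (1 : R).
Proof.
apply/cvgrPdist_le => e e0; have [B B0 HB] := survival_small e0.
exists B; split => [|x Bx]; first exact: num_real.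
have x0 : 0 <= x by rewrite ltW// (lt_trans B0).
rewrite /F opprB addrC subrK max_r//.
by have /andP[h _] := H_bound x0; rewrite ger0_norm// HB// ltW.
Qed.

HB.instance Definition _ := isCumulativeBounded.Build R 0 1 F F_Ny F_y.

Let lsf : probability (measurableTypeR R) R := lebesgue_stieltjes_measure F.

Let lsfE (r : R) : lsf [set x : R | x <= r] = (F r)%:E.
Proof.
have := cdf_lebesgue_stieltjes_id F r; rewrite /cdf /distribution /pushforward => <-.
by congr (lsf _); apply/seteqP; split => x /=; rewrite in_itv.
Qed.

(** Truncation at 0 makes the limit variable nonnegative everywhere and not merely almost surely, as
    [survival_weak_close] asks. *)
Let pos (x : measurableTypeR R) : R := Num.max 0 x.

Let mpos : measurable_fun setT pos.
Proof. by apply: measurable_maxr. Qed.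

HB.instance Definition _ := isMeasurableFun.Build _ _ _ _ pos mpos.

(** A point mass at a <= 0 contradicts F 0 = 0. A point mass at a > 0 would make F jump from 0 to 1
    at a, against the Lipschitz bound. *)
Lemma survival_distribution : exists nu : probability R R, non_degenerate nu /\
  exists (V : measurableTypeR R -> \bar R) (Q : probability (measurableTypeR R) R),
  [/\ measurable_fun setT V, forall x, (0 <= V x)%E,
    forall t : R, 0 < t -> fine (Q [set x | (t%:E < V x)%E]) = H t &
    forall f : \bar R -> R, continuous f -> (exists M : R, forall x, `|f x| <= M) ->
      (\int[pushforward nu (@EFin R)]_x (f x)%:E)%E = (\int[Q]_x f (V x))%:E].
Proof.
exists (distribution lsf pos); split.
  move=> [a aE].
  have nuE (r : R) : 0 <= r -> F r = \1_[set x : R | x <= r] a.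
    move=> r0; have mr : measurable [set x : R | x <= r].
      rewrite (_ : [set x | _] = `]-oo, r]%classic); first exact: measurable_itv.
      by apply/seteqP; split => x /=; rewrite in_itv.
    have := aE _ mr; rewrite /distribution /pushforward diracE => h.
    apply: EFin_inj; rewrite indicE -[RHS]h -lsfE; congr (lsf _).
    by apply/seteqP; split => x /=; rewrite /pos ge_max r0.
  have F0 : F 0 = 0 by rewrite /F maxxx H0 subrr.
  have [a0|a0] := leP a 0.
    have := nuE 0 (lexx _); rewrite F0 indicE mem_set//= => /eqP.
    by rewrite eq_sym oner_eq0.
  have Fa : F a = 1 by rewrite nuE ?(ltW a0)// indicE mem_set/=.
  pose K := lam * a + c; have K0 : 0 <= K by rewrite addr_ge0// mulr_ge0 ?ltW.
  (* Between r and a the Lipschitz bound allows an increase of at most K / (2 (K + 1)), which is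
     less than 1. *)
  pose r := Num.max 0 (a - (2 * (K + 1))^-1).
  have r0 : 0 <= r by rewrite le_max lexx.
  have K1 : 0 < 2 * (K + 1) by rewrite mulr_gt0// ltr_wpDl.
  have ra : r < a by rewrite gt_max a0/= gtrDl oppr_lt0 invr_gt0.
  have Fr : F r = 0 by rewrite nuE// indicE memNset//= ; apply/negP; rewrite -ltNge.
  have := H_lip r0 (ltW ra); rewrite -/K.
  have -> : H r - H a = F a - F r by rewrite /F !max_r ?(ltW a0)//; ring.
  rewrite Fa Fr subr0; have : a - r <= (2 * (K + 1))^-1.
    by rewrite lerBlDr -lerBlDl /r le_max lexx orbT.
  move=> /(ler_wpM2r K0) h1 h2; have := le_trans h2 h1.
  by rewrite mulrC ler_pdivlMr// mul1r; lra.
exists (fun x => (pos x)%:E), lsf.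
have mV : measurable_fun setT (fun x : measurableTypeR R => (pos x)%:E).
  exact/measurable_EFinP.
split => //.
- by move=> x; rewrite lee_fin le_max lexx.
- move=> t t0; have mt : measurable ([set x : R | x <= t] : set (measurableTypeR R)).
    rewrite (_ : [set x | _] = `]-oo, t]%classic); first exact: measurable_itv.
    by apply/seteqP; split => x /=; rewrite in_itv.
  rewrite (_ : [set x | _] = ~` [set x : R | x <= t]); last first.
    apply/seteqP; split => x /=; rewrite lte_fin lt_max ltNge (ltW t0)/=.
      by move=> tx; apply/negP; rewrite -ltNge.
    by move=> /negP; rewrite -ltNge.
  by rewrite probability_setC// lsfE /= /F max_r ?(ltW t0)//; ring.
- move=> f cf [M fM]; have mf := measurable_continuous_ereal cf.
  have bf : bmf (fun x => f (pos x)%:E).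
    by split; [exact: measurableT_comp|exists M].
  have mf' : measurable_fun setT (EFin \o f) by exact/measurable_EFinP.
  have iV : lsf.-integrable ((fun x => (pos x)%:E) @^-1` setT) ((EFin \o f) \o (fun x => (pos x)%:E)).
    by rewrite preimage_setT; exact: bmf_integrable.
  have := integral_pushforward mV mf' iV measurableT; rewrite preimage_setT => E.
  rewrite /Rintegral fineK; last exact: integrable_fin_num.
  rewrite -E; apply: eq_integral_setfun => A mA.
  by [].
Qed.

End limit_distribution.

(** * The conditional law given an exceedance *)

Section conditional_law.
Context d (T : measurableType d) {R : realType} (P : probability T R).

(** [S] may fail to be measurable: monotonicity and subadditivity of the outer measure do the
    work. *)
Lemma mu_ext_null_diff (S S' N : set T) : measurable S' -> measurable N -> P N = 0%E ->
  S `<=` S' `|` N -> S' `<=` S `|` N -> (P^*)%mu S = P S'.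
Proof.
move=> mS' mN PN SS' S'S; apply/eqP; rewrite eq_le; apply/andP; split.
  apply: (le_trans (le_mu_ext P SS')).
  rewrite measurable_mu_extE; last exact: measurableU.
  by have := measureU2 P mS' mN; rewrite -[X in (_ + X)%E]/(P N) PN adde0.
have h := le_mu_ext P S'S; rewrite measurable_mu_extE// in h.
apply: (le_trans h); apply: (le_trans (outer_measureU2 _ _ _)).
by rewrite -[X in (_ + X)%E]/((P^*)%mu N) (measurable_mu_extE P mN)
  -[X in (_ + X)%E]/(P N) PN adde0.
Qed.

Variable E : set T.
Hypotheses (mE : measurable E) (PE : 0 < fine (P E)).

Let p_ge0 : 0 <= (fine (P E))^-1.
Proof. by rewrite invr_ge0 ltW. Qed.

Definition cond_law : set T -> \bar R := mscale (NngNum p_ge0) (mrestr P mE).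

HB.instance Definition _ := Measure.on cond_law.

Let cond_lawT : cond_law setT = 1%E.
Proof.
rewrite /cond_law /mscale/= /mrestr setTI -[X in (_ * X)%E]fineK ?fin_num_measure//.
by rewrite -EFinM mulVf// gt_eqF.
Qed.

HB.instance Definition _ := Measure_isProbability.Build _ _ _ cond_law cond_lawT.

Definition cond_prob : probability T R := cond_law.

Lemma cond_probE A : cond_prob A = ((fine (P E))^-1%:E * P (A `&` E))%E.
Proof. by []. Qed.

End conditional_law.

(** * The law of the extremal range as a conditional law *)

Section extremal_law.
Context {R : realType} {d : nat} {dO : measure_display} {Omega : measurableType dO}.
Variables (P : probability Omega R) (X : 'rV[R]_d -> {RV P >-> R}).
Variable N0 : set Omega.
Hypotheses (mN0 : measurable N0) (PN0 : P N0 = 0%E).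
Hypothesis cX : forall w, ~ N0 w -> continuous (fun s => X s w).
Variable u : R.
Hypotheses (u0 : 0 < u) (PE : 0 < fine (P [set w | u < X 0 w])).

(** A measurable version of u R, with the range set to 0 on the null set where the paths may be
    discontinuous. *)
Definition scaled_range (w : Omega) : \bar R :=
  (u%:E * (if w \in N0 then 0%E else Rtilde X u 0 w))%E.

Lemma measurable_scaled_range : measurable_fun setT scaled_range.
Proof. by apply: measurable_funeM; exact: measurable_Rtilde. Qed.

Lemma scaled_range_ge0 w : (0 <= scaled_range w)%E.
Proof.
rewrite mule_ge0 ?lee_fin ?(ltW u0)//; case: ifP => // _; exact: Rtilde_ge0.
Qed.

Lemma scaled_range_gt (t : R) w : 0 < t -> ~ N0 w -> (t%:E < scaled_range w)%E <->
  exists2 rho, t < rho & forall s, enorm s <= rho -> u < X (u^-1 *: s) w.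
Proof.
move=> t0 nN; rewrite /scaled_range memNset//.
have tu0 : 0 <= t / u by rewrite divr_ge0 ?ltW.
rewrite (_ : (t%:E < u%:E * Rtilde X u 0 w)%E = ((t / u)%:E < Rtilde X u 0 w)%E); last first.
  by rewrite muleC -lte_pdivrMr.
have enormZ (a : R) (s : 'rV[R]_d) : 0 <= a -> enorm (a *: s) = a * enorm s.
  by move=> a0; rewrite /enorm -/(sqn _) sqnZ sqrtrM ?sqr_ge0// sqrtr_sqr ger0_norm.
have u1 : 0 < u^-1 by rewrite invr_gt0.
split=> [/(Rtilde_gt _ _ _ tu0)[rho trho B]|[rho trho B]].
  exists (u * rho); first by rewrite mulrC -ltr_pdivrMr.
  move=> s sr; apply: B; rewrite enormZ ?(ltW u1)// mulrC ler_pdivrMr// mulrC//.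
apply/(Rtilde_gt _ _ _ tu0); exists (rho / u); first by rewrite ltr_pM2r.
move=> s sr; have -> : s = u^-1 *: (u *: s) by rewrite scalerA mulVf ?scale1r// gt_eqF.
by apply: B; rewrite enormZ ?(ltW u0)// mulrC -ler_pdivlMr.
Qed.

Let mE : measurable [set w | u < X 0 w].
Proof. by apply: measurable_gt. Qed.

(** On Borel sets the outer measure changes nothing, since the two events differ by a null set. The
    law is thus that of [scaled_range] under the conditional probability, and [eq_integral_setfun]
    carries this over to integrals. *)
Lemma extremal_law_integral (f : \bar R -> R) : continuous f ->
  (exists M : R, forall x, `|f x| <= M) ->
  (\int[pushforward (extremal_range_law X u) (fun r : \bar R => u%:E * r)]_x (f x)%:E)%E =
  (\int[cond_prob mE PE]_w f (scaled_range w))%:E.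
Proof.
move=> cf [M fM]; have mf := measurable_continuous_ereal cf.
have mV := measurable_scaled_range.
have bf : bmf (fun w => f (scaled_range w)).
  by split; [exact: measurableT_comp|exists M].
have mf' : measurable_fun setT (EFin \o f) by exact/measurable_EFinP.
have iV : (cond_prob mE PE).-integrable (scaled_range @^-1` setT) ((EFin \o f) \o scaled_range).
  by rewrite preimage_setT; exact: bmf_integrable.
have := integral_pushforward mV mf' iV measurableT; rewrite preimage_setT => IE.
rewrite /Rintegral fineK; last exact: integrable_fin_num.
rewrite -IE; apply: eq_integral_setfun => A mA.
rewrite /pushforward /extremal_range_law.
have mS : measurable (scaled_range @^-1` A `&` [set w | u < X 0 w]).
  by apply: measurableI => //; rewrite -[X in measurable X]setTI; exact: mV.
rewrite (@mu_ext_null_diff _ _ _ P _ _ N0 mS mN0 PN0).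
- rewrite [RHS](cond_probE mE PE) [RHS]muleC; congr (_ * _)%E.
  by rewrite -[P _ in LHS]fineK ?fin_num_measure// inver gt_eqF.
- move=> w [Aw Ew]; have [Nw|nN] := pselect (N0 w); first by right.
  by left; split => //; rewrite /= /scaled_range memNset.
- move=> w [Aw Ew]; have [Nw|nN] := pselect (N0 w); first by right.
  by left; split => //; move: Aw; rewrite /= /scaled_range memNset.
Qed.

End extremal_law.

(** * Weak convergence from the survival limit *)

Theorem proposition2 (R : realType) (d : nat) (d_ge1 : (1 <= d)%N)
    (dO : measure_display) (Omega : measurableType dO) (P : probability Omega R)
    (X : 'rV[R]_d -> {RV P >-> R})
    (X_stationary : stationary X) (X_isotropic : isotropic X)
    (X_centered : centered X) (X_gaussian : gaussian_field X)
    (X_continuous : continuous_paths X)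
    (lambda : R) (lambda_gt0 : 0 < lambda)
    (X_cov : (fun h => covariance_fun X h - (1 - lambda / 2 * enorm h ^+ 2))
             =o_ (0 : 'rV[R]_d) (fun h => enorm h ^+ 2)) :
  exists nu : probability R R,
    non_degenerate nu /\
    weakly_converges
      (fun u : R => pushforward (extremal_range_law X u)
                                (fun r : \bar R => u%:E * r)%E)
      +oo%R (pushforward nu (@EFin R)).
Proof.
have [N [mN PN subN]] := X_continuous.
have cX w : ~ N w -> continuous (fun s => X s w).
  by move=> nN; apply: contrapT => nc; apply: nN; exact: subN.
have [H [H0 Hmono Hbound Hlip Hlim]] := survival_limit d_ge1 X_stationary X_isotropic
  X_centered X_gaussian lambda_gt0 X_cov mN PN cX.
have c0 : 0 <= Num.sqrt lambda * (1 + d%:R) by rewrite mulr_ge0 ?sqrtr_ge0.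
have [nu [nu_nd [V' [Q' [mV' V'0 V'H nuE]]]]] :=
  survival_distribution lambda_gt0 c0 H0 Hmono Hbound Hlip.
exists nu; split => // f cf fM; rewrite nuE//.
have [M fM'] := fM.
have Hsmall tau : 0 < tau -> exists2 B : R, 0 < B & H B <= tau.
  by move=> /(survival_small lambda_gt0 Hbound)[B B0 HB]; exists B => //; exact: HB.
have gL := field_gaussian_space X_gaussian X_centered.
have vX0 : cov P (X 0) (X 0) = 1.
  (* At h = 0 the bound of the little-o is 0, which forces the variance to be exactly 1. *)
  have /eqoP/(_ _ ltr01)/nbhs_ballP[r /= r0 Br] := X_cov.
  have := Br 0 (ballxx _ r0); rewrite /= sqnE /sqn big1; last first.
    by move=> i _; rewrite mxE expr0n.
  by rewrite mulr0 subr0 normr0 mulr0 normr_le0 subr_eq0 -covariance_funE => /eqP.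
have LX0 : field_space X (X 0) := field_spaceX X 0.
have close tau : 0 < tau -> exists2 U : R, 0 < U & forall u, U <= u ->
    exists2 y : R, (\int[pushforward (extremal_range_law X u) (fun r : \bar R => u%:E * r)]_x
        (f x)%:E)%E = y%:E &
      `|y - \int[Q']_x f (V' x)| <= tau.
  move=> tau0.
  have [ts [dl [dl0 ts0 Hclose]]] := survival_weak_close cf fM' mV' V'0 V'H Hsmall Omega tau0.
  (* [ts] is finite, so the thresholds of the survival limit at its points have a common upper
     bound. *)
  have [U U0 HU] : exists2 U : R, 0 < U & forall u, U <= u -> forall M' t, t \in ts ->
      measurable M' -> (forall w, ~ N w -> (M' w <-> exists2 rho, t < rho &
        forall s, enorm s <= rho -> u < X (u^-1 *: s) w)) ->
      `|fine (P ([set w | u < X 0 w] `&` M')) / gtail u - H t| <= dl.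
    elim: ts ts0 {Hclose} => [_|t ts IH ts0]; first by exists 1.
    have ts0' : {in ts, forall t, 0 < t}.
      by move=> t' t't; apply: ts0; rewrite inE t't orbT.
    have [U1 U10 HU1] := IH ts0'.
    have [U2 U20 HU2] := Hlim t dl (ts0 t (mem_head _ _)) dl0.
    exists (Num.max U1 U2); first by rewrite lt_max U10.
    move=> u; rewrite ge_max => /andP[uU1 uU2] M' t'; rewrite inE => /orP[/eqP ->|t'ts] mM' HM'.
      exact: (HU2 u uU2 M').
    exact: (HU1 u uU1 M').
  exists U => // u Uu; have u0 : 0 < u by exact: lt_le_trans Uu.
  have gE : fine (P [set w | u < X 0 w]) = gtail u := gspace_gtail gL LX0 vX0 u.
  have PE : 0 < fine (P [set w | u < X 0 w]) by rewrite gE gtail_gt0.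
  have := extremal_law_integral mN PN cX PE cf fM.
  set Q := cond_prob _ _ => ->.
  exists (\int[Q]_w f (scaled_range X N u w)) => //.
  have mV := measurable_scaled_range mN cX u.
  apply: Hclose => //; first by move=> w; exact: scaled_range_ge0.
  move=> t tts; have t0 := ts0 t tts.
  have mt : measurable [set w | (t%:E < scaled_range X N u w)%E].
    by rewrite -[X in measurable X]setTI; exact: emeasurable_fun_o_infty.
  rewrite [Q _](cond_probE _ PE) setIC.
  rewrite fineM//; last by rewrite fin_num_measure//; apply: measurableI => //; exact: measurable_gt.
  rewrite mulrC /= gE; apply: (HU u Uu) => // w nN.
  exact: scaled_range_gt.
(* Convergence in the extended reals reduces to real convergence once the integrals are finite for
   large u; the first goal is this finiteness. *)
apply: cvg_EFin.
  have [U U0 HU] := close 1 ltr01.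
  by exists U; split => [|u Uu]; [exact: num_real|have [y -> _] := HU u (ltW Uu)].
apply/cvgrPdist_le => tau tau0; have [U U0 HU] := close tau tau0.
exists U; split => [|u Uu]; first exact: num_real.
by have [y yE yl] := HU u (ltW Uu); rewrite /= yE distrC.
Qed.
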